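(* Let $V=V(x)$, $x\in[0,\infty)$, be a Lévy process, let $a_n,b_n\in\mathbb{R}$ with $a_n\neq0$, let $s_n>0$ with $s_n\to\infty$ as $n\to\infty$, and put $$X_n(x)=\frac{V(s_nx)}{a_n}-xb_n,\qquad x\in[0,1],\ n\in\mathbb{N}.$$ Let $0<\alpha\le2$ and let $Y_\alpha$ be an $\alpha$-stable Lévy process, with $\mu_\alpha$ the distribution of $Y_\alpha$ in $D[0,1]$. Suppose that for some $\beta>0$ the sequence $\left(s_n/n^{\beta}\right)$ is increasing, and that $X_n\xrightarrow{d}Y_\alpha$ as $n\to\infty$ in $D[0,1]$. Then, for almost all $\omega\in\Omega$, the measures $$Q_n(\omega)=\frac{1}{\ln n}\sum_{k=1}^{n}\frac1k\,\delta_{X_k(\omega)}$$ on $D[0,1]$ satisfy $Q_n(\omega)\xrightarrow{w}\mu_\alpha$ as $n\to\infty$.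
   Context: A Lévy process $V(t)$, $t\ge 0$, is a homogeneous, stochastically continuous random process with independent increments, $V(0)=0$, and trajectories in the Skorohod space (right-continuous with left limits). $(\Omega,\mathcal{A},P)$ is the probability space on which $V$ is defined. $D[0,1]$ is the Skorohod space with its usual metric, under which it is a complete separable metric space; processes are identified with the corresponding random elements of $D[0,1]$, so that $X_k(\omega)\in D[0,1]$ is the trajectory of $X_k$. $\delta_x$ is the unit mass at the point $x$; $\xrightarrow{w}$ denotes weak convergence of measures on $D[0,1]$ and $\xrightarrow{d}$ convergence in distribution. $Q_n(\omega)$ is considered for $n\ge2$. For $\alpha=2$, $Y_\alpha$ is a Gaussian Lévy process (a multiple of the Wiener process). *)

(* Defs.v *)
From HB Require Import structures.
From mathcomp Require Import all_boot all_order all_algebra.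
From mathcomp Require Import all_classical all_reals all_analysis.
From mathcomp Require Import ring lra.

Set Implicit Arguments.
Unset Strict Implicit.
Unset Printing Implicit Defensive.

Import Order.TTheory GRing.Theory Num.Theory.
Import numFieldNormedType.Exports.

Local Open Scope classical_set_scope.
Local Open Scope ring_scope.

(* At an endpoint of [A] the filter of a missing side contains [set0], so the
   corresponding condition is void. *)
Definition cadlag {R : realType} (A : set R) (f : R -> R) : Prop :=
  forall t, A t ->
    f u @[u --> within A t^'+] --> f t /\
    exists l : R, f u @[u --> within A t^'-] --> l.

Section cadlag_theory.
Context {R : realType}.
Implicit Types (A : set R) (f g : R -> R) (t l : R).

Lemma cvg_within_rightP A f t l :
  f u @[u --> within A t^'+] --> l <->
  forall e, 0 < e ->
    exists2 d, 0 < d & forall u, A u -> t < u -> u < t + d -> `|f u - l| < e.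
Proof.
split.
  move=> /cvgrPdist_lt cf e e0; have := cf e e0.
  rewrite near_withinE /at_right near_withinE.
  move=> /nbhs_ballP[d /= d0 H]; exists d => // u Au tu utd.
  rewrite distrC; apply: H => //=.
  by rewrite /ball/= ltr_norml; apply/andP; split; lra.
move=> H; apply/cvgrPdist_lt => e e0; have [d d0 {}H] := H e e0.
rewrite near_withinE /at_right near_withinE; apply/nbhs_ballP; exists d => //= u.
rewrite /ball/= ltr_norml => /andP[? ?] tu Au.
by rewrite distrC; apply: H => //; lra.
Qed.

Lemma cvg_within_leftP A f t l :
  f u @[u --> within A t^'-] --> l <->
  forall e, 0 < e ->
    exists2 d, 0 < d & forall u, A u -> t - d < u -> u < t -> `|f u - l| < e.
Proof.
split.
  move=> /cvgrPdist_lt cf e e0; have := cf e e0.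
  rewrite near_withinE /at_left near_withinE.
  move=> /nbhs_ballP[d /= d0 H]; exists d => // u Au tu utd.
  rewrite distrC; apply: H => //=.
  by rewrite /ball/= ltr_norml; apply/andP; split; lra.
move=> H; apply/cvgrPdist_lt => e e0; have [d d0 {}H] := H e e0.
rewrite near_withinE /at_left near_withinE; apply/nbhs_ballP; exists d => //= u.
rewrite /ball/= ltr_norml => /andP[? ?] tu Au.
by rewrite distrC; apply: H => //; lra.
Qed.

Lemma cadlag_sub A B f g : B `<=` A -> {in B, f =1 g} -> cadlag A f ->
  cadlag B g.
Proof.
move=> BA fg cf t Bt; have [/cvg_within_rightP fr [l /cvg_within_leftP fl]] :=
  cf t (BA _ Bt).
split; last exists l.
  apply/cvg_within_rightP => e /fr[d d0 H]; exists d => // u Bu tu utd.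
  by rewrite -!fg ?inE//; apply: H => //; exact: BA.
apply/cvg_within_leftP => e /fl[d d0 H]; exists d => // u Bu tu utd.
by rewrite -!fg ?inE//; apply: H => //; exact: BA.
Qed.

Lemma cadlag_cst A c : cadlag A (fun=> c).
Proof. by move=> t At; split; [|exists c]; exact: cvg_cst. Qed.

Lemma cadlag_affine f (s a b : R) : 0 < s ->
  cadlag [set t | 0 <= t] f ->
  cadlag `[0, 1]%classic (fun x => f (s * x) / a - x * b).
Proof.
move=> s0 cf t /=; rewrite in_itv/= => /andP[t0 t1].
have st0 : 0 <= s * t by rewrite mulr_ge0// ltW.
have [/cvg_within_rightP fr [l /cvg_within_leftP fl]] := cf (s * t) st0.
split; [|exists (l / a - t * b)].
- apply: cvgB; last first.
    apply: cvgM; last exact: cvg_cst.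
    apply/cvg_within_rightP => e e0; exists e => // u _ ? ?.
    by rewrite ltr_norml; apply/andP; split; lra.
  apply: cvgM; last exact: cvg_cst.
  apply/cvg_within_rightP => e /fr[d d0 H].
  exists (d / s); first by rewrite divr_gt0.
  move=> u /=; rewrite in_itv/= => /andP[u0 u1] tu utd; apply: H.
  + by rewrite /= mulr_ge0// ltW.
  + by rewrite ltr_pM2l.
  + by rewrite mulrC -ltr_pdivlMr// mulrDl [s * t]mulrC mulfK// gt_eqF.
- apply: cvgB; last first.
    apply: cvgM; last exact: cvg_cst.
    apply/cvg_within_leftP => e e0; exists e => // u _ ? ?.
    by rewrite ltr_norml; apply/andP; split; lra.
  apply: cvgM; last exact: cvg_cst.
  apply/cvg_within_leftP => e /fl[d d0 H].
  exists (d / s); first by rewrite divr_gt0.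
  move=> u /=; rewrite in_itv/= => /andP[u0 u1] tu utd; apply: H.
  + by rewrite /= mulr_ge0// ltW.
  + by rewrite [ltRHS]mulrC -ltr_pdivrMr// mulrBl [s * t]mulrC mulfK// gt_eqF.
  + by rewrite ltr_pM2l.
Qed.

Lemma cadlag_bounded f : cadlag `[0, 1]%classic f ->
  exists M, forall t, 0 <= t <= 1 -> `|f t| <= M.
Proof.
move=> cf.
have cpt : compact `[(0 : R), 1]%classic by exact: segment_compact.
move/compact_near_coveringP : cpt.
move=> /(_ _ (pinfty_nbhs R) (fun M t => 0 <= t <= 1 -> `|f t| <= M)) H.
have {}H : \forall M \near +oo, `[0, 1]%classic `<=`
    [set t | 0 <= t <= 1 -> `|f t| <= M].
  apply: H => t tI; have [/cvg_within_rightP/(_ 1 ltr01)[d1 d10 H1]] := cf t tI.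
  move=> [l /cvg_within_leftP/(_ 1 ltr01)[d2 d20 H2]].
  exists (ball (t : R) (Num.min d1 d2),
          [set M | `|f t| + 1 + (`|l| + 1) <= M]).
    split => /=; first by apply: nbhsx_ballx; rewrite lt_min d10.
    exact: nbhs_pinfty_ge.
  move=> [u M] /= []; rewrite /ball/= ltr_norml lt_min ltrNl lt_min.
  move=> /andP[/andP[? ?] /andP[? ?]] lM uI.
  have ? := normr_ge0 (f t); have ? := normr_ge0 l.
  have uI' : `[0, 1]%classic u by rewrite /= in_itv.
  have [ut|tu|->] := ltgtP u t; last by lra.
  - have := ler_normD (f u - l) l; rewrite subrK => ?.
    by have := H2 u uI' ltac:(lra) ut; lra.
  - have := ler_normD (f u - f t) (f t); rewrite subrK => ?.
    by have := H1 u uI' tu ltac:(lra); lra.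
have [M HM] : exists M, `[0, 1]%classic `<=`
    [set t | 0 <= t <= 1 -> `|f t| <= M] by exact: (@filter_ex _ (pinfty_nbhs R)).
by exists M => t tI; apply: HM => //=; rewrite in_itv.
Qed.

End cadlag_theory.

(* The Skorohod space D[0,1]; a path is encoded by its extension by 0 outside
   of [0,1], so that equality of elements is equality on [0,1]. *)
Record skorohod (R : realType) := Skorohod {
  skorohod_fun :> R -> R ;
  skorohod_cadlag : cadlag `[0, 1]%classic skorohod_fun ;
  skorohod_out : forall t, ~ `[0, 1]%classic t -> skorohod_fun t = 0 }.

Section skorohod_type.
Context {R : realType}.

Lemma skorohod_ext (f g : skorohod R) :
  (forall t, 0 <= t <= 1 -> f t = g t) -> f = g.
Proof.
case: f g => [f cf of_] [g cg og] /= fg.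
have {}fg : f = g.
  apply/funext => t; have [tI|tI] := boolP (0 <= t <= 1); first exact: fg.
  by rewrite of_ ?og//= in_itv/=; exact/negP.
by move: cg og; rewrite -fg => cg og; congr Skorohod; exact: Prop_irrelevance.
Qed.

HB.instance Definition _ := gen_eqMixin (skorohod R).
HB.instance Definition _ := gen_choiceMixin (skorohod R).
HB.instance Definition _ := isPointed.Build (skorohod R)
  (@Skorohod R (fun=> 0) (cadlag_cst 0) (fun _ _ => erefl)).

Program Definition skorohod_restrict (f : R -> R)
    (cf : cadlag `[0, 1]%classic f) : skorohod R :=
  @Skorohod R (f \_ `[0, 1]%classic) _ _.
Next Obligation.
move=> f cf; apply: cadlag_sub cf => // t tI.
by rewrite patchE tI.
Qed.
Next Obligation. by move=> f cf t tI; rewrite patchE memNset. Qed.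

End skorohod_type.

Section skorohod_metric.
Context {R : realType}.
Implicit Types (l : R -> R) (f g h : skorohod R).

(* An increasing bijection of [0,1] is automatically a homeomorphism. *)
Definition time_change l : Prop :=
  l @` `[0, 1]%classic = `[0, 1]%classic /\
  (forall t u, 0 <= t -> t < u -> u <= 1 -> l t < l u).

(* sup over t < u of |log of the slope of [l] between t and u| *)
Definition log_distortion l : \bar R :=
  ereal_sup [set (`|ln ((l p.2 - l p.1) / (p.2 - p.1))|)%:E
            | p in [set p : R * R | [/\ 0 <= p.1, p.1 < p.2 & p.2 <= 1]]].

(* Billingsley's metric d^o, for which D[0,1] is complete and separable. *)
Definition skorohod_dist f g : R :=
  fine (ereal_inf
    [set maxe (log_distortion l)
              (ereal_sup [set (`|f t - g (l t)|)%:E | t in `[0, 1]%classic])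
    | l in time_change]).

Let close f g (e : R) l : Prop :=
  [/\ time_change l,
      forall t u, 0 <= t -> t < u -> u <= 1 ->
        `|ln ((l u - l t) / (u - t))| <= e &
      forall t, 0 <= t <= 1 -> `|f t - g (l t)| <= e].

Let cost f g l := maxe (log_distortion l)
  (ereal_sup [set (`|f t - g (l t)|)%:E | t in `[0, 1]%classic]).

Let costP f g e l : time_change l -> (cost f g l <= e%:E)%E <-> close f g e l.
Proof.
move=> tl; rewrite /cost ge_max; split.
  move=> /andP[/ereal_supP le1 /ereal_supP le2]; split => //.
    move=> t u t0 tu u1; rewrite -lee_fin; apply: le1.
    by exists (t, u).
  by move=> t t01; rewrite -lee_fin; apply: le2; exists t => //=; rewrite in_itv.
move=> [_ le1 le2]; apply/andP; split; apply/ereal_supP.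
  by move=> _ [[t u] /= [t0 tu u1] <-]; rewrite lee_fin; exact: le1.
by move=> _ [t /= tI <-]; rewrite lee_fin; apply: le2; rewrite in_itv in tI.
Qed.

Let time_change_id : time_change id.
Proof. by split; [rewrite image_id|]. Qed.

Let cost_ge0 f g l : (0 <= cost f g l)%E.
Proof.
rewrite /cost le_max; apply/orP; right.
apply: (@le_trans _ _ (`|f 0 - g (l 0)|%:E)%E); first by rewrite lee_fin.
by apply: ereal_sup_ubound; exists 0 => //=; rewrite in_itv/= lexx ler01.
Qed.

Let D f g := ereal_inf [set cost f g l | l in time_change].

Let D_ge0 f g : (0 <= D f g)%E.
Proof. by apply: le_ereal_inf_tmp => _ [l _ <-]; exact: cost_ge0. Qed.

Let D_fin f g : D f g \is a fin_num.
Proof.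
rewrite ge0_fin_numE//.
have [M fM] := cadlag_bounded (@skorohod_cadlag _ f).
have [N gN] := cadlag_bounded (@skorohod_cadlag _ g).
apply: (@le_lt_trans _ _ (M + N)%:E); last by rewrite ltry.
have f0 : 0 <= M by apply: le_trans (fM 0 _); rewrite ?lexx ?ler01.
have g0 : 0 <= N by apply: le_trans (gN 0 _); rewrite ?lexx ?ler01.
apply: (@le_trans _ _ (cost f g id)).
  by apply: ereal_inf_lbound; exists id.
apply/costP => //; split => //.
  move=> t u t0 tu u1; rewrite divff ?subr_eq0 ?gt_eqF// ln1 normr0.
  by rewrite addr_ge0.
move=> t t01; apply: le_trans (ler_normB _ _) _.
by apply: lerD; [exact: fM|exact: gN].
Qed.

Let distP f g e : skorohod_dist f g < e <->
  exists l e', e' < e /\ close f g e' l.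
Proof.
have -> : (skorohod_dist f g < e) = (D f g < e%:E)%E.
  by rewrite -(fineK (D_fin f g)) lte_fin.
split.
  move=> /ereal_inf_lt[_ [l tl <-]] le.
  have cfin : cost f g l \is a fin_num.
    by rewrite ge0_fin_numE//; apply: lt_trans le _; rewrite ltry.
  exists l, (fine (cost f g l)); split; first by rewrite -lte_fin fineK.
  by apply/costP => //; rewrite fineK.
move=> [l [e' [e'e cl]]]; have [tl _ _] := cl.
apply: (@le_lt_trans _ _ (cost f g l)).
  by apply: ereal_inf_lbound; exists l.
by apply: (@le_lt_trans _ _ e'%:E); rewrite ?lte_fin//; apply/costP.
Qed.

Let dist_ge0 f g : 0 <= skorohod_dist f g.
Proof. exact/fine_ge0/D_ge0. Qed.

Let close_id f : close f f 0 id.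
Proof.
split => //.
  by move=> t u t0 tu u1; rewrite divff ?subr_eq0 ?gt_eqF// ln1 normr0.
by move=> t _; rewrite subrr normr0.
Qed.

Let distxx f : skorohod_dist f f = 0.
Proof.
apply/eqP; rewrite eq_le dist_ge0 andbT; apply/ler_addgt0Pl => e e0.
by rewrite addr0; apply/ltW/distP; exists id, 0.
Qed.

Let time_change_in l t : time_change l -> 0 <= t <= 1 -> 0 <= l t <= 1.
Proof.
move=> [li _] tI.
have : (l @` `[0, 1]%classic) (l t) by exists t => //=; rewrite in_itv.
by rewrite li /= in_itv.
Qed.

Let close_comp f g h d e l m : close f g d l -> close g h e m ->
  close f h (d + e) (m \o l).
Proof.
move=> [tl l1 l2] [tm m1 m2].
have [li lm] := tl; have [mi mm] := tm.
split.
- split; first by rewrite -image_comp li mi.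
  move=> t u t0 tu u1 /=; apply: mm; [|exact: lm|].
  + have /andP[//] : 0 <= l t <= 1 by apply: time_change_in => //; lra.
  + have /andP[//] : 0 <= l u <= 1 by apply: time_change_in => //; lra.
- move=> t u t0 tu u1 /=.
  have ltu := lm t u t0 tu u1.
  have /andP[lt0 _] : 0 <= l t <= 1 by apply: time_change_in => //; lra.
  have /andP[_ lu1] : 0 <= l u <= 1 by apply: time_change_in => //; lra.
  have mtu := mm _ _ lt0 ltu lu1.
  have -> : (m (l u) - m (l t)) / (u - t) =
      ((m (l u) - m (l t)) / (l u - l t)) * ((l u - l t) / (u - t)).
    by rewrite mulrA divfK// subr_eq0 gt_eqF.
  rewrite lnM ?posrE ?divr_gt0 ?subr_gt0// addrC.
  apply: le_trans (ler_normD _ _) _; apply: lerD; first exact: l1.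
  exact: m1.
- move=> t tI /=.
  rewrite -[f t](subrK (g (l t))) -addrA.
  apply: le_trans (ler_normD _ _) _; apply: lerD; first exact: l2.
  by apply: m2; exact: time_change_in.
Qed.

Let time_change_inv l : time_change l ->
  exists2 m, time_change m &
    forall t, 0 <= t <= 1 -> 0 <= m t <= 1 /\ l (m t) = t.
Proof.
move=> tl; have [li lm] := tl.
have linj t u : 0 <= t <= 1 -> 0 <= u <= 1 -> l t = l u -> t = u.
  move=> /andP[? ?] /andP[? ?] ltu; have [tu|ut|//] := ltgtP t u.
    by have := lm t u ltac:(lra) tu ltac:(lra); rewrite ltu ltxx.
  by have := lm u t ltac:(lra) ut ltac:(lra); rewrite ltu ltxx.
have /choice[m mP] : forall t, exists u,
    0 <= t <= 1 -> 0 <= u <= 1 /\ l u = t.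
  move=> t; have [tI|tI] := boolP (0 <= t <= 1); last by exists 0.
  have : `[0, 1]%classic t by rewrite /= in_itv.
  by rewrite -li => -[u /=]; rewrite in_itv/= => uI <-; exists u.
exists m => //; split.
- apply/seteqP; split => [_ [t /= + <-]|t /=]; rewrite !in_itv/= => tI.
    by have [] := mP t tI.
  exists (l t).
    by rewrite /= in_itv; exact: time_change_in.
  have [mI lmE] := mP (l t) (time_change_in tl tI).
  exact: linj.
- move=> t u t0 tu u1; rewrite ltNge; apply/negP => mut.
  have [/andP[_ mt1] ltE] := mP t ltac:(lra).
  have [/andP[mu0 _] luE] := mP u ltac:(lra).
  have [/eqP|lt] := eqVneq (m u) (m t).
    by move=> /eqP e; move: tu; rewrite -ltE -luE e ltxx.
  have {}lt : m u < m t by rewrite lt_neqAle lt.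
  by have := lm _ _ mu0 lt mt1; rewrite ltE luE; lra.
Qed.

Let close_sym f g e l : close f g e l -> exists m, close g f e m.
Proof.
move=> [tl l1 l2]; have [m tm mP] := time_change_inv tl.
exists m; split => //.
- move=> t u t0 tu u1.
  have mtu := tm.2 t u t0 tu u1.
  have [/andP[mt0 _] lt] := mP t ltac:(lra).
  have [/andP[_ mu1] lu] := mP u ltac:(lra).
  have := l1 _ _ mt0 mtu mu1.
  by rewrite lt lu -invf_div lnV ?normrN// posrE divr_gt0// subr_gt0.
- move=> t tI; have [mI lmt] := mP t tI.
  by rewrite distrC -{2}lmt; exact: l2.
Qed.

Let dist_sym f g : skorohod_dist f g = skorohod_dist g f.
Proof.
wlog : f g / skorohod_dist f g < skorohod_dist g f => [H|].
  by have [/H//|/H//|] := ltgtP (skorohod_dist f g) (skorohod_dist g f).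
move=> /distP[l [e [eg /close_sym[m cm]]]].
suff : skorohod_dist g f < skorohod_dist g f by rewrite ltxx.
by apply/distP; exists m, e.
Qed.

Let dist_triangle g f h :
  skorohod_dist f h <= skorohod_dist f g + skorohod_dist g h.
Proof.
apply/ler_addgt0Pl => e e0; apply/ltW.
have /distP[l [e1 [le1 cl]]] : skorohod_dist f g < skorohod_dist f g + e / 2.
  by lra.
have /distP[m [e2 [le2 cm]]] : skorohod_dist g h < skorohod_dist g h + e / 2.
  by lra.
apply/distP; exists (m \o l), (e1 + e2); split; first by lra.
exact: close_comp cl cm.
Qed.

Let time_change1 l : time_change l -> l 1 = 1.
Proof.
move=> tl; have [m tm mP] := time_change_inv tl.
have [/andP[m0 m1] lm1] := mP 1 ltac:(lra).
have [m1E|lt] := eqVneq (m 1) 1; first by rewrite -[LHS](congr1 l m1E).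
have {}lt : m 1 < 1 by rewrite lt_neqAle lt.
have := tl.2 _ _ m0 lt (lexx 1); rewrite lm1.
have /andP[_ ?] : 0 <= l 1 <= 1 by apply: time_change_in => //; lra.
by lra.
Qed.

Let time_change0 l : time_change l -> l 0 = 0.
Proof.
move=> tl; have [m tm mP] := time_change_inv tl.
have [/andP[m0 m1] lm0] := mP 0 ltac:(lra).
have [m0E|lt] := eqVneq 0 (m 0); first by rewrite [LHS](congr1 l m0E).
have {}lt : 0 < m 0 by rewrite lt_neqAle lt.
have := tl.2 _ _ (lexx 0) lt m1; rewrite lm0.
have /andP[? _] : 0 <= l 0 <= 1 by apply: time_change_in => //; lra.
by lra.
Qed.

(* A small distortion keeps [l] uniformly close to the identity. *)
Let close_near_id f g l d e : 0 < d -> e <= ln (1 + d) -> close f g e l ->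
  forall t, 0 <= t <= 1 -> `|l t - t| <= d.
Proof.
move=> d0 ed [tl l1 _] t /andP[t0 t1].
have [->|tn0] := eqVneq t 0; first by rewrite time_change0// subrr normr0 ltW.
have {tn0}t0' : 0 < t by rewrite lt_neqAle eq_sym tn0.
have := l1 _ _ (lexx 0) t0' t1; rewrite time_change0// !subr0 => le.
have lt0 : 0 < l t by have := tl.2 _ _ (lexx 0) t0' t1; rewrite time_change0.
have q0 : 0 < l t / t by rewrite divr_gt0.
have := le_trans le ed; rewrite ler_norml => /andP[].
rewrite -lnV ?posrE ?addr_gt0//.
rewrite !ler_ln ?posrE ?invr_gt0 ?addr_gt0//.
rewrite ler_pdivlMr// ler_pdivrMr// => lo up.
have {}lo : t <= (1 + d) * l t.
  by rewrite -ler_pdivrMl ?addr_gt0.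
have /andP[_ lt1] : 0 <= l t <= 1 by apply: time_change_in => //; lra.
rewrite ler_norml; apply/andP; split; nra.
Qed.

Let dist0_values f g t d e : skorohod_dist f g = 0 -> 0 <= t <= 1 ->
  0 < d -> 0 < e ->
  exists u, [/\ 0 <= u <= 1, `|u - t| <= d & `|f t - g u| <= e].
Proof.
move=> fg tI d0 e0.
have ld : 0 < ln (1 + d) by rewrite ln_gt0// ltrDl.
have /distP[l [e' [le cl]]] : skorohod_dist f g < Num.min e (ln (1 + d)).
  by rewrite fg lt_min e0.
move: le; rewrite lt_min => /andP[e'e e'd].
have [tl _ cv] := cl.
exists (l t); split; first exact: time_change_in.
  by apply: close_near_id cl _ tI => //; exact: ltW.
by apply: le_trans (cv t tI) _; exact: ltW.
Qed.


Let dist0_left f g t d e : skorohod_dist f g = 0 -> 0 <= t <= 1 ->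
  f t != g t -> 0 < d -> 0 < e ->
  exists u, [/\ 0 <= u, t - d < u, u < t & `|f t - g u| < e].
Proof.
move=> fg tI fgt d0 e0.
have tI' : `[0, 1]%classic t by rewrite /= in_itv.
have r0 : 0 < `|f t - g t| by rewrite normr_gt0 subr_eq0.
have [/cvg_within_rightP gr _] := @skorohod_cadlag _ g t tI'.
set r := `|f t - g t| in r0.
have [d1 d10 {}gr] := gr (r / 2) ltac:(lra).
pose d' := Num.min d d1 / 2; pose e' := Num.min e r / 2.
have m0 : 0 < Num.min d d1 by rewrite lt_min d0.
have n0 : 0 < Num.min e r by rewrite lt_min e0.
have [md md1] : Num.min d d1 <= d /\ Num.min d d1 <= d1.
  by rewrite !ge_min !lexx orbT.
have [me mr] : Num.min e r <= e /\ Num.min e r <= r.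
  by rewrite !ge_min !lexx orbT.
have [u [uI]] := @dist0_values f g t d' e' fg tI ltac:(rewrite /d'; lra)
  ltac:(rewrite /e'; lra).
rewrite ler_norml /d' /e' => /andP[u1 u2] fu.
have [ut|tu|ute] := ltgtP u t.
- by exists u; split => //; [case/andP: uI|lra|lra].
- exfalso.
  have := gr u _ tu ltac:(lra); rewrite /= in_itv => /(_ uI) gu.
  by have := ler_distD (g u) (f t) (g t); rewrite -/r; lra.
- by exfalso; move: fu; rewrite ute -/r; lra.
Qed.

Let dist_positivity f g : skorohod_dist f g = 0 -> f = g.
Proof.
move=> fg; apply: skorohod_ext => t tI.
have tI' : `[0, 1]%classic t by rewrite /= in_itv.
apply/eqP/negPn/negP => fgt.
have [t1|t1] := eqVneq t 1.
  move: fgt; rewrite t1 -subr_eq0 -normr_gt0 => r0.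
  move: (r0); rewrite -fg => /distP[l [e [le [tl _ cv]]]].
  by have := cv 1 ltac:(lra); rewrite (time_change1 tl) leNgt le.
have {}t1 : t < 1 by rewrite lt_neqAle t1; case/andP: tI.
have r0 : 0 < `|f t - g t| by rewrite normr_gt0 subr_eq0.
set r := `|f t - g t| in r0.
have [/cvg_within_rightP/(_ (r / 4) ltac:(lra))[d1 d10 fr] _] :=
  @skorohod_cadlag _ f t tI'.
have [/cvg_within_rightP/(_ (r / 4) ltac:(lra))[d2 d20 gr] _] :=
  @skorohod_cadlag _ g t tI'.
pose d := Num.min (Num.min d1 d2) (1 - t).
have d0 : 0 < d by rewrite !lt_min d10 d20; lra.
have [dd1 dd2 d3] : [/\ d <= d1, d <= d2 & d <= 1 - t].
  by split; rewrite /d !ge_min lexx ?orbT.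
have far u : t < u -> u < t + d -> r / 2 < `|f u - g u|.
  move=> tu utd.
  have uI : `[0, 1]%classic u.
    by rewrite /= in_itv/=; case/andP: tI => ? ?; apply/andP; split; lra.
  have := fr u uI tu ltac:(lra); have := gr u uI tu ltac:(lra).
  have := ler_distD (f u) (f t) (g t); have := ler_distD (g u) (f u) (g t).
  by rewrite -/r (distrC (f t) (f u)); lra.
pose s := t + d / 2.
have sI : `[0, 1]%classic s.
  by rewrite /= in_itv/= /s; case/andP: tI => ? ?; apply/andP; split; lra.
have [_ [L /cvg_within_leftP/(_ (r / 16) ltac:(lra))[d4 d40 gl]]] :=
  @skorohod_cadlag _ g s sI.
pose m := Num.min d4 (d / 2).
have m0 : 0 < m by rewrite lt_min d40; lra.
have [m4 md] : m <= d4 /\ m <= d / 2 by rewrite /m !ge_min !lexx orbT.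
pose u := s - m / 2.
have tu : t < u by rewrite /u /s; lra.
have us : u < s by rewrite /u; lra.
have uI : 0 <= u <= 1.
  by move: sI; rewrite /= in_itv/=; case/andP: tI => ? ? /andP[? ?];
    apply/andP; split; lra.
have fu := far u tu ltac:(rewrite /s in us; lra).
have fgu : f u != g u by rewrite -subr_eq0 -normr_gt0; lra.
have [v [v0 uv vu fgv]] := @dist0_left f g u (m / 2) (r / 16) fg uI fgu
  ltac:(lra) ltac:(lra).
have gu : `|g u - L| < r / 16.
  by apply: gl => //; rewrite /u; lra.
have gv : `|g v - L| < r / 16.
  apply: gl; [|by rewrite /u in uv; lra|by lra].
  by rewrite /= in_itv/=; case/andP: uI => ? ?; apply/andP; split; lra.
have := ler_distD (g v) (f u) (g u); have := ler_distD L (g v) (g u).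
by rewrite (distrC L (g u)); lra.
Qed.

HB.instance Definition _ := @isMetric.Build R (skorohod R) skorohod_dist
  distxx dist_positivity dist_sym dist_triangle.

HB.instance Definition _ := @isMeasurable.Build
  (sigma_display (@open (skorohod R))) (skorohod R)
  <<s @open (skorohod R) >> (@sigma_algebra0 _ setT _)
  (@sigma_algebraC _ (@open (skorohod R)))
  (@sigma_algebra_bigcup _ setT _).

End skorohod_metric.

(* [mu_] and [mu] are the set functions of measures on the Borel
   sigma-algebra; they are not bundled so that laws of random paths,
   [pushforward P X], can be used directly. *)
Definition weak_cvg {R : realType} (mu_ : nat -> set (skorohod R) -> \bar R)
    (mu : set (skorohod R) -> \bar R) : Prop :=
  forall F : skorohod R -> R, continuous F ->
    (exists M, forall x, `|F x| <= M) ->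
    (\int[mu_ n]_x (F x)%:E @[n --> \oo] --> \int[mu]_x (F x)%:E)%E.

Definition cvg_in_distribution {R : realType} {d d' : measure_display}
    {T : measurableType d} {T' : measurableType d'}
    (P : probability T R) (P' : probability T' R)
    (X : nat -> T -> skorohod R) (Y : T' -> skorohod R) : Prop :=
  weak_cvg (fun n => pushforward P (X n)) (pushforward P' Y).

Section levy.
Context {d : measure_display} {T : measurableType d} {R : realType}.
Variable P : probability T R.

Definition mutually_independent n (X : 'I_n -> T -> R) : Prop :=
  forall B : 'I_n -> set R, (forall i, measurable (B i)) ->
    P [set w | forall i, B i (X i w)] =
    (\prod_(i < n) P [set w | B i (X i w)])%E.

Definition independent_increments (V : T -> R -> R) : Prop :=
  forall n (t : nat -> R), 0 <= t 0%N -> {homo t : i j / (i <= j)%N >-> i <= j} ->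
    mutually_independent (fun (i : 'I_n) w => V w (t i.+1) - V w (t i)).

Definition homogeneous_increments (V : T -> R -> R) : Prop :=
  forall (t h : R) (B : set R), 0 <= t -> 0 <= h -> measurable B ->
    P [set w | B (V w (t + h) - V w t)] = P [set w | B (V w h - V w 0)].

Definition stochastically_continuous (V : T -> R -> R) : Prop :=
  forall t e : R, 0 <= t -> 0 < e ->
    P [set w | e < `|V w u - V w t|] @[u --> within [set u | 0 <= u] (nbhs t)]
      --> 0%E.

(* Only the values at times t >= 0 are meaningful. *)
Record levy_process := LevyProcess {
  levy_path :> T -> R -> R ;
  levy_measurable : forall t, 0 <= t ->
    measurable_fun [set: T] (fun w => levy_path w t) ;
  levy0 : forall w, levy_path w 0 = 0 ;
  levy_cadlag : forall w, cadlag [set t | 0 <= t] (levy_path w) ;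
  levy_indep : independent_increments levy_path ;
  levy_homogeneous : homogeneous_increments levy_path ;
  levy_stoch_continuous : stochastically_continuous levy_path }.

(* With X1, X2 independent copies of X, realized on the product space:
   A X1 + B X2 and (A^alpha + B^alpha)^(1/alpha) X + D have the same law. *)
Definition stable_rv (alpha : R) (X : T -> R) : Prop :=
  forall A B : R, 0 < A -> 0 < B -> exists D : R,
    forall U : set R, measurable U ->
      (P \x P)%E [set w | U (A * X w.1 + B * X w.2)] =
      P [set w | U ((A `^ alpha + B `^ alpha) `^ alpha^-1 * X w + D)].

Definition stable_levy_process (alpha : R) (Y : levy_process) : Prop :=
  stable_rv alpha (fun w => Y w 1).

Implicit Types (V Y : levy_process).

Lemma levy_cadlag01 Y w : cadlag `[0, 1]%classic (Y w).
Proof.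
apply: cadlag_sub (levy_cadlag Y w) => // t /=.
by rewrite in_itv/= => /andP[].
Qed.

Definition levy_restrict Y (w : T) : skorohod R :=
  skorohod_restrict (levy_cadlag01 Y w).

Lemma levy_rescale_cadlag V (s : {posnum R}) (a b : R) w :
  cadlag `[0, 1]%classic (fun x => V w (s%:num * x) / a - x * b).
Proof. by apply: cadlag_affine => //; exact: levy_cadlag. Qed.

Definition levy_rescale V (s : {posnum R}) (a b : R) (w : T) : skorohod R :=
  skorohod_restrict (levy_rescale_cadlag V s a b w).

End levy.

Section log_average.
Context {R : realType}.

Lemma inv_ln_ge0 (n : nat) : 0 <= (ln n%:R)^-1 :> R.
Proof.
rewrite invr_ge0; case: n => [|n]; first by rewrite ln0.
by rewrite ln_ge0// ler1n.
Qed.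

(* The average of \d_(x k), 1 <= k <= n, with weights 1 / (k ln n); the zero
   measure for n <= 1. *)
Definition log_average (x : nat -> skorohod R) (n : nat) :
    {measure set (skorohod R) -> \bar R} :=
  mscale (NngNum (inv_ln_ge0 n))
    (msum (fun k => mscale ((k.+1%:R : R)^-1)%:nng (\d_(x k.+1))) n).

End log_average.

(* Main.v *)
Require Import Defs.
From HB Require Import structures.
From mathcomp Require Import all_boot all_order all_algebra.
From mathcomp Require Import all_classical all_reals all_analysis.
From mathcomp Require Import measurable_realfun ring lra.
Import Order.TTheory GRing.Theory Num.Theory.
Import numFieldNormedType.Exports.
Local Open Scope classical_set_scope.
Local Open Scope ring_scope.
Set Implicit Arguments.
Unset Strict Implicit.
Unset Printing Implicit Defensive.

(** Write [X_k] for the path of index [k], [H_n] for the harmonic sum [hsum n],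
    and [havg] for averages with the weights [1/k] normalised by [H_n].  As
    [H_n / ln n] tends to 1, weak convergence of the measures at a given outcome
    amounts to convergence of [havg] of [F (X_k)] to the mean of [F] under the
    limit law, for every bounded continuous [F].  The exceptional null set must
    not depend on [F], so countably many [F] have to suffice: paths that are
    step functions on a regular grid with rational values are dense
    ([discretize_cvg]), hence every nonnegative continuous function is a limit
    from below of maxima of finitely many rational bumps ([bump_max_cvg]), and
    bounding the limit from below for [M + F] and [M - F] is enough
    ([havg_weak_cvg], [weak_cvg_log_average]).  These test functions are bounded
    and Lipschitz.

    For such an [F] the expectations of [F (X_k)] converge by hypothesis, and
    what remains is a strong law for logarithmic averages.  A second moment
    bound of order [H_n ^ (3/2)] for the weighted sums suffices: it makes the
    averages converge along indices with [H_n] close to [p ^ 4], and between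
    these the averages hardly move ([havg_strong_law]).

    The variables [F (X_k)] are all dependent because each path starts at time
    0.  Let [phi l] be the index for which the window of indices from [phi l]
    to [l] has total weight at most about [sqrt H_l] ([cut_index_ex]), and
    remove from [X_l] all that [V] does before the largest time seen by the
    paths of index below [phi l].  The trimmed paths [X'_k] and [X'_l] are then functions of
    increments of [V] over disjoint time intervals as soon as [k < phi l]
    ([expectM_path_after]), so only pairs in a common window contribute to the
    second moment, which is therefore of order [H_n * sqrt H_n]
    ([windowed_second_moment]).

    Trimming must be harmless.  The growth of [s] makes the removed fraction of
    the time interval at most [exp (- beta * sqrt H_l)].  The key estimate
    ([uniform_initial_tail]) is that the probability that [X_l] exceeds [e]
    somewhere on [[0, h]] is at most [C * h], with the same [C] for all large
    [l].  Indeed the limit is continuous at 0, so on some interval [[0, h0]]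
    all [X_l] with large [l] stay small with probability at least one half;
    [[0, h0]] splits into about [h0 / h] blocks with independent identically
    distributed displacements, and if each were large with probability more than
    [2 * h / h0] then some block would be large with probability more than one
    half ([prob_exceeds_le]); Ottaviani's inequality passes from the
    endpoint to the supremum ([prob_grid_exceeds_le], [prob_sup_exceeds_le]).
    The events on which trimming moves [X_l] by more than [e] thus have
    probability [O (1 / H_l ^ 2)], which is summable against the weights, and
    their indicators have vanishing logarithmic averages
    ([havg_indic_ae]). *)

(** * The Skorohod distance *)

Section skorohod_distance.
Context {R : realType}.
Implicit Types (f g h : skorohod R) (l : R -> R) (e t u : R).

Lemma time_change_itv l t : time_change l -> 0 <= t <= 1 -> 0 <= l t <= 1.
Proof.
move=> [li _] tI; have : (l @` `[0, 1]%classic) (l t).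
  by exists t => //=; rewrite in_itv.
by rewrite li /= in_itv.
Qed.

Lemma time_change_at0 l : time_change l -> l 0 = 0.
Proof.
move=> tl; have [li lm] := tl.
have : `[0, 1]%classic (0 : R) by rewrite /= in_itv /= lexx ler01.
rewrite -li => -[t /=]; rewrite in_itv /= => /andP[t0 t1] lt0.
have [t_eq|tn] := eqVneq t 0; first by rewrite -[in LHS]t_eq.
have {}tn : 0 < t by rewrite lt_neqAle eq_sym tn.
have := lm _ _ (lexx 0) tn t1; rewrite lt0.
have /andP[? _] : 0 <= l 0 <= 1.
  by apply: time_change_itv; rewrite // lexx ler01.
lra.
Qed.

(** With [skorohod_dist_lt], this trades the infimum that defines the distance
    for one time change, pointwise bounds in hand. *)
Lemma skorohod_dist_le f g l e : time_change l ->
  (forall t u, 0 <= t -> t < u -> u <= 1 ->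
     `|ln ((l u - l t) / (u - t))| <= e) ->
  (forall t, 0 <= t <= 1 -> `|f t - g (l t)| <= e) ->
  mdist f g <= e.
Proof.
move=> tl le1 le2; rewrite -[mdist f g]/(skorohod_dist f g) /skorohod_dist.
set D := ereal_inf _; suff De : (D <= e%:E)%E.
  have e0 : 0 <= e.
    by apply: le_trans (normr_ge0 _) (le2 0 _); rewrite lexx ler01.
  case: D De => //= r; by rewrite lee_fin.
apply: ereal_inf_le; exists (maxe (log_distortion l)
   (ereal_sup [set (`|f t - g (l t)|)%:E | t in `[0, 1]%classic])).
  by exists l.
rewrite ge_max; apply/andP; split; apply/ereal_supP.
  by move=> _ [[t u] /= [t0 tu u1] <-]; rewrite lee_fin; exact: le1.
by move=> _ [t /= tI <-]; rewrite lee_fin; apply: le2; rewrite in_itv in tI.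
Qed.

Lemma skorohod_dist_le_uniform f g e :
  (forall t, 0 <= t <= 1 -> `|f t - g t| <= e) -> mdist f g <= e.
Proof.
move=> fg; apply: (@skorohod_dist_le _ _ id) => //.
  by split => //; rewrite image_id.
move=> t u t0 tu u1; rewrite divff ?subr_eq0 ?gt_eqF// ln1 normr0.
by apply: le_trans (normr_ge0 _) (fg 0 _); rewrite lexx ler01.
Qed.

Lemma skorohod_dist_lt f g e : mdist f g < e ->
  exists2 l, time_change l &
    (forall t u, 0 <= t -> t < u -> u <= 1 ->
       `|ln ((l u - l t) / (u - t))| < e) /\
    (forall t, 0 <= t <= 1 -> `|f t - g (l t)| < e).
Proof.
rewrite -[mdist f g]/(skorohod_dist f g) /skorohod_dist.
set S := [set _ | _ in _]; move=> De.
have Sfin : exists2 M : R, (ereal_inf S <= M%:E)%E & (0%R%:E <= ereal_inf S)%E.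
  have [M fM] := cadlag_bounded (@skorohod_cadlag _ f).
  have [N gN] := cadlag_bounded (@skorohod_cadlag _ g).
  have I0 : 0 <= (0 : R) <= 1 by rewrite lexx ler01.
  exists (M + N).
    apply: ereal_inf_le; eexists; first by exists id; [split => //; rewrite image_id|].
    rewrite ge_max; apply/andP; split; apply/ereal_supP.
      move=> _ [[t u] /= [t0 tu u1] <-]; rewrite lee_fin divff ?subr_eq0 ?gt_eqF//.
      rewrite ln1 normr0; apply: addr_ge0; apply: le_trans (normr_ge0 _) _.
        exact: (fM 0).
      exact: (gN 0).
    move=> _ [t /= tI <-]; rewrite lee_fin; rewrite in_itv in tI.
    by apply: le_trans (ler_normB _ _) _; rewrite lerD ?fM ?gN.
  apply: le_ereal_inf_tmp => _ [l tl <-]; rewrite le_max; apply/orP; right.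
  apply: (@le_trans _ _ (`|f 0 - g (l 0)|%:E)%E); first by rewrite lee_fin.
  by apply: ereal_sup_ubound; exists 0 => //=; rewrite in_itv/= lexx ler01.
have {De} : (ereal_inf S < e%:E)%E.
  case: Sfin De => M; case: (ereal_inf S) => //= r _ _; by rewrite lte_fin.
move=> /ereal_inf_lt[_ [l tl <-]]; rewrite gt_max => /andP[l1 l2].
exists l => //; split.
  move=> t u t0 tu u1; rewrite -lte_fin; apply: le_lt_trans l1.
  by apply: ereal_sup_ubound; exists (t, u).
move=> t tI; rewrite -lte_fin; apply: le_lt_trans l2.
by apply: ereal_sup_ubound; exists t => //=; rewrite in_itv.
Qed.

(** A time change within log-distortion [ln 2] at most doubles the time elapsed
    since 0. *)
Lemma time_change_le_double l : time_change l ->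
  (forall t u, 0 <= t -> t < u -> u <= 1 ->
     `|ln ((l u - l t) / (u - t))| < ln 2) ->
  forall t, 0 <= t <= 1 -> l t <= 2 * t.
Proof.
move=> tl le t /andP[t0 t1].
have [->|tn0] := eqVneq t 0; first by rewrite (time_change_at0 tl) mulr0.
have {tn0}t0' : 0 < t by rewrite lt_neqAle eq_sym tn0.
have := le _ _ (lexx 0) t0' t1; rewrite (time_change_at0 tl) !subr0 => {}le.
have lt0 : 0 < l t.
  by have := tl.2 _ _ (lexx 0) t0' t1; rewrite (time_change_at0 tl).
have q0 : 0 < l t / t by rewrite divr_gt0.
move: le; rewrite ltr_norml => /andP[_].
by rewrite ltr_ln ?posrE// ltr_pdivrMr// => /ltW.
Qed.

End skorohod_distance.

(** * Density of step paths *)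

Section cadlag_discretization.
Context {R : realType}.
Implicit Types (f : R -> R) (e t u : R).

(** The supremum of the right ends that admit a partition is such an end by the
    left limit there, and could be moved further to the right by
    right-continuity if it were less than 1. *)
Lemma cadlag_partition f e : cadlag `[0, 1]%classic f -> 0 < e ->
  exists n (p : nat -> R),
    [/\ p 0%N = 0, p n = 1, forall i, (i < n)%N -> p i < p i.+1 &
        forall i x y, (i < n)%N -> p i <= x < p i.+1 -> p i <= y < p i.+1 ->
          `|f x - f y| <= e].
Proof.
move=> cf e0.
pose good c := 0 <= c <= 1 /\ exists n (p : nat -> R),
    [/\ p 0%N = 0, p n = c, forall i, (i < n)%N -> p i < p i.+1 &
        forall i x y, (i < n)%N -> p i <= x < p i.+1 -> p i <= y < p i.+1 ->
          `|f x - f y| <= e].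
suff [_ H] : good 1 by exact: H.
have extend c d' : good c -> c < d' -> d' <= 1 ->
    (forall x y, c <= x < d' -> c <= y < d' -> `|f x - f y| <= e) -> good d'.
  move=> [/andP[c0 c1] [n [p [p0 pn pm pv]]]] cd d1 cv; split.
    by apply/andP; split => //; lra.
  exists n.+1, (fun i => if (i <= n)%N then p i else d'); split => //.
  - by rewrite ltnn.
  - move=> i; rewrite ltnS => i_n; rewrite i_n.
    have [i_lt|n_i] := ltnP i n; first exact: pm.
    by rewrite (_ : i = n) ?pn//; apply/eqP; rewrite eqn_leq i_n n_i.
  - move=> i x y; rewrite ltnS => i_n; rewrite i_n.
    have [i_lt|n_i] := ltnP i n; first exact: pv.
    by rewrite (_ : i = n) ?pn; [exact: cv|apply/eqP; rewrite eqn_leq i_n n_i].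
have good0 : good 0.
  by split; [rewrite lexx ler01|exists 0%N, (fun=> 0)].
have hs : has_sup good by split; [exists 0|exists 1 => x [/andP[]]].
pose c := sup good.
have c0 : 0 <= c by apply: (ub_le_sup hs.2).
have c1 : c <= 1 by apply: ge_sup => //; [exists 0|move=> x [/andP[]]].
have cI : `[0, 1]%classic c by rewrite /= in_itv /= c0 c1.
have [/cvg_within_rightP fr [l /cvg_within_leftP fl]] := cf c cI.
have goodc : good c.
  have [d d0 {}fl] := fl (e / 2) ltac:(lra).
  have [c' gc' dc'] := sup_adherent d0 hs.
  have : c' <= c by apply: (ub_le_sup hs.2).
  rewrite le_eqVlt => /predU1P[<-//|c'c]; apply: (extend c') => //.
  have [/andP[c'0 _] _] := gc'.
  move=> x y /andP[x1 x2] /andP[y1 y2].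
  have := fl x _ _ x2; have := fl y _ _ y2.
  rewrite /= !in_itv /= -/c in dc' *.
  move=> /(_ ltac:(apply/andP; split; lra) ltac:(lra)).
  move=> + /(_ ltac:(apply/andP; split; lra) ltac:(lra)).
  by have := ler_distD l (f x) (f y); rewrite (distrC l (f y)); lra.
move: c1; rewrite le_eqVlt => /predU1P[<-//|c1]; exfalso.
have [d d0 {}fr] := fr (e / 2) ltac:(lra).
pose c' := Num.min (c + d) 1.
have c'd : c' <= c + d /\ c' <= 1 by rewrite /c' !ge_min !lexx orbT.
have cc' : c < c' by rewrite /c' lt_min c1 andbT; lra.
have : good c'.
  apply: (extend c) => //; first by lra.
  have near_c x : c <= x < c' -> `|f x - f c| <= e / 2.
    move=> /andP[]; rewrite le_eqVlt => /predU1P[<- _|cx xc'].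
      by rewrite subrr normr0; lra.
    apply/ltW/fr => //; last by lra.
    by rewrite /= in_itv/=; apply/andP; split; lra.
  move=> x y /near_c ? /near_c ?.
  by have := ler_distD (f c) (f x) (f y); rewrite (distrC (f c) (f y)); lra.
by move=> gc'; have := ub_le_sup hs.2 gc'; rewrite -/c; lra.
Qed.

(** McShane's extension: the lower envelope of the cones [c i + L * |t - u i|];
    the hypothesis says that each cone lies above the prescribed values. *)
Lemma lipschitz_extension n (u c : nat -> R) (L : R) : 0 <= L ->
  (forall i j, (i <= n)%N -> (j <= n)%N -> `|c i - c j| <= L * `|u i - u j|) ->
  exists2 phi : R -> R, (forall x y, `|phi x - phi y| <= L * `|x - y|) &
    forall i, (i <= n)%N -> phi (u i) = c i.
Proof.
move=> L0 cL.
have /choice[phi phiP] : forall t, exists v,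
    (exists i : 'I_n.+1, v = c i + L * `|t - u i|) /\
    forall j : 'I_n.+1, v <= c j + L * `|t - u j|.
  move=> t; pose i0 := [arg min_(i < (ord0 : 'I_n.+1)) (c i + L * `|t - u i|)]%O.
  exists (c i0 + L * `|t - u i0|); split; first by exists i0.
  by rewrite /i0; case: arg_minP => // i _ H j; exact: H.
exists phi.
  suff H x y : phi x - phi y <= L * `|x - y|.
    move=> x y; rewrite ler_norml lerNl opprB H andbT distrC; exact: H.
  have [[i ->] _] := phiP y; have [_ /(_ i)] := phiP x.
  have := ler_distD y x (u i) => tri /le_trans H.
  rewrite lerBlDr; apply: H; rewrite addrCA lerD2l -mulrDr.
  exact: ler_wpM2l.
move=> i i_n; have [[j vj] /(_ (Ordinal (i_n : (i < n.+1)%N)))] := phiP (u i).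
rewrite /= subrr normr0 mulr0 addr0 => le; apply/eqP.
rewrite eq_le le vj /=; have := cL i j i_n (ltn_ord j).
by rewrite ler_norml => /andP[_]; lra.
Qed.

Lemma abs_ln_near1 (L x : R) : 0 <= L -> L <= 2^-1 -> 1 - L <= x <= 1 + L ->
  `|ln x| <= 2 * L.
Proof.
move=> L0 L1 /andP[x1 x2]; have x0 : 0 < x by lra.
rewrite ler_norml; apply/andP; split; last first.
  by have := @le_ln1Dx R (x - 1) ltac:(lra); rewrite addrC subrK; lra.
rewrite lerNl -lnV ?posrE//.
have xV : 0 < x^-1 by rewrite invr_gt0.
have := @le_ln1Dx R (x^-1 - 1) ltac:(lra); rewrite addrC subrK => /le_trans; apply.
have : x * x^-1 = 1 by rewrite mulfV// gt_eqF.
nra.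
Qed.

Lemma cadlag_step (c : nat -> R) (M : nat) : (0 < M)%N ->
  cadlag `[0, 1]%classic (fun t : R => c (Num.truncn (M%:R * t))).
Proof.
move=> M0 t /=; rewrite in_itv /= => /andP[t0 t1].
have MR : 0 < M%:R :> R by rewrite ltr0n.
have Mt0 : 0 <= M%:R * t by rewrite mulr_ge0// ltW.
have /andP[tl tr] := truncn_itv Mt0; set j := Num.truncn _ in tl tr.
split; last first.
  have [jt|jt] := eqVneq (j%:R : R) (M%:R * t); last first.
    exists (c j); apply/cvg_within_leftP => e e0.
    exists (t - j%:R / M%:R) => [|u _ ut1 ut].
      by rewrite subr_gt0 ltr_pdivrMr// mulrC lt_neqAle jt.
    rewrite (_ : Num.truncn _ = j) ?subrr ?normr0//; apply: truncn_def.
    have : j%:R / M%:R < u by lra.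
    rewrite ltr_pdivrMr// mulrC => /ltW -> /=.
    by apply: lt_trans tr; rewrite ltr_pM2l.
  case: j jt tl tr => [|k] jt tl tr.
    exists 0; apply/cvg_within_leftP => e e0; exists 1 => // u.
    rewrite /= in_itv /= => /andP[u0 _] _ ut.
    have : M%:R * u < M%:R * t by rewrite ltr_pM2l.
    by rewrite -jt ltNge mulr_ge0// ltW.
  exists (c k); apply/cvg_within_leftP => e e0.
  exists (M%:R^-1) => [|u _ ut1 ut]; first by rewrite invr_gt0.
  rewrite (_ : Num.truncn _ = k) ?subrr ?normr0//; apply: truncn_def.
  rewrite jt ltr_pM2l// ut andbT.
  have : M%:R * (t - M%:R^-1) < M%:R * u by rewrite ltr_pM2l.
  by rewrite mulrBr mulfV ?gt_eqF// -jt -natr1 addrK => /ltW.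
apply/cvg_within_rightP => e e0.
exists (j.+1%:R / M%:R - t) => [|u _ tu ut].
  by rewrite subr_gt0 ltr_pdivlMr// mulrC.
rewrite (_ : Num.truncn (M%:R * u) = j) ?subrr ?normr0//; apply: truncn_def.
rewrite (le_trans tl) ?ler_pM2l//=; last exact: ltW.
have : u < j.+1%:R / M%:R by lra.
by rewrite ltr_pdivlMr// mulrC.
Qed.

(** Step paths with jumps at multiples of [1 / m.+1] and values that are
    multiples of the same number; there are countably many of them. *)
Definition step_path (m : nat) (z : seq int) : skorohod R :=
  skorohod_restrict
    (@cadlag_step (fun i => (nth 0 z i)%:~R / m.+1%:R) m.+1 (ltn0Sn m)).

Definition discretize (m : nat) (f : R -> R) : seq int :=
  mkseq (fun i => Num.floor (m.+1%:R * f (i%:R / m.+1%:R))) m.+2.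

Lemma step_path_discretize m f t : 0 <= t <= 1 ->
  `|step_path m (discretize m f) t -
    f ((Num.truncn (m.+1%:R * t))%:R / m.+1%:R)| <= m.+1%:R^-1.
Proof.
move=> /andP[t0 t1].
have MR : 0 < m.+1%:R :> R by rewrite ltr0n.
have Mt0 : 0 <= m.+1%:R * t by rewrite mulr_ge0// ltW.
rewrite /= patchE mem_set /=; last by rewrite /= in_itv /= t0 t1.
set j := Num.truncn _.
have jm : (j < m.+2)%N.
  rewrite truncn_lt_nat//; apply: (@le_lt_trans _ _ m.+1%:R).
    by rewrite ler_piMr// ltW.
  by rewrite ltr_nat.
rewrite nth_mkseq//; set y := f _.
have /andP[f1 f2] := floor_itv (m.+1%:R * y).
rewrite intrD in f2.
set z : R := (Num.floor _)%:~R in f1 f2 *.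
have -> : z / m.+1%:R - y = (z - m.+1%:R * y) / m.+1%:R.
  by rewrite mulrBl mulrAC mulfV ?mul1r// gt_eqF.
rewrite normrM [X in _ * X]ger0_norm ?invr_ge0 ?(ltW MR)//.
rewrite ler_piMl ?invr_ge0 ?(ltW MR)// ler_norml; apply/andP; split; lra.
Qed.

(** The points [p i] between which [f] hardly varies need not lie on the grid.
    The time change [id - phi] carries the first grid point [u i] from [p i] on
    back to [p i], after which the step path and [f] are compared on matching
    pieces.  Its slopes are close to 1: [phi] interpolates the differences
    [u i - p i], which are at most the mesh, at points whose distances are
    bounded below. *)
Lemma discretize_cvg (f : skorohod R) :
  mdist (step_path m (discretize m f)) f @[m --> \oo] --> (0 : R).
Proof.
apply/cvgrPdist_le => e e0.
have [n [p [p0 pn pm pv]]] := cadlag_partition (@skorohod_cadlag _ f)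
  (ltac:(lra) : 0 < e / 2).
have [dl dl0 dlP] : exists2 dl, 0 < dl & forall i, (i < n)%N -> dl <= p i.+1 - p i.
  elim: (n) pm => [|k IH] pm; first by exists 1.
  have [dl dl0 dlP] := IH (fun i ik => pm i (ltnW ik)).
  exists (Num.min dl (p k.+1 - p k)); first by rewrite lt_min dl0 subr_gt0 pm.
  move=> i; rewrite ltnS leq_eqVlt => /predU1P[->|ik].
    by rewrite ge_min lexx orbT.
  by rewrite ge_min dlP.
have gap i j : (i < j)%N -> (j <= n)%N -> p i + dl <= p j.
  elim: j => // j IH; rewrite ltnS leq_eqVlt => /predU1P[->|ij] jn.
    by have := dlP _ jn; lra.
  by have := IH ij (ltnW jn); have := dlP _ jn; lra.
have p_ge0 i : (i <= n)%N -> 0 <= p i.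
  by case: i => [|i] i_n; [rewrite p0|have := gap 0%N i.+1 isT i_n; lra].
(* a value of [m.+1] beyond which the mesh meets the four bounds below *)
pose K := (2 / dl) * (2 + 2 * e^-1) + 2 * e^-1 + dl^-1.
have eV : 0 < e^-1 by rewrite invr_gt0.
have dV : 0 < dl^-1 by rewrite invr_gt0.
near=> m.
rewrite sub0r normrN ger0_norm ?mdist_ge0//.
have MR : 0 < m.+1%:R :> R by rewrite ltr0n.
set r := m.+1%:R^-1 : R.
have r0 : 0 < r by rewrite invr_gt0.
have r1 : m.+1%:R * r = 1 by rewrite mulfV// gt_eqF.
have [r_dl r_e r_L r_Le] : [/\ 2 * r <= dl, 2 * r <= e, 2 / dl * r <= 2^-1 &
    2 * (2 / dl * r) <= e].
  have KM : K <= m.+1%:R.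
    by near: m; exists (Num.truncn K) => // m /= Km;
      rewrite (le_trans (ltW (truncnS_gt K)))// ler_nat ltnS.
  have Kr : K * r <= 1 by rewrite -r1 ler_pM2r.
  have dd : dl * dl^-1 = 1 by rewrite mulfV// gt_eqF.
  have ee : e * e^-1 = 1 by rewrite mulfV// gt_eqF.
  have h1 : 0 <= dl^-1 * r by rewrite mulr_ge0// ltW.
  have h2 : 0 <= e^-1 * r by rewrite mulr_ge0// ltW.
  have h3 : 0 <= dl^-1 * e^-1 * r by rewrite mulr_ge0// ltW// mulr_gt0.
  have KE : 4 * (dl^-1 * r) + 4 * (dl^-1 * e^-1 * r) + 2 * (e^-1 * r) +
     dl^-1 * r = K * r by rewrite /K; ring.
  rewrite -KE in Kr.
  split.
  - have -> : 2 * r = dl * (2 * (dl^-1 * r)).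
      by rewrite mulrCA [dl * _]mulrA dd mul1r.
    by rewrite -[leRHS]mulr1 ler_pM2l//; lra.
  - have -> : 2 * r = e * (2 * (e^-1 * r)).
      by rewrite mulrCA [e * _]mulrA ee mul1r.
    by rewrite -[leRHS]mulr1 ler_pM2l//; lra.
  - by lra.
  - have -> : 2 * (2 / dl * r) = e * (4 * (dl^-1 * e^-1 * r)).
      have -> : e * (4 * (dl^-1 * e^-1 * r)) = (e * e^-1) * (4 * (dl^-1 * r)).
        by ring.
      by rewrite ee; ring.
    by rewrite -[leRHS]mulr1 ler_pM2l//; lra.
pose N i := `|Num.ceil (m.+1%:R * p i)|%N.
have NP i : (i <= n)%N -> m.+1%:R * p i <= (N i)%:R < m.+1%:R * p i + 1.
  move=> i_n; have /andP[c1 c2] := ceil_itv (m.+1%:R * p i).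
  have : 0 <= Num.ceil (m.+1%:R * p i).
    by rewrite ceil_ge0; have := mulr_ge0 (ltW MR) (p_ge0 i i_n); lra.
  rewrite /N -[(absz _)%:R]/((Posz (absz _))%:~R) => c0.
  rewrite gez0_abs//; rewrite intrD in c1.
  by rewrite c2 /=; lra.
pose u i : R := (N i)%:R / m.+1%:R.
have NE i : (N i)%:R = m.+1%:R * u i by rewrite mulrC divfK// gt_eqF.
have uP i : (i <= n)%N -> p i <= u i < p i + r.
  move=> i_n; have := NP i i_n; rewrite NE.
  rewrite -[X in _ < _ + X]r1 -mulrDr ler_pM2l// ltr_pM2l//.
have u0 : u 0%N = 0.
  have := NP 0%N (leq0n n); rewrite p0 mulr0 add0r => /andP[_].
  rewrite -[X in _ < X](_ : 1%:R = 1)// ltr_nat ltnS leqn0 => /eqP.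
  by rewrite /u => ->; rewrite mul0r.
have un : u n = 1.
  have := NP n (leqnn n); rewrite pn mulr1 natr1 ler_nat ltr_nat ltnS.
  by rewrite -eqn_leq /u => /eqP <-; rewrite mulfV// gt_eqF.
have L0 : 0 <= 2 / dl * r by rewrite mulr_ge0// ltW// divr_gt0.
have [|phi phiL phiE] := @lipschitz_extension n u (fun i => u i - p i) _ L0.
  have wlog_lt i j : (i < j)%N -> (j <= n)%N ->
      `|u i - p i - (u j - p j)| <= 2 / dl * r * `|u i - u j|.
    move=> ij jn; have := gap i j ij jn.
    have /andP[? ?] := uP i (ltnW (leq_trans ij jn)).
    have /andP[? ?] := uP j jn => gapij.
    have far : dl / 2 <= u j - u i by lra.
    apply: (@le_trans _ _ r); first by rewrite ler_norml; apply/andP; split; lra.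
    rewrite distrC ger0_norm; last by lra.
    have {1}-> : r = 2 / dl * r * (dl / 2) by field; rewrite gt_eqF.
    exact: ler_wpM2l.
  move=> i j i_n jn; have [ij|ji|->] := ltngtP i j.
  - exact: wlog_lt.
  - by rewrite distrC (distrC (u i)); exact: wlog_lt.
  - by rewrite !subrr normr0 mulr0.
set L := 2 / dl * r in L0 phiL r_L r_Le.
pose l t := t - phi t.
have lu i : (i <= n)%N -> l (u i) = p i by move=> i_n; rewrite /l phiE//; ring.
have slope x y : x < y -> (1 - L) * (y - x) <= l y - l x <= (1 + L) * (y - x).
  move=> xy; have := phiL y x; rewrite (ger0_norm (ltac:(lra) : 0 <= y - x)).
  by rewrite ler_norml /l => /andP[? ?]; apply/andP; split; nra.
have lm x y : x < y -> l x < l y.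
  by move=> xy; have := slope _ _ xy => /andP[+ _]; nra.
have lm' x y : x <= y -> l x <= l y.
  by rewrite le_eqVlt => /predU1P[->//|/lm/ltW].
have l0 : l 0 = 0 by rewrite -u0 lu// p0.
have l1 : l 1 = 1 by rewrite -un lu// pn.
have tl : time_change l.
  split; last by move=> x y _ xy _; exact: lm.
  apply/seteqP; split => [_ [t /= + <-]|t /=]; rewrite !in_itv /= => /andP[t0 t1].
    by rewrite -l0 -[X in _ <= _ <= X]l1 !lm'.
  have [||c cI lc] := @IVT R l 0 1 t ler01.
  - apply: continuous_subspaceT => x; apply/cvgrPdist_le => e' e'0.
    near=> y; have -> : l x - l y = (x - y) - (phi x - phi y) by rewrite /l; ring.
    apply: le_trans (ler_normB _ _) _; have := phiL x y.
    have : `|x - y| <= e' / 2.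
      by near: y; apply: (@cvgr_dist_le _ _ _ _ _ _ x) => //; rewrite divr_gt0.
    by have := normr_ge0 (x - y); nra.
  - by rewrite l0 l1 minEle ler01 maxEle ler01 t0.
  - by exists c => //=; move: cI; rewrite !in_itv.
apply: (skorohod_dist_le tl).
  move=> x y x0 xy y1; apply: (le_trans _ r_Le); apply: abs_ln_near1 => //.
  have yx : 0 < y - x by lra.
  by rewrite ler_pdivlMr// ler_pdivrMr//; exact: slope.
move=> t tI; have /andP[t0 t1] := tI.
apply: le_trans (ler_distD (f ((Num.truncn (m.+1%:R * t))%:R / m.+1%:R)) _ _) _.
suff fosc : `|f ((Num.truncn (m.+1%:R * t))%:R / m.+1%:R) - f (l t)| <= e / 2.
  have := step_path_discretize m f tI; rewrite -/r => h.
  apply: le_trans (lerD h fosc) _; lra.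
move: t1; rewrite le_eqVlt => /predU1P[->|t1].
  by rewrite mulr1 natrK mulfV ?gt_eqF// l1 subrr normr0; lra.
have [i i_n /andP[ut tu]] : exists2 i, (i < n)%N & u i <= t < u i.+1.
  have : t < u n by rewrite un.
  elim: (n) => [|k IH]; first by rewrite u0 ltNge t0.
  have [tk _|kt tk] := ltP t (u k); last by exists k => //; rewrite kt.
  by have [i ik iP] := IH tk; exists i => //; exact: ltnW.
have Mt0 : 0 <= m.+1%:R * t by rewrite mulr_ge0// ltW.
apply: (pv i) => //.
- set j := Num.truncn _.
  have /andP[N1 N2] := NP i.+1 i_n.
  apply/andP; split.
    apply: (@le_trans _ _ (u i)); first by case/andP: (uP i (ltnW i_n)).
    rewrite ler_pM2r ?invr_gt0// ler_nat truncn_ge_nat// NE.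
    by rewrite ler_pM2l.
  rewrite ltr_pdivrMr// mulrC.
  have : (j < N i.+1)%N by rewrite truncn_lt_nat// NE ltr_pM2l.
  by rewrite -(ler_nat R) -natr1; lra.
- by rewrite -!lu ?(ltnW i_n)// lm' ?lm.
Unshelve. all: by end_near. Qed.

End cadlag_discretization.

(** * Lipschitz functionals and distances to sets *)

Section metric_functionals.
Context {R : realType} {M : metricType R}.
Implicit Types (A : set M) (x y : M) (F : M -> R).

Lemma lipschitz_continuous F (K : R) :
  (forall x y, `|F x - F y| <= K * mdist x y) -> continuous F.
Proof.
move=> FK x; apply/cvgrPdist_lt => e e0.
have K0 : 0 < `|K| + 1 by rewrite ltr_wpDl.
apply/nbhs_ballP; exists (e / (`|K| + 1)) => /=; first by rewrite divr_gt0.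
move=> y; rewrite ballEmdist /= ltr_pdivlMr// => xy.
apply: le_lt_trans (FK x y) _; apply: le_lt_trans xy.
rewrite mulrC ler_wpM2l ?mdist_ge0// (le_trans (ler_norm K))//.
by rewrite lerDl.
Qed.

Lemma continuous_mdist_cvg F (u : nat -> M) x : continuous F ->
  mdist (u n) x @[n --> \oo] --> (0 : R) -> F (u n) @[n --> \oo] --> F x.
Proof.
move=> cF ux; apply: (@continuous_cvg _ _ _ \oo _ u F x); first exact: cF.
apply/cvg_ballP => e e0; move/cvgrPdist_lt : ux => /(_ e e0).
apply: filterS => n; rewrite ballEmdist /= metric_sym sub0r normrN.
by rewrite ger0_norm ?mdist_ge0.
Qed.

Lemma mdist_lip z x y : `|mdist z x - mdist z y| <= mdist x y.
Proof.
have := metric_triangle z x y; have := metric_triangle z y x.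
rewrite (metric_sym y x) => ? ?.
by rewrite ler_norml; apply/andP; split; lra.
Qed.

Definition set_dist A x : R := inf [set mdist x y | y in A].

Let set_dist_lb A x : has_lbound [set mdist x y | y in A].
Proof. by exists 0 => _ [y _ <-]; exact: mdist_ge0. Qed.

Lemma set_dist_le A x y : A y -> set_dist A x <= mdist x y.
Proof. by move=> Ay; apply: ge_inf => //; exists y. Qed.

Lemma set_dist_ge A x r : A !=set0 -> (forall y, A y -> r <= mdist x y) ->
  r <= set_dist A x.
Proof.
move=> [y Ay] rA; apply: lb_le_inf; first by exists (mdist x y); exists y.
by move=> _ [z Az <-]; exact: rA.
Qed.

Lemma set_dist_lip A : A !=set0 ->
  forall x y, `|set_dist A x - set_dist A y| <= 1 * mdist x y.
Proof.
move=> A0; suff H x y : set_dist A x - set_dist A y <= mdist x y.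
  by move=> x y; rewrite mul1r ler_norml lerNl opprB H andbT metric_sym H.
rewrite lerBlDr -lerBlDl; apply: set_dist_ge => // z Az.
rewrite lerBlDl; apply: le_trans (set_dist_le x Az) _.
exact: metric_triangle.
Qed.

End metric_functionals.

(** * Measurability of functionals of a path *)

Section skorohod_measurability.
Context {R : realType} {d : measure_display} {T : measurableType d}.
Variable X : T -> skorohod R.

Section grid.
Variable m : nat.
Hypothesis mX : forall i, (i <= m.+1)%N ->
  measurable_fun setT (fun w => X w (i%:R / m.+1%:R)).

Lemma measurable_discretize (z : seq int) :
  measurable [set w | discretize m (X w) = z].
Proof.
have MR : 0 < m.+1%:R :> R by rewrite ltr0n.
rewrite (_ : [set _ | _] = \bigcap_(i in [set i | (i < m.+2)%N])
    [set w | size z = m.+2 /\ Num.floor (m.+1%:R * X w (i%:R / m.+1%:R)) = nth 0 z i]).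
  apply: bigcap_measurable => [|i /= im]; first by exists 0%N.
  have [sz|sz] := eqVneq (size z) m.+2; last first.
    rewrite (_ : [set _ | _] = set0)//.
    by apply/seteqP; split => // w /= [/eqP]; rewrite (negbTE sz).
  rewrite (_ : [set _ | _] = (fun w => m.+1%:R * X w (i%:R / m.+1%:R)) @^-1`
      `[(nth 0 z i)%:~R, (nth 0 z i + 1)%:~R[%classic).
    rewrite -[X in measurable X]setTI; apply: measurable_funM => //.
    exact: mX.
  apply/seteqP; split => w /=; rewrite in_itv /=.
    by move=> [_ <-]; exact: floor_itv.
  by move=> zi; split => //; apply: floor_def.
apply/seteqP; split => w /=.
  move=> <- i im; split; first exact: size_mkseq.
  by rewrite /discretize nth_mkseq.
move=> H; have [sz _] := H 0%N isT; apply: (@eq_from_nth _ 0).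
  by rewrite sz; exact: size_mkseq.
move=> i; rewrite [X in (i < X)%N](size_mkseq _ _) /discretize => im; rewrite nth_mkseq//; by have [] := H i im.
Qed.

(** A discretized path takes countably many values, so [F] is arbitrary. *)
Lemma measurable_step_path (F : skorohod R -> R) :
  measurable_fun setT (fun w => F (step_path m (discretize m (X w)))).
Proof.
move=> _ B mB; rewrite setTI (_ : _ @^-1` B = \bigcup_(z : seq int)
    [set w | B (F (step_path m z)) /\ discretize m (X w) = z]).
  apply: countable_bigcupT_measurable => // z.
  have [Bz|Bz] := pselect (B (F (step_path m z))).
    rewrite (_ : [set _ | _] = [set w | discretize m (X w) = z]).
      exact: measurable_discretize.
    by apply/seteqP; split => [w []|].
  by rewrite (_ : [set _ | _] = set0)//; apply/seteqP; split => // w [].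
apply/seteqP; split => [w /= Bw|w [z _ /= [Bz zE]]]; last by rewrite zE.
by exists (discretize m (X w)).
Qed.

End grid.

Hypothesis mX : forall t, 0 <= t <= 1 -> measurable_fun setT (fun w => X w t).

(** The values at all times generate enough: by density of step paths, [F] of
    the path is a limit of functions of its values at finitely many times. *)
Lemma measurable_continuous_comp (F : skorohod R -> R) : continuous F ->
  measurable_fun setT (fun w => F (X w)).
Proof.
move=> cF; apply: (@measurable_fun_cvg _ _ _ _
    (fun m w => F (step_path m (discretize m (X w))))) => [m|w _].
  apply: measurable_step_path => i im; apply: mX.
  by rewrite divr_ge0 ?ler0n//= ler_pdivrMr ?ltr0n// mul1r ler_nat.
exact: continuous_mdist_cvg (@discretize_cvg _ _).
Qed.

(** An open set is where the distance to its complement, a continuous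
    functional, is positive. *)
Lemma measurable_skorohod : measurable_fun setT X.
Proof.
apply: (@measurability _ _ _ _ _ _ (@open (skorohod R))) => // _ [U oU <-].
rewrite setTI; have [U0|nU0] := pselect (~` U = set0).
  by rewrite -[U]setCK U0 setC0 preimage_setT.
have {}nU0 : ~` U !=set0 by apply/set0P/eqP.
have cD : continuous (set_dist (~` U) : skorohod R -> R).
  exact: lipschitz_continuous (set_dist_lip nU0).
rewrite (_ : _ @^-1` _ = (fun w => set_dist (~` U) (X w)) @^-1` `]0, +oo[%classic).
  by rewrite -[X in measurable X]setTI; exact: measurable_continuous_comp.
apply/seteqP; split => w /=; rewrite in_itv /= andbT.
  move=> UX; have [e /= e0 eU] := (nbhs_ballP _ _).1 (open_nbhs_nbhs (conj oU UX)).
  apply: lt_le_trans e0 _; apply: set_dist_ge => // y nUy.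
  rewrite leNgt; apply/negP => Xy; apply: nUy; apply: eU.
  by rewrite ballEmdist.
move=> D0; apply: contrapT => nUX; move: D0; rewrite ltNge => /negP; apply.
by rewrite -(mdistxx (X w)); exact: set_dist_le.
Qed.

End skorohod_measurability.

(** * A countable family of test functions *)

Section test_functions.
Context {R : realType}.
Implicit Types (x y : skorohod R).

(** Height, inverse radius and centre of a bump; a rational height [q] stands
    for [|q|], so that every code denotes a nonnegative function. *)
Definition bump_code := (rat * nat * (nat * seq int))%type.

Definition bump (i : bump_code) x : R :=
  `|ratr i.1.1| *
    Num.max 0 (1 - i.1.2%:R * mdist (step_path i.2.1 i.2.2) x).

Definition bump_max (s : seq bump_code) x : R :=
  \big[Num.max/0]_(i <- s) bump i x.

Lemma bump_ge0 i x : 0 <= bump i x.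
Proof. by rewrite mulr_ge0// le_max lexx. Qed.

Lemma bump_max_ge0 s x : 0 <= bump_max s x.
Proof. by rewrite /bump_max; apply: bigmax_ge_id. Qed.

Lemma max_lip (a b a' b' r : R) : `|a - a'| <= r -> `|b - b'| <= r ->
  `|Num.max a b - Num.max a' b'| <= r.
Proof.
rewrite !ler_norml => /andP[? ?] /andP[? ?].
by have [?|?] := leP a b; have [?|?] := leP a' b'; apply/andP; split; lra.
Qed.

Lemma bump_lip i x y : `|bump i x - bump i y| <=
  `|ratr i.1.1| * i.1.2%:R * mdist x y.
Proof.
rewrite -mulrBr normrM normr_id -mulrA ler_wpM2l//; apply: max_lip.
  by rewrite subrr normr0 mulr_ge0// mdist_ge0.
rewrite opprB addrC addrA subrK -mulrBr normrM ger0_norm// ler_wpM2l//.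
by rewrite distrC mdist_lip.
Qed.

Lemma bump_max_lip s :
  exists2 K, 0 <= K & forall x y, `|bump_max s x - bump_max s y| <= K * mdist x y.
Proof.
rewrite /bump_max; elim: s => [|i s [K K0 IH]].
  by exists 0 => // x y; rewrite !big_nil subrr normr0 mul0r.
exists (`|ratr i.1.1| * i.1.2%:R + K) => [|x y].
  by rewrite addr_ge0// mulr_ge0.
rewrite !big_cons; apply: max_lip.
  by apply: le_trans (bump_lip i x y) _; rewrite mulrDl lerDl mulr_ge0// mdist_ge0.
apply: le_trans (IH x y) _; rewrite mulrDl lerDr.
by rewrite mulr_ge0 ?mdist_ge0// mulr_ge0.
Qed.

Lemma bump_max_bounded s : exists M, forall x, `|bump_max s x| <= M.
Proof.
rewrite /bump_max; elim: s => [|i s [K IH]].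
  by exists 0 => x; rewrite big_nil normr0.
exists (`|ratr i.1.1| + K) => x; rewrite big_cons.
have h1 : 0 <= bump i x <= `|ratr i.1.1|.
  rewrite bump_ge0 /= -[leRHS]mulr1 ler_wpM2l// ge_max ler01 /=.
  by rewrite gerBl mulr_ge0// mdist_ge0.
have := bump_max_ge0 s x; rewrite /bump_max => h2.
have := IH x; rewrite (ger0_norm h2) => h3.
rewrite (@ger0_norm _ (Num.max _ _)); last by rewrite le_max h2 orbT.
have := normr_ge0 (ratr i.1.1 : R); case/andP: h1 => *.
by rewrite ge_max; apply/andP; split; lra.
Qed.

Lemma bump_max_continuous s : continuous (bump_max s).
Proof. by have [K _] := bump_max_lip s; exact: lipschitz_continuous. Qed.

(** Step paths being dense, a nonnegative continuous function is the supremum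
    of the bumps below it. *)
Lemma bump_approx (F : skorohod R -> R) x e : continuous F ->
  0 < e -> e < F x -> exists2 i, (forall y, bump i y <= Num.max 0 (F y)) & F x - e <= bump i x.
Proof.
move=> cF e0 eF; have [q] := @rat_in_itvoo R (F x - e / 2) (F x - e / 4) ltac:(lra).
rewrite in_itv /= => /andP[q1 q2].
have [Q QE] : exists Q : R, Q = ratr q by exists (ratr q).
rewrite -QE in q1 q2; have q0 : 0 < Q by lra.
have := cF x; move=> /cvgrPdist_lt/(_ (e / 4) ltac:(lra))/nbhs_ballP[r /= r0 rF].
pose k := (Num.truncn (2 / r)).+1.
have k0 : 0 < k%:R :> R by rewrite ltr0n.
have kr : (k%:R)^-1 < r / 2.
  rewrite -[ltRHS]invf_div ltf_pV2 ?posrE ?divr_gt0//; exact: truncnS_gt.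
pose dl := Num.min (r / 2) (e / (2 * (Q * k%:R))).
have qk0 : 0 < Q * k%:R :> R by rewrite mulr_gt0.
have dl0 : 0 < dl.
  rewrite lt_min; apply/andP; split; first by lra.
  by rewrite divr_gt0// mulr_gt0.
have := discretize_cvg x; move=> /cvgr0_norm_lt/(_ _ dl0)[m _ /(_ m (leqnn m))].
rewrite /= ger0_norm ?mdist_ge0// /dl lt_min; set z := discretize _ _.
move=> /andP[z1 z2].
exists (q, k, (m, z)) => [y|]; rewrite /bump /= -QE gtr0_norm//; last first.
  apply: (@le_trans _ _ (Q * (1 - k%:R * mdist (step_path m z) x))); last first.
    by rewrite ler_pM2l// le_max lexx orbT.
  move: z2; rewrite ltr_pdivlMr ?mulr_gt0// => z2; lra.
have [k1|k1] := leP 1 (k%:R * mdist (step_path m z) y).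
  by rewrite max_l ?mulr0 ?le_max ?lexx//; lra.
apply: (@le_trans _ _ (Q)).
  by rewrite ler_piMr ?(ltW q0)// ge_max ler01 /= gerBl mulr_ge0 ?mdist_ge0.
have xy : mdist x y < r.
  apply: le_lt_trans (metric_triangle x (step_path m z) y) _.
  rewrite metric_sym; have : mdist (step_path m z) y < k%:R^-1.
    by rewrite -[ltRHS]mul1r ltr_pdivlMr// mulrC.
  lra.
have : `|F x - F y| < e / 4 by apply: rF; rewrite ballEmdist.
by rewrite le_max ltr_norml => /andP[? ?]; apply/orP; right; lra.
Qed.

(** The [n]-th maximum runs over those of the first [n] bumps that lie below
    [F]. *)
Lemma bump_max_cvg (F : skorohod R -> R) : continuous F -> (forall x, 0 <= F x) ->
  exists2 s : nat -> seq bump_code,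
    (forall n x, bump_max (s n) x <= F x) &
    forall x, bump_max (s n) x @[n --> \oo] --> F x.
Proof.
move=> cF F0.
pose s n := [seq i <- pmap (@unpickle bump_code) (iota 0 n) |
              `[< forall x, bump i x <= F x >]].
have sF n x : bump_max (s n) x <= F x.
  rewrite /bump_max big_seq; apply: bigmax_le => // i.
  by rewrite mem_filter => /andP[/asboolP].
exists s => // x; apply/cvgrPdist_le => e e0.
have [Fe|eF] := leP (F x) e.
  near=> n; rewrite ger0_norm ?subr_ge0//.
  by apply: le_trans Fe; rewrite gerBl bump_max_ge0.
have [i iF ix] := bump_approx cF e0 eF.
exists (pickle i).+1 => // n /= i_n.
rewrite ger0_norm ?subr_ge0// lerBlDl -lerBlDr; apply: le_trans ix _.
rewrite /bump_max; apply: (@le_bigmax_seq _ _ _ _ _ i) => //.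
rewrite mem_filter; apply/andP; split.
  apply/asboolP => y; apply: le_trans (iF y) _; by rewrite ge_max F0 lexx.
by rewrite mem_pmap; apply/mapP; exists (pickle i); rewrite ?pickleK// mem_iota.
Unshelve. all: by end_near. Qed.

End test_functions.

(** * Expectations of bounded random variables *)

Section bounded_expectation.
Context {R : realType} {d : measure_display} {T : measurableType d}.
Variable P : probability T R.
Implicit Types (f g : T -> R).

Definition bounded_rv f :=
  measurable_fun setT f /\ exists C, forall w, `|f w| <= C.

Lemma bounded_rvP f C : measurable_fun setT f -> (forall w, `|f w| <= C) ->
  bounded_rv f.
Proof. by move=> mf fC; split => //; exists C. Qed.

Lemma bounded_rv_integrable f : bounded_rv f -> P.-integrable setT (EFin \o f).
Proof.
move=> [mf [C fC]]; apply: measurable_bounded_integrable => //.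
  by rewrite [X in (X < _)%E](probability_setT P) ltry.
exists C; split; first by rewrite num_real.
by move=> M CM w _; apply: le_trans (fC w) (ltW CM).
Qed.

Lemma bounded_rv_cst c : bounded_rv (fun=> c).
Proof. by split; [exact: measurable_cst|exists `|c|]. Qed.

Lemma bounded_rvD f g : bounded_rv f -> bounded_rv g ->
  bounded_rv (fun w => f w + g w).
Proof.
move=> [mf [C fC]] [mg [D gD]]; split; first exact: measurable_funD.
by exists (C + D) => w; rewrite (le_trans (ler_normD _ _))// lerD.
Qed.

Lemma bounded_rvM f g : bounded_rv f -> bounded_rv g ->
  bounded_rv (fun w => f w * g w).
Proof.
move=> [mf [C fC]] [mg [D gD]]; split; first exact: measurable_funM.
by exists (C * D) => w; rewrite normrM ler_pM.
Qed.

Lemma bounded_rvZ c f : bounded_rv f -> bounded_rv (fun w => c * f w).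
Proof. by move=> bf; apply: bounded_rvM => //; exact: bounded_rv_cst. Qed.

Lemma bounded_rvN f : bounded_rv f -> bounded_rv (fun w => - f w).
Proof.
move=> bf; have := bounded_rvZ (-1) bf.
by under eq_fun do rewrite mulN1r.
Qed.

Lemma bounded_rvB f g : bounded_rv f -> bounded_rv g ->
  bounded_rv (fun w => f w - g w).
Proof. by move=> bf bg; apply: bounded_rvD => //; exact: bounded_rvN. Qed.

Lemma bounded_rv_norm f : bounded_rv f -> bounded_rv (fun w => `|f w|).
Proof.
move=> [mf [C fC]]; split; first exact: measurableT_comp.
by exists C => w; rewrite normr_id.
Qed.

Lemma bounded_rv_sum n (f : nat -> T -> R) : (forall i, bounded_rv (f i)) ->
  bounded_rv (fun w => \sum_(i < n) f i w).
Proof.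
move=> bf; elim: n => [|n IH].
  under eq_fun do rewrite big_ord0; exact: bounded_rv_cst.
under eq_fun do rewrite big_ord_recr /=; exact: bounded_rvD.
Qed.

Lemma bounded_rv_indic (A : set T) : measurable A -> bounded_rv (\1_A).
Proof.
move=> mA; split; first exact: measurable_indic.
by exists 1 => w; rewrite indicE; case: (_ \in _); rewrite ?normr0 ?normr1.
Qed.

Lemma EFin_expect f : bounded_rv f ->
  (\int[P]_w (f w)%:E = (\int[P]_w f w)%R%:E)%E.
Proof.
move=> /bounded_rv_integrable bf; rewrite /Rintegral fineK//.
exact: (@integrable_fin_num _ _ _ P setT _ (EFin \o f)).
Qed.

Lemma expect_cst c : \int[P]_w c = c :> R.
Proof. by rewrite Rintegral_cst// [X in fine X](probability_setT P) mulr1. Qed.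

Lemma expectD f g : bounded_rv f -> bounded_rv g ->
  \int[P]_w (f w + g w) = \int[P]_w f w + \int[P]_w g w.
Proof. by move=> bf bg; rewrite RintegralD//; exact: bounded_rv_integrable. Qed.

Lemma expectB f g : bounded_rv f -> bounded_rv g ->
  \int[P]_w (f w - g w) = \int[P]_w f w - \int[P]_w g w.
Proof. by move=> bf bg; rewrite RintegralB//; exact: bounded_rv_integrable. Qed.

Lemma expectZ c f : bounded_rv f -> \int[P]_w (c * f w) = c * \int[P]_w f w.
Proof. by move=> bf; rewrite RintegralZl//; exact: bounded_rv_integrable. Qed.

Lemma expect_sum n (f : nat -> T -> R) : (forall i, bounded_rv (f i)) ->
  \int[P]_w (\sum_(i < n) f i w) = \sum_(i < n) \int[P]_w f i w.
Proof.
move=> bf; elim: n => [|n IH].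
  by under eq_Rintegral do rewrite big_ord0; rewrite expect_cst big_ord0.
under eq_Rintegral do rewrite big_ord_recr /=.
by rewrite expectD ?IH ?big_ord_recr//; exact: bounded_rv_sum.
Qed.

Lemma le_expect f g : bounded_rv f -> bounded_rv g -> (forall w, f w <= g w) ->
  \int[P]_w f w <= \int[P]_w g w.
Proof.
by move=> bf bg fg; apply: le_Rintegral => //; exact: bounded_rv_integrable.
Qed.

Lemma expect_norm_le f C : bounded_rv f -> (forall w, `|f w| <= C) ->
  `|\int[P]_w f w| <= C.
Proof.
move=> bf fC; apply: le_trans (le_normr_Rintegral _ (bounded_rv_integrable bf)) _ => //.
rewrite -[leRHS]expect_cst; apply: le_expect => //.
  exact: bounded_rv_norm.
exact: bounded_rv_cst.
Qed.

Lemma expect_indic (A : set T) : measurable A -> \int[P]_w \1_A w = fine (P A).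
Proof. by move=> mA; rewrite /Rintegral integral_indic// setIT. Qed.

(** Dominated convergence, with a constant as the dominating function. *)
Lemma expect_cvg (f_ : nat -> T -> R) f C : (forall n, measurable_fun setT (f_ n)) ->
  (forall n w, `|f_ n w| <= C) -> (forall w, f_ n w @[n --> \oo] --> f w) ->
  \int[P]_w f_ n w @[n --> \oo] --> \int[P]_w f w.
Proof.
move=> mf_ f_C f_f.
have mf : measurable_fun setT f by apply: (measurable_fun_cvg mf_) => w _.
have fC w : `|f w| <= C.
  apply: (cvgr_to_le (cvg_norm (f_f w))).
  by apply: nearW => n /=.
have [|||||_ _] := @dominated_convergence _ _ _ P setT measurableT
  (fun n => EFin \o f_ n) (EFin \o f) (fun=> C%:E).
- by move=> n; exact/measurable_EFinP.
- exact/measurable_EFinP.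
- by apply: aeW => w _; apply: cvg_EFin; [exact: nearW|exact: f_f].
- exact: (bounded_rv_integrable (bounded_rv_cst C)).
- by apply: aeW => w n _ /=; rewrite lee_fin.
rewrite EFin_expect; last exact: bounded_rvP fC.
move=> /fine_cvg; apply: cvg_trans; apply: near_eq_cvg; apply: nearW => n.
by [].
Qed.

(** The sum of the [f p] has finite expectation, hence is almost surely finite,
    and its terms tend to 0. *)
Lemma ae_cvg0_of_summable (f : nat -> T -> R) (c : nat -> R) B :
  (forall p, bounded_rv (f p)) -> (forall p w, 0 <= f p w) ->
  (forall p, \int[P]_w f p w <= c p) -> (forall n, \sum_(p < n) c p <= B) ->
  {ae P, forall w, f p w @[p --> \oo] --> 0}.
Proof.
move=> bf f0 fc cB.
have mf p : measurable_fun setT (fun w => (f p w)%:E).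
  by apply/measurable_EFinP; case: (bf p).
pose S w := (\sum_(0 <= p <oo) (f p w)%:E)%E.
have S0 w : (0 <= S w)%E by apply: nneseries_ge0 => p _ _; rewrite lee_fin.
have intS : P.-integrable setT S.
  apply/integrableP; split.
    by apply: ge0_emeasurable_sum => // p w _ _; rewrite lee_fin.
  under eq_integral do rewrite gee0_abs//.
  rewrite integral_nneseries//; last by move=> p w _; rewrite lee_fin.
  apply: (@le_lt_trans _ _ B%:E); last by rewrite ltry.
  apply: lime_le.
    by apply: is_cvg_nneseries => p _ _; apply: integral_ge0 => w _; rewrite lee_fin.
  apply: nearW => n; rewrite big_mkord.
  under eq_bigr do rewrite EFin_expect//.
  rewrite sumEFin lee_fin; apply: le_trans (cB n).
  by apply: ler_sum => p _; exact: fc.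
have := integrable_ae measurableT intS; apply: filterS => w /(_ I) Sfin.
have tl : (\sum_(N <= p <oo) (f p w)%:E @[N --> \oo] --> 0)%E.
  apply: nneseries_tail_cvg; last by move=> p _; rewrite lee_fin.
  by move: Sfin; rewrite ge0_fin_numE.
apply/cvgrPdist_le => e e0.
have /fine_cvgP[tfin /cvgrPdist_le/(_ e e0)] := tl.
move: tfin; apply: filterS2 => N tfin /=.
rewrite !sub0r !normrN; apply: le_trans.
rewrite ger0_norm// [leRHS]ger0_norm; last first.
  by apply/fine_ge0/nneseries_ge0 => p _ _; rewrite lee_fin.
rewrite -lee_fin fineK//.
have := @nneseries_lim_ge R (fun p => (f p w)%:E) xpredT N N.+1.
by rewrite big_nat1; apply => p _ _; rewrite lee_fin.
Qed.

End bounded_expectation.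

(** * Harmonic sums and logarithmic averages *)

Section harmonic_weights.
Context {R : realType}.

(** The weight [1 / k] of the index [k], with indices shifted to start at 0;
    accordingly [hsum n] is the [n]-th harmonic number. *)
Definition weight (k : nat) : R := k.+1%:R^-1.

Definition hsum (n : nat) : R := \sum_(k < n) weight k.

Definition havg (u : nat -> R) (n : nat) : R :=
  (hsum n)^-1 * \sum_(k < n) weight k * u k.

Lemma weight_gt0 k : 0 < weight k.
Proof. by rewrite invr_gt0. Qed.

Lemma weight_le1 k : weight k <= 1.
Proof. by rewrite invf_le1// ler1n. Qed.

Lemma hsumS n : hsum n.+1 = hsum n + weight n.
Proof. by rewrite /hsum big_ord_recr. Qed.

Lemma hsum0 : hsum 0 = 0. Proof. by rewrite /hsum big_ord0. Qed.

Lemma hsum1 : hsum 1 = 1.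
Proof. by rewrite hsumS hsum0 add0r /weight invr1. Qed.

Lemma hsum_le : {homo hsum : m n / (m <= n)%N >-> m <= n}.
Proof.
apply: homo_leq => //; first exact: le_trans.
by move=> n; rewrite hsumS lerDl ltW// weight_gt0.
Qed.

Lemma hsum_ge0 n : 0 <= hsum n.
Proof. by rewrite -hsum0; exact: hsum_le. Qed.

Lemma hsum_ge1 n : 1 <= hsum n.+1.
Proof. by rewrite -hsum1; exact: hsum_le. Qed.

Lemma hsum_gt0 n : (0 < n)%N -> 0 < hsum n.
Proof. by case: n => // n _; exact: lt_le_trans ltr01 (hsum_ge1 n). Qed.

Lemma hsum_le_nat n : hsum n <= n%:R.
Proof.
elim: n => [|n IH]; first by rewrite hsum0.
by rewrite hsumS -natr1 lerD// weight_le1.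
Qed.

(** The sum of [1 / i] for [k + 1 < i <= l + 1] is below the integral of
    [1 / x] from [k + 1] to [l + 1]. *)
Lemma hsum_diff_le_ln k l : (k <= l)%N ->
  hsum l.+1 - hsum k.+1 <= ln (l.+1%:R / k.+1%:R).
Proof.
move=> /subnK <-; elim: (l - k)%N => [|n IH].
  by rewrite add0n subrr divff// ln1.
rewrite addSn hsumS; set m := (n + k)%N in IH *.
have -> : (m.+2%:R / k.+1%:R : R) = (m.+2%:R / m.+1%:R) * (m.+1%:R / k.+1%:R).
  by rewrite mulrA divfK.
rewrite lnM ?posrE ?divr_gt0//.
suff : weight m.+1 <= ln (m.+2%:R / m.+1%:R) by lra.
rewrite -[X in ln X]invf_div lnV ?posrE ?divr_gt0// lerNr.
have -> : m.+1%:R / m.+2%:R = 1 + - weight m.+1 :> R.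
  by rewrite /weight -[m.+1%:R](addrK 1) natr1 mulrBl divff// div1r.
apply: (@le_ln1Dx R (- weight m.+1)).
by rewrite ltrN2 invf_lt1// ltr1n.
Qed.

Lemma ln_le_hsum n : ln n.+1%:R <= hsum n.
Proof.
elim: n => [|n IH]; first by rewrite ln1 hsum0.
have -> : n.+2%:R = n.+1%:R * (1 + weight n) :> R.
  by rewrite /weight mulrDr mulr1 mulfV// natr1.
have w0 := weight_gt0 n.
rewrite lnM ?posrE ?addr_gt0// hsumS lerD//.
by apply: le_ln1Dx; rewrite (lt_trans _ w0).
Qed.

Lemma cvg_ln_nat : ln n%:R @[n --> \oo] --> (+oo : set_system R).
Proof.
apply/cvgryPge => A; exists (Num.truncn (expR A)).+1 => // n /= An.
have : expR A <= n%:R.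
  by apply: le_trans (ltW (truncnS_gt _)) _; rewrite ler_nat.
by move=> eA; rewrite -[leLHS]expRK ler_ln ?posrE ?expR_gt0// (lt_le_trans _ eA) ?expR_gt0.
Qed.

Lemma cvg_hsum : hsum n @[n --> \oo] --> (+oo : set_system R).
Proof.
apply/cvgryPge => A; move/cvgryPge: cvg_ln_nat => /(_ A).
apply: filterS2 (nbhs_infty_gt 0) => n n0 /le_trans; apply.
by apply: le_trans (ln_le_hsum n); rewrite ler_ln ?posrE ?ltr0n// ler_nat.
Qed.

Lemma cvg_hsum_ln : hsum n / ln n%:R @[n --> \oo] --> (1 : R).
Proof.
apply/cvgrPdist_le => e e0.
move/cvgryPge: cvg_ln_nat => /(_ (1 + e^-1)).
apply: filterS2 (nbhs_infty_gt 0) => -[//|n] _ lne.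
have eV : 0 < e^-1 by rewrite invr_gt0.
have l0 : 0 < ln n.+1%:R :> R by lra.
have h1 : hsum n.+1 - 1 <= ln n.+1%:R.
  have := @hsum_diff_le_ln 0 n (leq0n n).
  by rewrite divr1 hsum1.
have h2 : ln n.+1%:R <= hsum n.+1.
  by apply: le_trans (ln_le_hsum n.+1); rewrite ler_ln ?posrE ?ler_nat.
have -> : 1 - hsum n.+1 / ln n.+1%:R = (ln n.+1%:R - hsum n.+1) / ln n.+1%:R.
  by rewrite mulrBl divff// gt_eqF.
rewrite normrM normfV [X in _ / X]gtr0_norm// ler_pdivrMr//.
apply: (@le_trans _ _ 1); first by rewrite ler_norml; apply/andP; split; lra.
by rewrite -ler_pdivrMl// mulr1; lra.
Qed.

Lemma havgD u v n : havg (fun k => u k + v k) n = havg u n + havg v n.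
Proof.
rewrite /havg -mulrDr -big_split; congr (_ * _).
by apply: eq_bigr => k _; rewrite mulrDr.
Qed.

Lemma havgN u n : havg (fun k => - u k) n = - havg u n.
Proof.
rewrite /havg -mulrN -sumrN; congr (_ * _).
by apply: eq_bigr => k _; rewrite mulrN.
Qed.

Lemma havgB u v n : havg (fun k => u k - v k) n = havg u n - havg v n.
Proof. by rewrite havgD havgN. Qed.

Lemma havgZ c u n : havg (fun k => c * u k) n = c * havg u n.
Proof.
rewrite /havg [RHS]mulrCA; congr (_ * _); rewrite mulr_sumr.
by apply: eq_bigr => i _; rewrite mulrCA.
Qed.

Lemma havg_cst c n : (0 < n)%N -> havg (fun=> c) n = c.
Proof.
move=> n0; rewrite /havg -mulr_suml mulrA mulVf ?mul1r//.
by rewrite gt_eqF// hsum_gt0.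
Qed.

Lemma havg_le u v n : (forall k, u k <= v k) -> havg u n <= havg v n.
Proof.
move=> uv; apply: ler_wpM2l; first by rewrite invr_ge0 hsum_ge0.
by apply: ler_sum => k _; apply: ler_wpM2l; rewrite ?(ltW (weight_gt0 _)).
Qed.

Lemma havg_norm u n : `|havg u n| <= havg (fun k => `|u k|) n.
Proof.
rewrite normrM ger0_norm ?invr_ge0 ?hsum_ge0//; apply: ler_wpM2l.
  by rewrite invr_ge0 hsum_ge0.
apply: le_trans (ler_norm_sum _ _ _) _; apply: ler_sum => k _.
by rewrite normrM ger0_norm// ltW// weight_gt0.
Qed.

(** Only finitely many terms are not below the eventual bound, and the total
    weight diverges. *)
Lemma havg_limsup_le u c : (\forall k \near \oo, u k <= c) ->
  forall e, 0 < e -> \forall n \near \oo, havg u n <= c + e.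
Proof.
move=> [N _ uN] e e0.
pose A := \sum_(k < N) `|u k - c|.
have A0 : 0 <= A by apply: sumr_ge0.
have bound n : \sum_(k < n) weight k * (u k - c) <= A.
  elim: n {-2}n (leqnn n) => [|m IH] n nm.
    by move: nm; rewrite leqn0 => /eqP ->; rewrite big_ord0.
  have [nN|Nn] := leqP n N.
    rewrite /A (big_ord_widen _ (fun k => weight k * (u k - c)) nN) big_mkcond.
    apply: ler_sum => k _; case: ifP => _ //.
    apply: le_trans (ler_norm _) _; rewrite normrM ger0_norm ?(ltW (weight_gt0 k))//.
    by rewrite ler_piMl// weight_le1.
  case: n nm Nn => // n nm Nn; rewrite big_ord_recr /=.
  have := IH n nm; have : weight n * (u n - c) <= 0.
    by rewrite mulr_ge0_le0 ?(ltW (weight_gt0 n))// subr_le0; exact: uN.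
  lra.
move/cvgryPge: cvg_hsum => /(_ (A / e)); apply: filterS2 (nbhs_infty_gt 0).
move=> n n0 An; have h0 := hsum_gt0 n0.
have -> : havg u n = c + havg (fun k => u k - c) n.
  by rewrite havgB havg_cst// addrC subrK.
rewrite lerD2l /havg ler_pdivrMl//; apply: le_trans (bound n) _.
by rewrite -ler_pdivrMr.
Qed.

(** The upper bound of the previous lemma for [u] and for [- u]. *)
Lemma havg_cvg u (c : R) : u k @[k --> \oo] --> c -> havg u n @[n --> \oo] --> c.
Proof.
move=> uc; apply/cvgrPdist_le => e e0.
have u1 : \forall k \near \oo, u k <= c + e / 2.
  by apply: (cvgr_le _ uc); lra.
have u2 : \forall k \near \oo, - u k <= - c + e / 2.
  have [N _ uN] := cvgr_ge _ uc (c - e / 2) ltac:(lra).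
  by exists N => // k /uN /=; lra.
have h1 := havg_limsup_le u1 (ltac:(lra) : 0 < e / 2).
have := havg_limsup_le u2 (ltac:(lra) : 0 < e / 2).
apply: filterS2 h1 => n h1; rewrite havgN => h2.
by rewrite ler_norml; apply/andP; split; lra.
Qed.

End harmonic_weights.

(** * Weak convergence of logarithmic averages *)

Section weak_convergence_criterion.
Context {R : realType}.
Implicit Types (F : skorohod R -> R).

Lemma continuous_measurable_skorohod F : continuous F -> measurable_fun setT F.
Proof.
move=> /continuousP cF; apply: (measurability _ (RGenOInfty.measurableE R)).
move=> _ [_ [r ->] <-]; rewrite setTI; apply: sub_sigma_algebra.
exact/cF/interval_open.
Qed.

Lemma integral_log_average (x : nat -> skorohod R) F n : continuous F ->
  (\int[log_average x n]_y (F y)%:E =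
   ((ln n%:R)^-1 * \sum_(k < n) weight k * F (x k.+1))%R%:E)%E.
Proof.
move=> /continuous_measurable_skorohod mF.
have nonneg (G : skorohod R -> R) : measurable_fun setT G -> (forall y, 0 <= G y) ->
    (\int[log_average x n]_y (G y)%:E =
     ((ln n%:R)^-1 * \sum_(k < n) weight k * G (x k.+1))%R%:E)%E.
  move=> mG G0; have mGE : measurable_fun setT (fun y => (G y)%:E).
    exact/measurable_EFinP.
  have GE0 y : [set: skorohod R] y -> (0 <= (G y)%:E)%E by rewrite lee_fin.
  rewrite /log_average ge0_integral_mscale// ge0_integral_measure_sum//.
  rewrite EFinM -sumEFin; congr (_ * _)%E; apply: eq_bigr => k _.
  by rewrite ge0_integral_mscale// integral_dirac// diracT mul1e EFinM.
rewrite integralE.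
have := funerpos F; have := funerneg F; rewrite /comp /= => -> ->.
rewrite !nonneg; [|exact: measurable_funrneg|by []|exact: measurable_funrpos|by []].
rewrite -EFinB -mulrBr -sumrB; congr (_ * _)%:E; apply: eq_bigr => k _.
by rewrite -mulrBr; congr (_ * _); rewrite -[in RHS](funrposBneg F).
Qed.

Context {d : measure_display} {T : measurableType d} (P : probability T R).
Variable Y : T -> skorohod R.
Hypothesis mY : forall t, 0 <= t <= 1 -> measurable_fun setT (fun w => Y w t).

Lemma bounded_rv_continuous F M : continuous F -> (forall x, `|F x| <= M) ->
  bounded_rv (fun w => F (Y w)).
Proof.
by move=> cF FM; apply: bounded_rvP => //; exact: measurable_continuous_comp.
Qed.

Lemma integral_law F M : continuous F -> (forall x, `|F x| <= M) ->
  (\int[pushforward P Y]_y (F y)%:E = (\int[P]_w F (Y w))%R%:E)%E.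
Proof.
move=> cF FM; have bF := bounded_rv_continuous cF FM.
rewrite integral_pushforward//.
- exact: EFin_expect bF.
- exact: measurable_skorohod.
- by apply/measurable_EFinP; exact: continuous_measurable_skorohod.
- exact: (bounded_rv_integrable P bF).
Qed.

(** Weak convergence needs testing on countably many functions only: a
    nonnegative continuous function is a limit from below of maxima of bumps,
    which gives the lower half of the limit for [M + F] and for [M - F]. *)
Lemma havg_weak_cvg (x : nat -> skorohod R) :
  (forall s, havg (fun k => bump_max s (x k)) n @[n --> \oo] -->
             \int[P]_w bump_max s (Y w)) ->
  forall F, continuous F -> (exists M, forall y, `|F y| <= M) ->
    havg (fun k => F (x k)) n @[n --> \oo] --> \int[P]_w F (Y w).
Proof.
move=> bump_cvg F cF [M FM].
have lower (G : skorohod R -> R) (N : R) : continuous G -> (forall y, 0 <= G y) -> (forall y, `|G y| <= N) ->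
    forall e, 0 < e -> \forall n \near \oo,
      \int[P]_w G (Y w) - e <= havg (fun k => G (x k)) n.
  move=> cG G0 GN e e0; have [s sG s_cvg] := bump_max_cvg cG G0.
  have : \int[P]_w bump_max (s n) (Y w) @[n --> \oo] --> \int[P]_w G (Y w).
    apply: (@expect_cvg _ _ _ _ _ _ N).
    - by move=> n; exact: measurable_continuous_comp (@bump_max_continuous _ _).
    - move=> n w; rewrite ger0_norm ?bump_max_ge0//.
      by apply: le_trans (sG n _) _; apply: le_trans (ler_norm _) (GN _).
    - by move=> w; exact: s_cvg.
  move=> /cvgr_ge/(_ (\int[P]_w G (Y w) - e / 2) ltac:(lra))[m _ /(_ m (leqnn m))].
  move=> /= sm; have := bump_cvg (s m).
  move=> /cvgr_ge/(_ (\int[P]_w G (Y w) - e)); move=> /(_ ltac:(lra)).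
  by apply: filterS => n /le_trans; apply; apply: havg_le => k.
have cst_cont (c : R) : continuous (fun _ : skorohod R => c) by exact: cst_continuous.
have bF := bounded_rv_continuous cF FM.
apply/cvgrPdist_le => e e0.
have := lower (fun y => M + F y) (M + M).
move=> /(_ (fun y => cvgD (cst_cont M y) (cF y))).
have h1 y : 0 <= M + F y by have := FM y; rewrite ler_norml => /andP[? _]; lra.
have h2 y : `|M + F y| <= M + M.
  by rewrite ger0_norm//; have := FM y; rewrite ler_norml => /andP[_ ?]; lra.
move=> /(_ h1 h2 _ e0); rewrite expectD ?expect_cst//; last exact: bounded_rv_cst.
have := lower (fun y => M - F y) (M + M).
move=> /(_ (fun y => cvgB (cst_cont M y) (cF y))).
have h3 y : 0 <= M - F y by have := FM y; rewrite ler_norml => /andP[_ ?]; lra.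
have h4 y : `|M - F y| <= M + M.
  by rewrite ger0_norm//; have := FM y; rewrite ler_norml => /andP[? _]; lra.
move=> /(_ h3 h4 _ e0); rewrite expectB ?expect_cst//; last exact: bounded_rv_cst.
apply: filterS3 (nbhs_infty_gt 0) => n n0.
rewrite havgB havgD havg_cst// => le1 le2.
by rewrite ler_norml; apply/andP; split; lra.
Qed.

Lemma weak_cvg_log_average (x : nat -> skorohod R) :
  (forall s, havg (fun k => bump_max s (x k.+1)) n @[n --> \oo] -->
             \int[P]_w bump_max s (Y w)) ->
  weak_cvg (log_average x) (pushforward P Y).
Proof.
move=> bump_cvg F cF [M FM]; rewrite (integral_law cF FM).
have := havg_weak_cvg bump_cvg cF (ex_intro _ M FM) => F_cvg.
have -> : (fun n => \int[log_average x n]_y (F y)%:E)%E =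
    (fun n => ((ln n%:R)^-1 * \sum_(k < n) weight k * F (x k.+1))%:E).
  by apply/funext => n; exact: integral_log_average.
apply: cvg_EFin; first exact: nearW.
rewrite -[X in _ --> X]mul1r.
apply: cvg_trans (cvgM cvg_hsum_ln F_cvg); apply: near_eq_cvg.
apply: filterS (nbhs_infty_gt 0) => n n0 /=.
have h0 : hsum n != 0 :> R by rewrite gt_eqF// hsum_gt0.
by rewrite /havg [X in X * _]mulrC -mulrA mulVKf.
Qed.

End weak_convergence_criterion.

(** * A strong law for logarithmic averages *)

Section logarithmic_strong_law.
Context {R : realType}.

Lemma exists_hsum_subseq : exists N : nat -> nat, forall p,
  p.+1%:R ^+ 4 <= hsum (N p) :> R /\ hsum (N p) <= p.+1%:R ^+ 4 + 1 :> R.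
Proof.
suff H (p : nat) : exists n : nat,
    p.+1%:R ^+ 4 <= hsum n :> R /\ hsum n <= p.+1%:R ^+ 4 + 1 :> R.
  by have [N NP] := choice H; exists N.
have ex : exists n, p.+1%:R ^+ 4 <= hsum n :> R.
  move/cvgryPge: (@cvg_hsum R) => /(_ (p.+1%:R ^+ 4))[n _ /(_ n (leqnn n))].
  by exists n.
case: (ex_minnP ex) => -[|n] pn min_n.
  by exists 0%N; split => //; rewrite hsum0 addr_ge0// exprn_ge0.
exists n.+1; split => //.
rewrite hsumS lerD ?weight_le1// leNgt; apply/negP => /ltW /min_n.
by rewrite ltnn.
Qed.

(** Between two consecutive indices of the subsequence the total weight grows
    by a factor tending to 1, which leaves no room for bounded terms to move
    the average. *)
Lemma havg_cvg0_subseq (x : nat -> R) C (N : nat -> nat) :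
  (forall k, `|x k| <= C) ->
  (forall p, p.+1%:R ^+ 4 <= hsum (N p) :> R /\ hsum (N p) <= p.+1%:R ^+ 4 + 1 :> R) ->
  havg x (N p) @[p --> \oo] --> 0 -> havg x n @[n --> \oo] --> 0.
Proof.
move=> xC NP xN; have C0 : 0 <= C by exact: le_trans (normr_ge0 _) (xC 0%N).
apply/cvgrPdist_le => e e0.
have /cvgrPdist_le/(_ (e / 2) ltac:(lra))[p1 _ p1P] := xN.
pose p0 := maxn p1 (Num.truncn (32 * C / e)).
exists (N p0) => // n /= n_ge.
rewrite sub0r normrN.
have [p [p_ge pn np]] : exists p, [/\ (p0 <= p)%N, (N p <= n)%N & (n < N p.+1)%N].
  have NgeP q : (q < N q)%N.
    rewrite -(ltr_nat R); apply: lt_le_trans (hsum_le_nat _).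
    apply: lt_le_trans (NP q).1; apply: (@lt_le_trans _ _ q.+1%:R).
      by rewrite ltr_nat.
    by rewrite -[leLHS]expr1 ler_weXn2l// ler1n.
  have : (n < N (n + p0))%N by apply: leq_ltn_trans (NgeP _); exact: leq_addr.
  move: {2}n => j; elim: j => [|k IH]; first by rewrite add0n ltnNge (n_ge : (N p0 <= n)%N).
  rewrite addSn => kn; have [nk|nk] := ltnP n (N (k + p0)); first exact: IH.
  by exists (k + p0)%N; split => //; exact: leq_addl.
have [h1 h2] := NP p; have [_ h3] := NP p.+1.
have hNn : hsum (N p) <= hsum n :> R by exact: hsum_le.
have hnN : hsum n <= hsum (N p.+1) :> R by apply: hsum_le; exact: ltnW.
set q : R := p.+1%:R in h1 h2; have q1 : 1 <= q by rewrite /q ler1n.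
have qS : p.+2%:R = q + 1 :> R by rewrite /q natr1.
rewrite qS in h3.
have q4 : 1 <= q ^+ 4 by rewrite exprn_ege1.
have hN0 : 0 < hsum (N p) :> R by lra.
have hn0 : 0 < hsum n :> R by lra.
have split_sum : \sum_(k < n) weight k * x k =
    \sum_(k < N p) weight k * x k + \sum_(N p <= k < n) weight k * x k.
  by rewrite -!(big_mkord xpredT (fun k => weight k * x k)) (big_cat_nat (n := N p)).
have rest : `|\sum_(N p <= k < n) weight k * x k| <= C * (hsum n - hsum (N p)).
  have -> : hsum n - hsum (N p) = \sum_(N p <= k < n) weight k :> R.
    rewrite /hsum -!(big_mkord xpredT (@weight R)) (@big_cat_nat _ _ _ (N p))//=.
    by rewrite addrAC subrr add0r.
  rewrite mulr_sumr; apply: le_trans (ler_norm_sum _ _ _) _.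
  apply: ler_sum => k _; rewrite normrM mulrC.
  rewrite (gtr0_norm (weight_gt0 k)); apply: ler_wpM2r => //.
  exact/ltW/weight_gt0.
have grow : hsum n - hsum (N p) <= 16 * q ^+ 3.
  have : (q + 1) ^+ 4 + 1 - q ^+ 4 <= 16 * q ^+ 3.
    have -> : (q + 1) ^+ 4 + 1 - q ^+ 4 = 4 * q ^+ 3 + 6 * q ^+ 2 + 4 * q + 2.
      by ring.
    have q2 : q <= q ^+ 2 by rewrite expr2; nra.
    have q3 : q ^+ 2 <= q ^+ 3 by rewrite (exprS q 2) expr2; nra.
    lra.
  lra.
have main : `|havg x n| <= `|havg x (N p)| + 16 * C / q.
  rewrite /havg split_sum mulrDr; apply: le_trans (ler_normD _ _) _.
  apply: lerD; rewrite !normrM ger0_norm ?invr_ge0 ?(ltW hn0)//.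
    rewrite (@ger0_norm _ (hsum (N p))^-1) ?invr_ge0 ?(ltW hN0)//.
    apply: ler_wpM2r => //.
    by rewrite lef_pV2.
  rewrite ler_pdivrMl//; apply: le_trans rest _.
  apply: (@le_trans _ _ (C * (16 * q ^+ 3))); first exact: ler_wpM2l.
  have -> : C * (16 * q ^+ 3) = q ^+ 4 * (16 * C / q).
    by field; rewrite gt_eqF// (lt_le_trans ltr01 q1).
  apply: ler_wpM2r; last by lra.
  by rewrite divr_ge0 ?mulr_ge0//; lra.
apply: le_trans main _.
have := p1P p (leq_trans (leq_maxl _ _) p_ge); rewrite sub0r normrN => small.
suff H : 16 * C / q <= e / 2.
  by apply: le_trans (lerD small H) _; rewrite -splitr.
have q0 : 0 < q by lra.
rewrite ler_pdivrMr//.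
have : 32 * C / e <= q.
  apply: le_trans (ltW (truncnS_gt _)) _; rewrite ler_nat ltnS.
  by apply: leq_trans p_ge; exact: leq_maxr.
rewrite ler_pdivrMr//; nra.
Qed.

(** The partial sums stay below [2 - 1 / n], by telescoping. *)
Lemma sum_inv_sqr_le n : \sum_(p < n) (p.+1%:R ^+ 2)^-1 <= 2 :> R.
Proof.
case: n => [|n]; first by rewrite big_ord0.
suff : \sum_(p < n.+1) (p.+1%:R ^+ 2)^-1 <= 2 - n.+1%:R^-1 :> R.
  by move=> /le_trans; apply; rewrite gerBl invr_ge0.
elim: n => [|n IH]; first by rewrite big_ord_recr big_ord0 /= add0r expr1n invr1; lra.
rewrite big_ord_recr; move: IH => /=.
have n0 : 0 < n.+1%:R :> R by rewrite ltr0n.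
have -> : n.+2%:R = n.+1%:R + 1 :> R by rewrite natr1.
set a := n.+1%:R : R in n0 * => IH.
suff H : ((a + 1) ^+ 2)^-1 <= a^-1 - (a + 1)^-1.
  by apply: le_trans (lerD IH H) _; rewrite addrA subrK.
have -> : a^-1 - (a + 1)^-1 = (a * (a + 1))^-1.
  by field; rewrite !gt_eqF// addr_gt0.
rewrite lef_pV2 ?posrE ?exprn_gt0 ?mulr_gt0 ?addr_gt0//.
by rewrite expr2 ler_pM2r ?addr_gt0// lerDl.
Qed.

Context {d : measure_display} {T : measurableType d} (P : probability T R).

(** Where [hsum] is close to [p ^ 4], the second moment of the average is of
    order [1 / p ^ 2], which is summable; hence the averages tend to 0 along
    these indices, and [havg_cvg0_subseq] fills the gaps. *)
Lemma havg_strong_law (u : nat -> T -> R) C K :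
  (forall k, measurable_fun setT (u k)) -> (forall k w, `|u k w| <= C) ->
  (forall n, (0 < n)%N -> \int[P]_w (\sum_(k < n) weight k * u k w) ^+ 2 <=
     K * (hsum n * (1 + Num.sqrt (hsum n)))) ->
  {ae P, forall w, havg (u ^~ w) n @[n --> \oo] --> 0}.
Proof.
move=> mu uC var; have [N NP] := exists_hsum_subseq.
have bu k : bounded_rv (u k) by apply: bounded_rvP (uC k).
have hN p : 1 <= hsum (N p) :> R.
  by apply: le_trans (NP p).1; rewrite exprn_ege1// ler1n.
have N0 p : (0 < N p)%N.
  by case: (N p) (hN p) => //; rewrite hsum0 ler10.
have K0 : 0 <= K.
  have h0 : 0 < hsum (N 0%N) * (1 + Num.sqrt (hsum (N 0%N))) :> R.
    by rewrite mulr_gt0 ?ltr_wpDr ?sqrtr_ge0// (lt_le_trans ltr01).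
  rewrite -(pmulr_lge0 _ h0); apply: le_trans (var _ (N0 0%N)).
  by apply: Rintegral_ge0 => w _; exact: sqr_ge0.
have bU p : bounded_rv (fun w => \sum_(k < N p) weight k * u k w).
  by apply: (bounded_rv_sum (N p) (f := fun k w => weight k * u k w)) => k;
    exact: bounded_rvZ.
have : {ae P, forall w, (havg (u ^~ w) (N p)) ^+ 2 @[p --> \oo] --> 0}.
  apply: (@ae_cvg0_of_summable _ _ _ _ _ (fun p => 3 * K * (p.+1%:R ^+ 2)^-1)
      (3 * K * 2)).
  - move=> p; under eq_fun do rewrite expr2.
    by apply: bounded_rvM; exact: bounded_rvZ.
  - by move=> p w; exact: sqr_ge0.
  - move=> p; under eq_Rintegral do rewrite exprMn.
    rewrite expectZ; last by under eq_fun do rewrite expr2; exact: bounded_rvM.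
    have := var _ (N0 p); have := hN p; have [h1 h2] := NP p.
    set h := hsum (N p) in h1 h2 *; set q := p.+1%:R in h1 h2 * => h_1 varp.
    have q1 : 1 <= q by rewrite /q ler1n.
    have hV : 0 < h by exact: lt_le_trans ltr01 h_1.
    rewrite exprVn ler_pdivrMl ?exprn_gt0//.
    apply: le_trans varp _.
    have q0 : 0 < q by lra.
    have q20 : 0 < q ^+ 2 by rewrite exprn_gt0.
    have -> : h ^+ 2 * (3 * K / q ^+ 2) = K * (h * (h * (3 * (q ^+ 2)^-1))).
      by field; rewrite gt_eqF.
    apply: ler_wpM2l => //; apply: ler_wpM2l; first exact: ltW.
    have sq : Num.sqrt h <= q ^+ 2 + 1.
      rewrite -[leRHS]ger0_norm; last by rewrite addr_ge0// ltW.
      rewrite -sqrtr_sqr ler_wsqrtr//; apply: le_trans h2 _.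
      have -> : (q ^+ 2 + 1) ^+ 2 = q ^+ 4 + 1 + 2 * q ^+ 2 by ring.
      by rewrite lerDl mulr_ge0// ltW.
    apply: (@le_trans _ _ (q ^+ 4 * (3 * (q ^+ 2)^-1))); last first.
      by apply: ler_wpM2r => //; rewrite mulr_ge0// invr_ge0 ltW.
    have -> : q ^+ 4 * (3 * (q ^+ 2)^-1) = 3 * q ^+ 2 by field; rewrite gt_eqF.
    have : 1 <= q ^+ 2 by rewrite exprn_ege1.
    lra.
  - move=> n; rewrite -mulr_sumr; apply: ler_wpM2l; first by rewrite mulr_ge0.
    exact: sum_inv_sqr_le.
apply: filterS => w sq_cvg; apply: (havg_cvg0_subseq (uC ^~ w) NP).
apply/cvgrPdist_le => e e0; move/cvgrPdist_le : sq_cvg => /(_ (e ^+ 2)).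
move=> /(_ (exprn_gt0 _ e0)); apply: filterS => p; rewrite !sub0r !normrN.
by rewrite normrX ler_pXn2r// nnegrE// ltW.
Qed.

End logarithmic_strong_law.

(** * Independence of increments over disjoint intervals *)

Section independence.
Context {R : realType} {d : measure_display} {T : measurableType d}.
Variable P : probability T R.

Definition indep_sets (G1 G2 : set (set T)) :=
  forall A B, G1 A -> G2 B -> P (A `&` B) = (P A * P B)%E.

Lemma indep_sets_sym G1 G2 : indep_sets G1 G2 -> indep_sets G2 G1.
Proof. by move=> ind A B GA GB; rewrite setIC muleC; exact: ind. Qed.

(** For fixed [B] the two sides are finite measures in [A], which agree on a
    generating pi-system. *)
Lemma indep_sigma_algebra_left (G1 G2 : set (set T)) : setI_closed G1 ->
  G1 setT -> G1 `<=` measurable -> G2 `<=` measurable ->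
  indep_sets G1 G2 -> indep_sets <<s G1 >> G2.
Proof.
move=> IG1 G1T mG1 mG2 ind A B sA GB; have mB := mG2 _ GB.
pose c : {nonneg R} := NngNum (fine_ge0 (measure_ge0 P B)).
suff : mrestr P mB A = mscale c P A.
  by rewrite /mrestr /mscale /= fineK ?fin_num_measure// [in RHS]muleC.
apply: (@g_sigma_algebra_measure_unique _ _ _ G1 mG1 (fun=> setT)) => //.
- by rewrite bigcup_const//; exists 0%N.
- move=> C GC; change (P (C `&` B) = ((fine (P B))%:E * P C)%E).
  by rewrite fineK ?fin_num_measure// muleC; exact: ind.
- move=> _; change (P (setT `&` B) < +oo)%E.
  by rewrite setTI ltey_eq fin_num_measure.
Qed.

Lemma indep_sigma_algebra (G1 G2 : set (set T)) : setI_closed G1 ->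
  setI_closed G2 -> G1 setT -> G2 setT -> G1 `<=` measurable ->
  G2 `<=` measurable -> indep_sets G1 G2 -> indep_sets <<s G1 >> <<s G2 >>.
Proof.
move=> IG1 IG2 G1T G2T mG1 mG2 ind; apply: indep_sets_sym.
apply: indep_sigma_algebra_left => //.
  exact: smallest_sub (@sigma_algebra_measurable _ T) mG1.
by apply: indep_sets_sym; exact: indep_sigma_algebra_left.
Qed.

(** The law of the pair is the product of the laws, and Tonelli's theorem
    factors the integral. *)
Lemma expectM_indep (f g : T -> R) : bounded_rv f -> bounded_rv g ->
  (forall w, 0 <= f w) -> (forall w, 0 <= g w) ->
  (forall A B : set R, measurable A -> measurable B ->
     P (f @^-1` A `&` g @^-1` B) = (P (f @^-1` A) * P (g @^-1` B))%E) ->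
  \int[P]_w (f w * g w) = \int[P]_w f w * \int[P]_w g w.
Proof.
move=> bf bg f0 g0 ind; have [mf _] := bf; have [mg _] := bg.
pose fm : {mfun T >-> R} := HB.pack f (isMeasurableFun.Build _ _ _ _ f mf).
pose gm : {mfun T >-> R} := HB.pack g (isMeasurableFun.Build _ _ _ _ g mg).
pose fg w := (f w, g w).
have mfg : measurable_fun setT fg by exact: measurable_fun_pair.
pose fgm : {mfun T >-> (R * R)%type} :=
  HB.pack fg (isMeasurableFun.Build _ _ _ _ fg mfg).
pose m1 := distribution P fm; pose m2 := distribution P gm.
have fgE X : measurable X -> (m1 \x m2)%E X = distribution P fgm X.
  by apply: product_measure_unique => A B mA mB; exact: ind.
(* absolute values make the integrand nonnegative on the whole plane *)
pose h (z : R * R) := ((`|z.1| * `|z.2|)%:E)%E.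
have mh : measurable_fun setT h.
  apply/measurable_EFinP/measurable_funM.
    by apply: measurableT_comp => //; exact: measurable_fst.
  by apply: measurableT_comp => //; exact: measurable_snd.
have h0 z : (0 <= h z)%E by rewrite lee_fin mulr_ge0.
have mnorm : measurable_fun setT (fun x : R => `|x|%:E).
  by apply/measurable_EFinP; exact: normr_measurable.
apply: EFin_inj; rewrite EFinM -!EFin_expect//; last exact: bounded_rvM.
transitivity (\int[distribution P fgm]_z h z)%E.
  rewrite ge0_integral_pushforward//; apply: eq_integral => w _ /=.
  by rewrite /h /fg /= !ger0_norm.
transitivity (\int[m1 \x m2]_z h z)%E.
  by apply: eq_measure_integral => X mX _; apply/esym; exact: fgE.
rewrite fubini_tonelli1//.
have gE : (\int[m2]_y `|y|%:E = \int[P]_w (g w)%:E)%E.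
  rewrite ge0_integral_pushforward//; apply: eq_integral => w _ /=.
  by rewrite ger0_norm.
transitivity (\int[m1]_x (`|x|%:E * \int[P]_w (g w)%:E))%E.
  apply: eq_integral => x _; rewrite /fubini_F -gE.
  under eq_integral do rewrite /h /= EFinM.
  by rewrite ge0_integralZl.
rewrite EFin_expect// ge0_integralZr//; last first.
  by rewrite lee_fin; apply: Rintegral_ge0.
congr (_ * _)%E; rewrite ge0_integral_pushforward//.
by apply: eq_integral => w _ /=; rewrite ger0_norm.
Qed.

Variable V : levy_process P.

Section increments.
Variable t : nat -> R.
Hypotheses (t0 : 0 <= t 0%N) (tm : {homo t : i j / (i <= j)%N >-> i <= j}).

Let t_ge0 i : 0 <= t i.
Proof. by apply: le_trans t0 (tm _). Qed.

Definition increment i w := V w (t i.+1) - V w (t i).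

Lemma measurable_increment i : measurable_fun setT (increment i).
Proof. by apply: measurable_funB; exact: levy_measurable. Qed.

(** A pi-system generating the sigma-algebra of the increments numbered from
    [p] to [q - 1], on which independence is a product formula. *)
Definition increment_rect p q : set (set T) :=
  [set A | exists2 B : nat -> set R, (forall i, measurable (B i)) &
     A = [set w | forall i, (p <= i < q)%N -> B i (increment i w)]].

Lemma increment_rectT p q : increment_rect p q setT.
Proof. by exists (fun=> setT) => //; apply/seteqP; split. Qed.

Lemma increment_rectI p q : setI_closed (increment_rect p q).
Proof.
move=> _ _ [A mA ->] [B mB ->]; exists (fun i => A i `&` B i).
  by move=> i; exact: measurableI.
apply/seteqP; split => w /=; first by move=> [Aw Bw] i ipq; split; auto.
by move=> ABw; split=> i ipq; have [] := ABw i ipq.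
Qed.

Lemma increment_rect_measurable p q : increment_rect p q `<=` measurable.
Proof.
move=> _ [B mB ->].
rewrite (_ : [set _ | _] = \bigcap_(i in [set i | (p <= i < q)%N])
    (increment i @^-1` B i)); last by apply/seteqP; split => w /= H i; exact: H.
apply: bigcap_measurableType => i _; rewrite -[X in measurable X]setTI.
exact: measurable_increment.
Qed.

Lemma prob_increments n (B : nat -> set R) : (forall i, measurable (B i)) ->
  P [set w | forall i, (i < n)%N -> B i (increment i w)] =
  (\prod_(i < n) P [set w | B i (increment i w)])%E.
Proof.
move=> mB; rewrite -(levy_indep V t0 tm (B := fun i : 'I_n => B i)) => [|i]; last exact: mB.
congr (P _); apply/seteqP; split => w /= H i; first exact: H.
by move=> i_n; exact: (H (Ordinal i_n)).
Qed.

(** The intersection of a rectangle in the first [p] increments with one in the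
    next ones is a rectangle in the first [q], whose probability is a product. *)
Lemma increment_rect_indep p q : (p <= q)%N ->
  indep_sets (increment_rect 0 p) (increment_rect p q).
Proof.
move=> pq _ _ [A mA ->] [B mB ->].
pose A' i := if (i < p)%N then A i else setT.
pose B' i := if (i < p)%N then setT else B i.
have mA' i : measurable (A' i) by rewrite /A'; case: ifP.
have mB' i : measurable (B' i) by rewrite /B'; case: ifP.
have -> : [set w | forall i, (0 <= i < p)%N -> A i (increment i w)] =
    [set w | forall i, (i < q)%N -> A' i (increment i w)].
  apply/seteqP; split => w /= H i.
    by rewrite /A'; case: ifP => // ip _; exact: H.
  by move=> ip; have := H i (leq_trans ip pq); rewrite /A' (ip : (i < p)%N).
have -> : [set w | forall i, (p <= i < q)%N -> B i (increment i w)] =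
    [set w | forall i, (i < q)%N -> B' i (increment i w)].
  apply/seteqP; split => w /= H i.
    by move=> iq; rewrite /B'; case: ltnP => // pi; apply: H; rewrite pi.
  by move=> /andP[pi iq]; have := H i iq; rewrite /B' ltnNge pi.
have -> : [set w | forall i, (i < q)%N -> A' i (increment i w)] `&`
    [set w | forall i, (i < q)%N -> B' i (increment i w)] =
    [set w | forall i, (i < q)%N -> (A' i `&` B' i) (increment i w)].
  apply/seteqP; split => w /=; first by move=> [HA HB] i iq; split; auto.
  by move=> H; split=> i iq; have [] := H i iq.
rewrite (prob_increments q mA') (prob_increments q mB').
rewrite (prob_increments q (B := fun i => A' i `&` B' i)); last first.
  by move=> i; exact: measurableI.
rewrite -big_split; apply: eq_bigr => i _ /=; rewrite /A' /B'.
have PT : P [set w | [set: R] (increment i w)] = 1%E.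
  by rewrite (_ : [set w | _] = setT) ?probability_setT//; apply/seteqP; split.
case: ifP => _; rewrite PT ?mule1 ?mul1e; congr (P _);
  by apply/seteqP; split => w /=; [case|split].
Qed.

Lemma increment_sigma_indep p q : (p <= q)%N ->
  indep_sets <<s increment_rect 0 p >> <<s increment_rect p q >>.
Proof.
move=> pq; apply: indep_sigma_algebra; try exact: increment_rectI;
  try exact: increment_rectT; try exact: increment_rect_measurable.
exact: increment_rect_indep.
Qed.

Lemma increment_sigma_measurable p q A : <<s increment_rect p q >> A -> measurable A.
Proof.
exact: (smallest_sub (@sigma_algebra_measurable _ T) (@increment_rect_measurable p q)).
Qed.

Lemma measurable_path_diff p q i j : (p <= i <= j)%N -> (j <= q)%N ->
  measurable_fun [set: g_sigma_algebraType (increment_rect p q)]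
    (fun w => V w (t j) - V w (t i)).
Proof.
move=> /andP[pi ij]; rewrite -(subnK ij); elim: (j - i)%N => [|k IH] kq.
  under eq_fun do rewrite add0n subrr; exact: measurable_cst.
rewrite addSn in kq *.
rewrite (_ : (fun _ => _) = (fun w : g_sigma_algebraType (increment_rect p q) =>
    increment (k + i) w + (V w (t (k + i)%N) - V w (t i)))); last first.
  by apply/funext => w; rewrite /increment addrA subrK.
apply: measurable_funD; last exact: IH (ltnW kq).
move=> _ B mB; rewrite setTI; apply: sub_sigma_algebra.
exists (fun l => if l == (k + i)%N then B else setT).
  by move=> l; case: ifP.
apply/seteqP; split => w /= H; first by move=> l _; case: eqP => [->|].
have := H (k + i)%N; rewrite eqxx kq andbT; apply.
by rewrite (leq_trans pi)// leq_addl.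
Qed.

End increments.

End independence.

(** * Removing the beginning of a path *)

Section path_after.
Context {R : realType}.
Implicit Types (f : skorohod R) (h t : R).

Lemma cadlag_stopped f h : cadlag `[0, 1]%classic (fun t => f (Num.min t h)).
Proof.
move=> t tI; have [/cvg_within_rightP fr [l /cvg_within_leftP fl]] :=
  @skorohod_cadlag _ f t tI.
split.
  apply/cvg_within_rightP => e e0; have [th|ht] := ltP t h; last first.
    exists 1 => // u _ tu _; rewrite min_r ?subrr ?normr0//.
    by rewrite (le_trans ht) ?ltW.
  have [d d0 {}fr] := fr e e0.
  exists (Num.min d (h - t)); first by rewrite lt_min d0 subr_gt0.
  move=> u uI tu; rewrite -ltrBlDl lt_min !ltrBlDl => /andP[ud].
  rewrite [t + _]addrC subrK => uh; rewrite min_l ?(ltW uh)//; exact: fr.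
have [ht|th] := ltP h t.
  exists (f h); apply/cvg_within_leftP => e e0.
  exists (t - h); first by rewrite subr_gt0.
  move=> u _; rewrite subKr => hu _.
  by rewrite min_r ?subrr ?normr0// ltW.
exists l; apply/cvg_within_leftP => e /fl[d d0 {}fl]; exists d => // u uI tdu ut.
rewrite min_l; first exact: fl.
by apply: ltW; exact: lt_le_trans th.
Qed.

Lemma cadlagB (A : set R) (f g : R -> R) : cadlag A f -> cadlag A g ->
  cadlag A (fun t => f t - g t).
Proof.
move=> cf cg t At; have [fr [l fl]] := cf t At; have [gr [l' gl]] := cg t At.
by split; [exact: cvgB fr gr|exists (l - l'); exact: cvgB fl gl].
Qed.

(** Subtracting the stopped path leaves only the increments after time [h]. *)
Definition path_after h f : skorohod R :=
  skorohod_restrict (cadlagB (@skorohod_cadlag _ f) (cadlag_stopped f h)).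

Lemma path_afterE h f t : 0 <= t <= 1 ->
  path_after h f t = f t - f (Num.min t h).
Proof. by move=> tI; rewrite /= patchE mem_set//= in_itv. Qed.

(** Beyond time [h], removing the beginning subtracts the constant [f h]. *)
Lemma dist_path_after h f e : 0 <= h ->
  (forall t, 0 <= t <= 1 -> t <= h -> `|f t| <= e) ->
  mdist f (path_after h f) <= e.
Proof.
move=> h0 fe; apply: skorohod_dist_le_uniform => t tI.
rewrite path_afterE// subKr; apply: fe; last by rewrite ge_min lexx orbT.
have /andP[t0 t1] := tI.
by rewrite le_min t0 h0 /= ge_min t1.
Qed.

End path_after.

(** * Oscillation of a path near time 0 *)

Section small_initial_oscillation.
Context {R : realType}.
Implicit Types (f g : skorohod R) (h e : R).

Definition initially_small h e : set (skorohod R) :=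
  [set g | forall t, 0 <= t <= 1 -> t <= h -> `|g t| <= e].

Let rho e : R := Num.min e (ln 2).

Let rho_gt0 e : 0 < e -> 0 < rho e.
Proof. by move=> e0; rewrite lt_min e0 ln_gt0// ltr1n. Qed.

(** A continuous substitute for the indicator of a large initial oscillation:
    1 on paths that exceed [2 * e] by time [h], and 0 on paths bounded by [e]
    up to time [2 * h].  The times differ by a factor 2 because paths at
    Skorohod distance less than [ln 2] match up to a time change that at most
    doubles the elapsed time; this is why [rho] involves [ln 2]. *)
Definition initial_oscillation h e f : R :=
  Num.min 1 (set_dist (initially_small (2 * h) e) f / rho e).

Let small_neq0 h e : 0 < e -> initially_small h e !=set0.
Proof.
move=> e0; exists (skorohod_restrict (cadlag_cst (0 : R))) => t tI _.
by rewrite /= patchE; case: ifP => _; rewrite normr0 ltW.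
Qed.

Lemma initial_oscillation_continuous h e : 0 < e ->
  continuous (initial_oscillation h e).
Proof.
move=> e0; apply: (@lipschitz_continuous _ _ _ (rho e)^-1) => x y.
have rV : 0 <= (rho e)^-1 by rewrite invr_ge0 ltW// rho_gt0.
have L : `|set_dist (initially_small (2 * h) e) x / rho e -
   set_dist (initially_small (2 * h) e) y / rho e| <= (rho e)^-1 * mdist x y.
  rewrite -mulrBl normrM [X in _ * X]ger0_norm// mulrC ler_wpM2l//.
  by have := set_dist_lip (small_neq0 (2 * h) e0) x y; rewrite mul1r.
move: L; rewrite /initial_oscillation.
have := mulr_ge0 rV (mdist_ge0 x y).
set a := set_dist _ x / _; set b := set_dist _ y / _; set c := _ * _ => c0.
rewrite !ler_norml => /andP[? ?].
by have [?|?] := leP 1 a; have [?|?] := leP 1 b; apply/andP; split; lra.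
Qed.

Lemma initial_oscillation_ge0 h e f : 0 < e -> 0 <= initial_oscillation h e f.
Proof.
move=> e0; rewrite le_min ler01 divr_ge0 ?(ltW (rho_gt0 e0))//.
by apply: set_dist_ge => [|y _]; [exact: small_neq0|exact: mdist_ge0].
Qed.

Lemma initial_oscillation_le1 h e f : initial_oscillation h e f <= 1.
Proof. by rewrite ge_min lexx. Qed.

Lemma initial_oscillation_eq0 h e f : 0 < e ->
  initially_small (2 * h) e f -> initial_oscillation h e f = 0.
Proof.
move=> e0 fS; apply/eqP; rewrite eq_le initial_oscillation_ge0// andbT.
rewrite ge_min; apply/orP; right; rewrite ler_pdivrMr ?rho_gt0// mul0r.
by rewrite -(mdistxx f); exact: set_dist_le.
Qed.

Lemma initial_oscillation_lt1 h e f : 0 < e ->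
  initial_oscillation h e f < 1 -> initially_small h (2 * e) f.
Proof.
move=> e0 + t tI th; rewrite gt_min ltxx /= ltr_pdivrMr ?rho_gt0// mul1r.
move=> dlt; rewrite leNgt; apply/negP => ft.
move: dlt; apply/negP; rewrite -leNgt; apply: set_dist_ge; first exact: small_neq0.
move=> g gS; rewrite leNgt; apply/negP => /skorohod_dist_lt[l tl [l1 l2]].
have lt2 := time_change_le_double tl _ tI.
have {lt2} : l t <= 2 * t.
  by apply: lt2 => x y x0 xy y1; apply: lt_le_trans (l1 x y x0 xy y1) _;
    rewrite ge_min lexx orbT.
move=> lt2; have lI := time_change_itv tl tI.
have gl : `|g (l t)| <= e by apply: gS => //; lra.
have := l2 t tI; rewrite lt_min => /andP[fg _].
by have := ler_normD (f t - g (l t)) (g (l t)); rewrite subrK; lra.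
Qed.

Lemma initially_small_cvg f e : f 0 = 0 -> 0 < e ->
  \forall n \near \oo, initially_small (2 * n.+1%:R^-1) e f.
Proof.
move=> f0 e0; have I0 : `[0, 1]%classic (0 : R) by rewrite /= in_itv /= lexx ler01.
have [/cvg_within_rightP/(_ e e0)[dl dl0 fr] _] := @skorohod_cadlag _ f 0 I0.
exists (Num.truncn (2 / dl)) => // n /= n_ge t /andP[t0 t1] th.
move: t0; rewrite le_eqVlt => /predU1P[<-|t0]; first by rewrite f0 normr0 ltW.
have := fr t; rewrite f0 subr0 add0r => fr'; apply/ltW/fr' => //.
  by rewrite /= in_itv /= t1 ltW.
apply: le_lt_trans th _; rewrite ltr_pdivrMr ?ltr0n// mulrC -ltr_pdivrMr//.
by apply: lt_le_trans (truncnS_gt _) _; rewrite ler_nat ltnS.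
Qed.

End small_initial_oscillation.

(** * Rescaled paths of a Levy process *)

Section rescaled_levy.
Context {R : realType} {d : measure_display} {T : measurableType d}.
Variables (P : probability T R) (V : levy_process P).
Implicit Types (s : {posnum R}) (a b c h t : R).

Lemma levy_rescaleE s a b w t : 0 <= t <= 1 ->
  levy_rescale V s a b w t = V w (s%:num * t) / a - t * b.
Proof. by move=> tI; rewrite /= patchE mem_set//= in_itv. Qed.

Lemma measurable_levy_rescale s a b t : 0 <= t <= 1 ->
  measurable_fun setT (fun w => levy_rescale V s a b w t).
Proof.
move=> tI; under eq_fun do rewrite levy_rescaleE//.
apply: measurable_funB => //; apply: measurable_funM => //.
by apply: levy_measurable; rewrite mulr_ge0//; case/andP: tI.
Qed.

Lemma measurable_path_after (X : T -> skorohod R) h t : 0 <= h ->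
  (forall t, 0 <= t <= 1 -> measurable_fun setT (fun w => X w t)) ->
  0 <= t <= 1 -> measurable_fun setT (fun w => path_after h (X w) t).
Proof.
move=> h0 mX tI; under eq_fun do rewrite path_afterE//.
apply: measurable_funB; first exact: mX.
by apply: mX; case/andP: tI => t0 t1; rewrite le_min t0 h0 /= ge_min t1.
Qed.

(** On the grid of mesh [1 / M] the path after time [c / s] is a function of
    the increments of [V] between the times [max(s * i / M, c)]. *)
Lemma path_after_grid s a b c M i w : 0 <= c -> (i <= M)%N -> (0 < M)%N ->
  path_after (c / s%:num) (levy_rescale V s a b w) (i%:R / M%:R) =
  (V w (Num.max (s%:num * (i%:R / M%:R)) c) - V w c) / a -
  (i%:R / M%:R - Num.min (i%:R / M%:R) (c / s%:num)) * b.
Proof.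
move=> c0 iM M0.
have MR : 0 < M%:R :> R by rewrite ltr0n.
have xI : 0 <= (i%:R / M%:R : R) <= 1.
  by rewrite divr_ge0 ?ler0n//= ler_pdivrMr// mul1r ler_nat.
set x : R := i%:R / M%:R in xI *; have /andP[x0 x1] := xI.
have h0 : 0 <= c / s%:num by rewrite divr_ge0.
rewrite path_afterE// !levy_rescaleE//; last by rewrite le_min x0 h0 /= ge_min x1.
have [xc|cx] := leP x (c / s%:num).
  rewrite max_r; last by rewrite mulrC -ler_pdivlMr.
  by rewrite !subrr !mul0r subrr.
rewrite max_l; last by rewrite mulrC -ler_pdivrMr// ltW.
by rewrite [s%:num * (c / _)]mulrC divfK ?gt_eqF//; ring.
Qed.

(** The two paths depend on what [V] does from [c] to [s] and from [c'] to [s']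
    respectively, and these time intervals do not overlap.  For the discretized
    paths this is independence of finitely many increments; the general case is
    the limit of infinitely fine grids. *)
Lemma expectM_path_after s a b c s' a' b' c' (F G : skorohod R -> R) C :
  0 <= c -> c <= s%:num -> s%:num <= c' -> c' <= s'%:num ->
  continuous F -> continuous G ->
  (forall x, 0 <= F x <= C) -> (forall x, 0 <= G x <= C) ->
  let X w := path_after (c / s%:num) (levy_rescale V s a b w) in
  let X' w := path_after (c' / s'%:num) (levy_rescale V s' a' b' w) in
  \int[P]_w (F (X w) * G (X' w)) = \int[P]_w F (X w) * \int[P]_w G (X' w).
Proof.
move=> c0 cs sc' cs' cF cG FC GC X X'.
have c'0 : 0 <= c' by apply: le_trans sc'.
have mX t : 0 <= t <= 1 -> measurable_fun setT (fun w => X w t).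
  by apply: measurable_path_after => //; [rewrite divr_ge0|exact: measurable_levy_rescale].
have mX' t : 0 <= t <= 1 -> measurable_fun setT (fun w => X' w t).
  by apply: measurable_path_after => //; [rewrite divr_ge0|exact: measurable_levy_rescale].
pose f m w := F (step_path m (discretize m (X w))).
pose g m w := G (step_path m (discretize m (X' w))).
have gridI m i : (i <= m.+1)%N -> 0 <= (i%:R / m.+1%:R : R) <= 1.
  by move=> im; rewrite divr_ge0 ?ler0n//= ler_pdivrMr ?ltr0n// mul1r ler_nat.
have mf m : measurable_fun setT (f m).
  by apply: measurable_step_path => i im; apply: mX; exact: gridI.
have mg m : measurable_fun setT (g m).
  by apply: measurable_step_path => i im; apply: mX'; exact: gridI.
have FN x : `|F x| <= C by have /andP[? ?] := FC x; rewrite ger0_norm.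
have GN x : `|G x| <= C by have /andP[? ?] := GC x; rewrite ger0_norm.
have C0 : 0 <= C by apply: le_trans (normr_ge0 _) (FN point).
have f_cvg w : f m w @[m --> \oo] --> F (X w).
  exact: continuous_mdist_cvg (@discretize_cvg _ _).
have g_cvg w : g m w @[m --> \oo] --> G (X' w).
  exact: continuous_mdist_cvg (@discretize_cvg _ _).
have Ef : \int[P]_w f m w @[m --> \oo] --> \int[P]_w F (X w).
  by apply: (@expect_cvg _ _ _ _ _ _ C) => // m w; exact: FN.
have Eg : \int[P]_w g m w @[m --> \oo] --> \int[P]_w G (X' w).
  by apply: (@expect_cvg _ _ _ _ _ _ C) => // m w; exact: GN.
have Efg : \int[P]_w (f m w * g m w) @[m --> \oo] --> \int[P]_w (F (X w) * G (X' w)).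
  apply: (@expect_cvg _ _ _ _ _ _ (C * C)).
  - by move=> m; exact: measurable_funM.
  - by move=> m w; rewrite normrM ler_pM// (FN, GN).
  - by move=> w; exact: cvgM (f_cvg w) (g_cvg w).
apply: (cvg_unique _ Efg) => //=.
suff -> : (fun m => \int[P]_w (f m w * g m w)) =
    (fun m => \int[P]_w f m w * \int[P]_w g m w) by exact: cvgM.
apply/funext => m.
pose M := m.+1.
(* the times read by the first path, followed by those read by the second;
   the increment numbered [M] bridges the gap between [s] and [c'] *)
pose t i : R := if (i <= M)%N then Num.max (s%:num * (i%:R / M%:R)) c
  else Num.max (s'%:num * ((minn (i - M.+1) M)%:R / M%:R)) c'.
have MR : 0 < M%:R :> R by rewrite ltr0n.
have tE1 i : (i <= M)%N -> t i = Num.max (s%:num * (i%:R / M%:R)) c.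
  by move=> iM; rewrite /t iM.
have tE2 i : (i <= M)%N -> t (M.+1 + i)%N = Num.max (s'%:num * (i%:R / M%:R)) c'.
  move=> iM; rewrite /t ifF; last by apply/negbTE; rewrite -ltnNge ltn_addr.
  by rewrite addKn (minn_idPl iM).
have t0 : 0 <= t 0%N by rewrite tE1// le_max c0 orbT.
have le_max2 (x y z : R) : x <= y -> Num.max x z <= Num.max y z.
  by move=> xy; rewrite ge_max !le_max xy lexx orbT.
have tm : {homo t : i j / (i <= j)%N >-> i <= j}.
  apply: homo_leq => //; first exact: le_trans.
  move=> i; rewrite /t; have [iM|Mi] := ltnP i M.
    rewrite (ltnW iM); apply: le_max2.
    by rewrite ler_pM2l// ler_pM2r ?invr_gt0// ler_nat.
  have [iM|Mi'] := leqP i M.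
    apply: (@le_trans _ _ c'); last by rewrite le_max lexx orbT.
    rewrite ge_max (le_trans cs sc') andbT; apply: le_trans sc'.
    rewrite ler_piMr// ler_pdivrMr// mul1r ler_nat//.
  apply: le_max2.
  rewrite ler_pM2l// ler_pM2r ?invr_gt0// ler_nat leq_min geq_minr andbT.
  by apply: leq_trans (geq_minl _ _) _; rewrite leq_sub2r.
have fS B : measurable B -> <<s increment_rect V t 0 M.+1 >> (f m @^-1` B).
  move=> mB; rewrite -[f m @^-1` B]setTI.
  have := @measurable_step_path R _ (g_sigma_algebraType (increment_rect V t 0 M.+1)) X m.
  move=> /(_ _ F measurableT B mB); apply => i im.
  under eq_fun do rewrite path_after_grid//.
  apply: measurable_funB => //; apply: measurable_funM => //.
  have tc : t 0%N = c by rewrite tE1// mul0r mulr0 max_r.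
  rewrite -(tE1 i im) -tc.
  by apply: measurable_path_diff => //; exact: leqW.
have gS B : measurable B -> <<s increment_rect V t M.+1 (M.+1 + M) >> (g m @^-1` B).
  move=> mB; rewrite -[g m @^-1` B]setTI.
  have := @measurable_step_path R _ (g_sigma_algebraType (increment_rect V t M.+1 (M.+1 + M))) X' m.
  move=> /(_ _ G measurableT B mB); apply => i im.
  under eq_fun do rewrite path_after_grid//.
  apply: measurable_funB => //; apply: measurable_funM => //.
  have tc : t (M.+1 + 0)%N = c' by rewrite tE2// mul0r mulr0 max_r.
  rewrite -(tE2 i im) -tc.
  apply: measurable_path_diff; first by rewrite leq_addr leq_add2l.
  by rewrite leq_add2l.
apply: expectM_indep.
- by apply: bounded_rvP => // w; exact: FN.
- by apply: bounded_rvP => // w; exact: GN.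
- by move=> w; case/andP: (FC (step_path m (discretize m (X w)))).
- by move=> w; case/andP: (GC (step_path m (discretize m (X' w)))).
- move=> A B mA mB.
  exact: (@increment_sigma_indep _ _ _ _ V t t0 tm _ _ (leq_addr M M.+1) _ _ (fS A mA) (gS B mB)).
Qed.

End rescaled_levy.

(** * Ottaviani's inequality and the tail of the initial supremum *)

Section initial_tail.
Context {R : realType} {d : measure_display} {T : measurableType d}.
Variables (P : probability T R) (V : levy_process P).

Lemma levy_homogeneous0 t h (B : set R) : 0 <= t -> 0 <= h -> measurable B ->
  P [set w | B (V w (t + h) - V w t)] = P [set w | B (V w h)].
Proof.
move=> t0 h0 mB; rewrite (levy_homogeneous V)//.
by congr (P _); apply/seteqP; split => w /=; rewrite levy0 subr0.
Qed.

(** Since [(1 - p) ^ N * (1 + N * p) <= 1], as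
    [(1 - p) * (1 + (N + 1) * p) <= 1 + N * p]. *)
Lemma bernoulli_bound (p : R) N : 0 <= p <= 1 -> 2^-1 <= (1 - p) ^+ N ->
  N%:R * p <= 1.
Proof.
move=> /andP[p0 p1] pN.
suff H : (1 - p) ^+ N * (1 + N%:R * p) <= 1.
  have : 0 <= N%:R * p by rewrite mulr_ge0.
  nra.
elim: N {pN} => [|N IH]; first by rewrite expr0 mul0r addr0 mulr1.
rewrite exprSr -mulrA; apply: le_trans IH; apply: ler_wpM2l.
  by rewrite exprn_ge0// subr_ge0.
rewrite -natr1; have : 0 <= N%:R :> R by [].
nra.
Qed.

Variables (s : {posnum R}) (a b : R).
Let X := levy_rescale V s a b.

Let measurable_X t : 0 <= t <= 1 -> measurable_fun setT (fun w => X w t).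
Proof. exact: measurable_levy_rescale. Qed.

Let X0 w : X w 0 = 0.
Proof.
by rewrite /X levy_rescaleE ?lexx ?ler01// mulr0 levy0 !mul0r subr0.
Qed.

Let X_diff w x y : 0 <= x -> x <= y -> y <= 1 ->
  X w y - X w x = (V w (s%:num * y) - V w (s%:num * x)) / a - (y - x) * b.
Proof.
move=> x0 xy y1.
rewrite /X !levy_rescaleE ?x0 ?(le_trans xy) ?y1 ?(le_trans x0)//; ring.
Qed.

Let measurable_exceeds e (f : T -> R) : measurable_fun setT f ->
  measurable [set w | e < `|f w|].
Proof.
move=> mf; rewrite (_ : [set _ | _] = (fun w => `|f w|) @^-1` `]e, +oo[%classic).
  by rewrite -[X in measurable X]setTI; apply: measurableT_comp.
by apply/seteqP; split => w /=; rewrite in_itv /= andbT.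
Qed.

Let prob_exceeds_diff e x y : 0 <= x -> x <= y -> y <= 1 ->
  P [set w | e < `|X w y - X w x|] = P [set w | e < `|X w (y - x)|].
Proof.
move=> x0 xy y1.
pose B := [set z : R | e < `|z / a - (y - x) * b|].
have mB : measurable B.
  rewrite (_ : B = (fun z => `|z / a - (y - x) * b|) @^-1` `]e, +oo[%classic).
    rewrite -[X in measurable X]setTI.
    have : measurable_fun setT (fun z : R => `|z / a - (y - x) * b|).
      apply: measurableT_comp => //; apply: measurable_funB => //.
      exact: measurable_funM.
    exact.
  by apply/seteqP; split => w /=; rewrite in_itv /= andbT.
have := @levy_homogeneous0 (s%:num * x) (s%:num * (y - x)) B.
rewrite -mulrDr [x + _]addrC subrK.
move=> H; have {}H := H ltac:(by rewrite mulr_ge0)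
  ltac:(by rewrite mulr_ge0// subr_ge0) mB.
have yxI : 0 <= y - x <= 1 by rewrite subr_ge0 xy lerBlDr (le_trans y1) ?lerDl.
rewrite [LHS](_ : _ = P [set w | B (V w (s%:num * y) - V w (s%:num * x))]).
  rewrite H; congr (P _); apply/funext => w.
  by rewrite /mkset /B /mkset /X levy_rescaleE.
by congr (P _); apply/funext => w; rewrite /mkset X_diff.
Qed.

(** Outside of [A] the path is displaced by at most [e] over each of the [N]
    blocks of length [h] that fit in the interval from 0 to [h0].  As the
    displacements are independent and distributed like the first one, this
    forces [(1 - p) ^ N >= 1 / 2] for the probability [p] in question, hence
    [N * p <= 1]. *)
Lemma prob_exceeds_le e h0 h (A : set T) : 0 < h -> h <= h0 -> h0 <= 1 ->
  measurable A -> (P A <= 2^-1%:E)%E ->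
  (forall w, ~ A w -> forall t, 0 <= t <= 1 -> t <= h0 -> `|X w t| <= e / 2) ->
  (P [set w | (e < `|X w h|)%R] <= (2 * h / h0)%:E)%E.
Proof.
move=> h_gt0 hh0 h01 mA PA AX.
have h0_gt0 : 0 < h0 by lra.
pose N := Num.truncn (h0 / h).
have /andP[N1 N2] := truncn_itv (ltW (divr_gt0 h0_gt0 h_gt0)).
rewrite -/N in N1 N2.
have N_gt0 : (0 < N)%N.
  by rewrite /N truncn_gt0 ler_pdivlMr// mul1r.
have Nh : N%:R * h <= h0 by rewrite -ler_pdivlMr.
set p := P _.
have mp : measurable [set w | e < `|X w h|].
  by apply/measurable_exceeds/measurable_X; rewrite (ltW h_gt0) (le_trans hh0).
have p_fin : p \is a fin_num by rewrite fin_num_measure.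
pose t i := s%:num * (i%:R * h).
have t_ge0 : 0 <= t 0%N by rewrite /t mul0r mulr0.
have tm : {homo t : i j / (i <= j)%N >-> i <= j}.
  by move=> i j ij; rewrite ler_pM2l// ler_pM2r// ler_nat.
have hI : h <= 1 by lra.
have ihI i : (i <= N)%N -> 0 <= i%:R * h <= 1.
  move=> iN; rewrite mulr_ge0 ?(ltW h_gt0)//=; apply: le_trans h01.
  by apply: le_trans Nh; rewrite ler_pM2r// ler_nat.
pose B := [set z : R | `|z / a - h * b| <= e].
have mB : measurable B.
  rewrite (_ : B = (fun z => `|z / a - h * b|) @^-1` `]-oo, e]%classic).
    rewrite -[X in measurable X]setTI.
    have : measurable_fun setT (fun z : R => `|z / a - h * b|).
      apply: measurableT_comp => //; apply: measurable_funB => //.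
      exact: measurable_funM.
    exact.
  by apply/seteqP; split => w /=; rewrite in_itv.
have incE i w : (i < N)%N -> B (increment V t i w) <->
    `|X w (i.+1%:R * h) - X w (i%:R * h)| <= e.
  move=> iN; rewrite X_diff.
  - rewrite /B /increment /t /= (_ : i.+1%:R * h - i%:R * h = h)//.
    by rewrite -natr1 mulrDl mul1r addrAC subrr add0r.
  - by case/andP: (ihI _ (ltnW iN)).
  - by rewrite ler_pM2r// ler_nat.
  - by case/andP: (ihI _ iN).
have blockE i : (i < N)%N -> P [set w | B (increment V t i w)] = (1 - p)%E.
  move=> iN; have : [set w | B (increment V t i w)] =
      ~` [set w | e < `|X w (i.+1%:R * h) - X w (i%:R * h)|].
    apply/seteqP; split => w /=; first by move=> /(incE _ _ iN) H; apply/negP; rewrite -leNgt.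
    by move=> /negP; rewrite -leNgt => /(incE _ _ iN).
  move=> ->; rewrite probability_setC; last first.
    apply: measurable_exceeds; apply: measurable_funB; apply: measurable_X.
      exact: ihI.
    exact: (ihI _ (ltnW iN)).
  rewrite prob_exceeds_diff.
  - by rewrite -mulrBl -natr1 [_ + 1]addrC addrK mul1r.
  - by case/andP: (ihI _ (ltnW iN)).
  - by rewrite ler_pM2r// ler_nat.
  - by case/andP: (ihI _ iN).
have pE : p = (fine p)%:E by rewrite fineK.
have p01 : 0 <= fine p <= 1.
  by rewrite -!lee_fin -pE measure_ge0 probability_le1.
have half : 2^-1 <= (1 - fine p) ^+ N.
  rewrite -lee_fin.
  have <- : P [set w | forall i, (i < N)%N -> B (increment V t i w)] =
      ((1 - fine p) ^+ N)%:E.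
    rewrite (@prob_increments _ _ _ P V t t_ge0 tm N (fun=> B))//.
    rewrite (eq_bigr (fun=> (1 - fine p)%:E)) => [|i _].
      by rewrite prodEFin prodr_const card_ord.
    by rewrite blockE// EFinB -pE.
  have mI : measurable [set w | forall i, (i < N)%N -> B (increment V t i w)].
    apply: (@increment_rect_measurable _ _ _ _ V t t_ge0 tm 0 N).
    by exists (fun=> B).
  apply: (@le_trans _ _ (P (~` A))).
    have PAE : P A = (fine (P A))%:E by rewrite fineK ?fin_num_measure.
    by rewrite probability_setC//; move: PA; rewrite PAE -EFinB !lee_fin; lra.
  apply: le_measure; rewrite ?inE//; first exact: measurableC.
  move=> w nAw i iN; apply/(incE _ _ iN).
  have AX' j : (j <= N)%N -> `|X w (j%:R * h)| <= e / 2.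
    move=> jN; apply: AX => //; first exact: ihI.
    by apply: le_trans Nh; rewrite ler_pM2r// ler_nat.
  apply: le_trans (ler_normB _ _) _.
  by have := AX' _ iN; have := AX' _ (ltnW iN); lra.
have Np := bernoulli_bound p01 half.
rewrite pE lee_fin.
have N0 : 0 < N%:R :> R by rewrite ltr0n.
have NN : h0 / h < 2 * N%:R.
  apply: lt_le_trans N2 _; rewrite -natr1 mulr_natl mulr2n lerD2l.
  by rewrite ler1n.
rewrite ler_pdivlMr//.
have : h0 < 2 * N%:R * h by rewrite -ltr_pdivrMr.
case/andP: p01 => p0 _; nra.
Qed.

(** Ottaviani's inequality: if the path has exceeded [2 * e] on the grid, then
    either it exceeds [e] at time [h], or it has moved by more than [e] since
    it first exceeded [2 * e]; that last displacement is independent of the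
    past and distributed like the path at the time elapsed. *)
Lemma prob_grid_exceeds_le e h (q : R) M : (0 < M)%N -> 0 <= h <= 1 ->
  (forall x, 0 <= x <= h -> (P [set w | (e < `|X w x|)%R] <= q%:E)%E) ->
  (P [set w | exists2 i, (i <= M)%N & (2 * e < `|X w (h * (i%:R / M%:R))|)%R]
    <= (2 * q)%:E)%E.
Proof.
move=> M0 /andP[h_ge0 h1] Pq.
have MR : 0 < M%:R :> R by rewrite ltr0n.
have q0 : 0 <= q.
  by rewrite -lee_fin; apply: le_trans (Pq 0 _); rewrite ?lexx.
pose x (i : nat) : R := h * ((minn i M)%:R / M%:R).
have xE i : (i <= M)%N -> x i = h * (i%:R / M%:R) by move=> iM; rewrite /x (minn_idPl iM).
have xm : {homo x : i j / (i <= j)%N >-> i <= j}.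
  move=> i j ij; rewrite ler_wpM2l// ler_pM2r ?invr_gt0// ler_nat.
  by rewrite leq_min geq_minr andbT (leq_trans (geq_minl _ _)).
have xI i : 0 <= x i <= h.
  rewrite mulr_ge0 ?divr_ge0//= ler_piMr// ler_pdivrMr// mul1r ler_nat.
  exact: geq_minr.
have xI1 i : 0 <= x i <= 1 by case/andP: (xI i) => -> /le_trans ->.
have xM : x M = h by rewrite xE// divff ?mulr1// gt_eqF.
pose t i := s%:num * x i.
have t0 : 0 <= t 0%N by rewrite /t /x min0n mul0r !mulr0.
have tm : {homo t : i j / (i <= j)%N >-> i <= j}.
  by move=> i j ij; rewrite ler_pM2l//; exact: xm.
have x0 : x 0%N = 0 by rewrite /x min0n mul0r mulr0.
have path_sigma p r i : (p <= i <= r)%N ->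
    measurable_fun [set: g_sigma_algebraType (increment_rect V t p r)]
      (fun w => X w (x i) - X w (x p)).
  move=> /andP[pi ir].
  rewrite (_ : (fun _ => _) = (fun w : g_sigma_algebraType (increment_rect V t p r) =>
      (V w (t i) - V w (t p)) / a - (x i - x p) * b)); last first.
    apply/funext => w; rewrite X_diff//; first by case/andP: (xI1 p).
      exact: xm.
    by case/andP: (xI1 i).
  apply: measurable_funB => //; apply: measurable_funM => //.
  by apply: measurable_path_diff => //; rewrite leqnn.
have path_sigma0 r i : (i <= r)%N ->
    measurable_fun [set: g_sigma_algebraType (increment_rect V t 0 r)]
      (fun w => X w (x i)).
  move=> ir; have := @path_sigma 0%N r i ir.
  by under eq_fun do rewrite x0 X0 subr0.
have sigma_exceeds p r c (f : T -> R) :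
    measurable_fun [set: g_sigma_algebraType (increment_rect V t p r)] f ->
    <<s increment_rect V t p r >> [set w | c < `|f w|].
  move=> mf.
  have -> : [set w | c < `|f w|] = setT `&` (fun w => `|f w|) @^-1` `]c, +oo[%classic.
    by rewrite setTI; apply/seteqP; split => w /=; rewrite in_itv /= andbT.
  have mn : measurable_fun [set: g_sigma_algebraType (increment_rect V t p r)]
    (fun w => `|f w|) by exact: measurableT_comp.
  by apply: (mn measurableT); exact: measurable_itv.
(* [E j]: the path has exceeded [2 * e] by step [j]; [S]: it is back at the end *)
pose E j := [set w | exists2 i, (i <= j)%N & 2 * e < `|X w (x i)|].
pose S := [set w | `|X w h| <= e].
have mX i : measurable_fun setT (fun w => X w (x i)) by exact: measurable_X.
have mS : measurable S.
  rewrite (_ : S = ~` [set w | e < `|X w h|]).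
    by apply: measurableC; apply: measurable_exceeds; rewrite -xM.
  apply/seteqP; split => w /=; first by move=> H; apply/negP; rewrite -leNgt.
  by move=> /negP; rewrite -leNgt.
have EE j : E j = \bigcup_(i in [set i | (i <= j)%N]) [set w | 2 * e < `|X w (x i)|].
  by apply/seteqP; split => w /= [i ij H]; exists i.
have mE j : measurable (E j).
  by rewrite EE; apply: bigcup_measurable => i _; apply: measurable_exceeds.
have sE j r : (j <= r)%N -> <<s increment_rect V t 0 r >> (E j).
  move=> jr; rewrite EE.
  apply: (@bigcup_measurable _ (g_sigma_algebraType (increment_rect V t 0 r))) => i /= ij.
  by apply: sigma_exceeds; apply: path_sigma0; exact: leq_trans jr.
have step j : (j <= M)%N -> (P (E j `&` S) <= q%:E * P (E j))%E.
  pose A j := [set w | 2 * e < `|X w (x j)|].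
  have mA i : measurable (A i) by exact: measurable_exceeds.
  (* used when [D] is the event that the level is first exceeded at step [k] *)
  have first_exit k (D : set T) : (k <= M)%N -> D `<=` A k ->
      <<s increment_rect V t 0 k >> D -> (P (D `&` S) <= q%:E * P D)%E.
    move=> kM DA sD.
    pose B := [set w | e < `|X w (x M) - X w (x k)|].
    have sB : <<s increment_rect V t k M >> B.
      by apply: sigma_exceeds; apply: path_sigma; rewrite kM leqnn.
    have mD := increment_sigma_measurable t0 tm sD.
    have mB := increment_sigma_measurable t0 tm sB.
    apply: (@le_trans _ _ (P (D `&` B))).
      apply: le_measure; rewrite ?inE//; try exact: measurableI.
      move=> w [Dw Sw]; split => //; rewrite /B /= xM.
      have := DA _ Dw; rewrite /A /= => Aw; rewrite /S /= in Sw.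
      have := ler_normD (X w h) (X w (x k) - X w h); rewrite addrC subrK.
      by rewrite (distrC (X w (x k))); lra.
    rewrite (increment_sigma_indep t0 tm kM sD sB) muleC.
    apply: lee_wpmul2r => //; rewrite /B prob_exceeds_diff.
    - apply: Pq; have /andP[? ?] := xI k; have := xm _ _ kM; rewrite xM => ?.
      by apply/andP; split; lra.
    - by case/andP: (xI1 k).
    - exact: xm.
    - by case/andP: (xI1 M).
  elim: j => [|j IH] jM.
    apply: (first_exit 0%N) => //; last exact: sE.
    by move=> w [i]; rewrite leqn0 => /eqP ->.
  have EU : E j.+1 = E j `|` (A j.+1 `\` E j).
    apply/seteqP; split => w /=.
      move=> [i]; rewrite leq_eqVlt => /predU1P[->|ij] H.
        by have [Ew|Ew] := pselect (E j w); [left|right].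
      by left; exists i.
    move=> [[i ij H]|[H _]]; last by exists j.+1.
    by exists i => //; exact: leqW.
  have disj : E j `&` (A j.+1 `\` E j) = set0.
    by apply/seteqP; split => // w [? [_ ?]].
  have mAE : measurable (A j.+1 `\` E j) by exact: measurableD.
  have sAE : <<s increment_rect V t 0 j.+1 >> (A j.+1 `\` E j).
    apply: (@measurableD _ (g_sigma_algebraType (increment_rect V t 0 j.+1))).
      by apply: sigma_exceeds; exact: path_sigma0.
    exact: sE.
  rewrite EU setIUl measureU; [|exact: measurableI|exact: measurableI|]; last first.
    by rewrite setIACA setIid disj set0I.
  rewrite [in leRHS]measureU// muleDr ?ge0_adde_def ?inE//.
  by apply: leeD; [exact: IH (ltnW jM)|apply: (first_exit j.+1) => // w []].
have -> : [set w | exists2 i, (i <= M)%N & 2 * e < `|X w (h * (i%:R / M%:R))|] = E M.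
  by apply/seteqP; split => w /= [i iM H]; exists i => //; move: H; rewrite xE.
have -> : E M = (E M `&` S) `|` (E M `\` S) by rewrite setUIDK.
rewrite measureU; [|exact: measurableI|exact: measurableD|]; last first.
  by apply/seteqP; split => // w [[_ ?] []].
rewrite mulr_natl mulr2n EFinD; apply: leeD.
  apply: le_trans (step M (leqnn M)) _; rewrite -[leRHS]mule1.
  by apply: lee_wpmul2l; rewrite ?lee_fin// probability_le1.
apply: le_trans (Pq h _); last by rewrite h_ge0 lexx.
apply: le_measure; rewrite ?inE; first exact: measurableD.
  by apply: measurable_exceeds; rewrite -xM.
by move=> w [_]; rewrite /S /= => /negP; rewrite -ltNge.
Qed.

(** By right-continuity, a path that exceeds [2 * e] somewhere does so on all
    sufficiently fine grids; this liminf of the grid events is the set [E]. *)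
Lemma prob_sup_exceeds_le e h (q : R) : 0 <= e -> 0 <= h <= 1 ->
  (forall x, 0 <= x <= h -> (P [set w | (e < `|X w x|)%R] <= q%:E)%E) ->
  exists E, [/\ measurable E, (P E <= (2 * q)%:E)%E &
    forall w, ~ E w -> forall x, 0 <= x <= 1 -> x <= h -> `|X w x| <= 2 * e].
Proof.
move=> e0 hI Pq; have /andP[h0 h1] := hI.
pose G M := [set w | exists2 i, (i <= M.+1)%N & 2 * e < `|X w (h * (i%:R / M.+1%:R))|].
have mG M : measurable (G M).
  rewrite (_ : G M = \bigcup_(i in [set i | (i <= M.+1)%N])
      [set w | 2 * e < `|X w (h * (i%:R / M.+1%:R))|]).
    apply: bigcup_measurable => i /= iM; apply/measurable_exceeds/measurable_X.
    rewrite mulr_ge0 ?divr_ge0//=; apply: le_trans h1.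
    by rewrite ler_piMr// ler_pdivrMr ?ltr0n// mul1r ler_nat.
  by apply/seteqP; split => w /= [i ij H]; exists i.
have PG M : (P (G M) <= (2 * q)%:E)%E by exact: prob_grid_exceeds_le.
pose I N := \bigcap_(M in [set M | (N <= M)%N]) G M.
have mI N : measurable (I N).
  by apply: bigcap_measurable => [|M _]; [exists N => /=|].
have mU : measurable (\bigcup_N I N) by exact: bigcupT_measurable.
exists (\bigcup_N I N); split => //.
  have nd : nondecreasing_seq I.
    move=> n m nm; apply/subsetPset => w Iw M /= mM; apply: Iw.
    exact: leq_trans mM.
  have cv : P (I N) @[N --> \oo] --> P (\bigcup_N I N) by exact: nondecreasing_cvg_mu.
  rewrite -(cvg_lim _ cv)//; apply: lime_le.
    by apply/cvg_ex; exists (P (\bigcup_N I N)); exact: cv.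
  apply: nearW => N; apply: le_trans (PG N).
  by apply: le_measure; rewrite ?inE// => w; apply => /=.
move=> w nE x xI xh; have /andP[x0 x1] := xI; rewrite leNgt; apply/negP => Xx.
have x_gt0 : 0 < x.
  rewrite lt_neqAle x0 andbT; apply/eqP => x_eq; move: Xx.
  by rewrite -x_eq X0 normr0 ltNge mulr_ge0.
have h_gt0 : 0 < h by exact: lt_le_trans xh.
apply: nE; move: xh; rewrite le_eqVlt => /predU1P[xh|xh].
  exists 0%N => // M _; exists M.+1 => //.
  by rewrite divff ?mulr1 -?xh// pnatr_eq0.
have [/cvg_within_rightP Xr _] := @skorohod_cadlag _ (X w) x xI.
have [dl dl0 {}Xr] := Xr (`|X w x| - 2 * e) ltac:(lra).
exists (Num.truncn (h / dl)) => // M /= M_ge.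
have MR : 0 < M.+1%:R :> R by rewrite ltr0n.
have hM : h / M.+1%:R < dl.
  rewrite ltr_pdivrMr// mulrC -ltr_pdivrMr//.
  by apply: lt_le_trans (truncnS_gt _) _; rewrite ler_nat ltnS.
pose k := Num.truncn (x / h * M.+1%:R).
have /andP[k1 k2] : k%:R <= x / h * M.+1%:R < k.+1%:R.
  by apply: truncn_itv; rewrite mulr_ge0// divr_ge0.
have kM : (k < M.+1)%N.
  rewrite -(ltr_nat R); apply: le_lt_trans k1 _.
  by rewrite -[ltRHS]mul1r ltr_pM2r// ltr_pdivrMr// mul1r.
have y1 : x < h * (k.+1%:R / M.+1%:R).
  rewrite mulrA ltr_pdivlMr// [h * _]mulrC -ltr_pdivrMr//.
  by rewrite mulrAC.
have y2 : h * (k.+1%:R / M.+1%:R) <= x + h / M.+1%:R.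
  rewrite -natr1 mulrDl mul1r mulrDr lerD2r.
  by rewrite mulrA ler_pdivrMr// [h * _]mulrC -ler_pdivlMr// mulrAC.
exists k.+1 => //.
set y := h * _ in y1 y2 *.
have yI : 0 <= y <= 1.
  rewrite (le_trans x0 (ltW y1)) /=; apply: le_trans h1.
  by rewrite ler_piMr ?(ltW h_gt0)// ler_pdivrMr// mul1r ler_nat.
have := Xr y yI y1 (le_lt_trans y2 _); rewrite ltrD2l => /(_ hM).
have := ler_normD (X w x - X w y) (X w y).
by rewrite subrK (distrC (X w x)) => ? ?; lra.
Qed.

End initial_tail.

(** * Uniformity of the initial tail along the sequence *)

Section uniform_initial_tail.
Context {R : realType} {d : measure_display} {T : measurableType d}.
Context {d' : measure_display} {T' : measurableType d'}.
Variables (P : probability T R) (P' : probability T' R).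
Variables (V : levy_process P) (Y : levy_process P').
Variables (a b : nat -> R) (s : nat -> {posnum R}).
Let X n := levy_rescale V (s n) (a n) (b n).
Hypothesis X_cvg : cvg_in_distribution P P' X (levy_restrict Y).

Lemma levy_restrictE w t : 0 <= t <= 1 -> levy_restrict Y w t = Y w t.
Proof. by move=> tI; rewrite /= patchE mem_set//= in_itv. Qed.

Lemma measurable_levy_restrict t : 0 <= t <= 1 ->
  measurable_fun setT (fun w => levy_restrict Y w t).
Proof.
move=> tI; under eq_fun do rewrite levy_restrictE//.
by apply: levy_measurable; case/andP: tI.
Qed.

Lemma cvg_expect_rescale F : continuous F -> (exists M, forall x, `|F x| <= M) ->
  \int[P]_w F (X n w) @[n --> \oo] --> \int[P']_w F (levy_restrict Y w).
Proof.
move=> cF [M FM]; have := X_cvg cF (ex_intro _ M FM).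
rewrite (integral_law _ measurable_levy_restrict cF FM).
have -> : (fun n => \int[pushforward P (X n)]_x (F x)%:E)%E =
    (fun n => (\int[P]_w F (X n w))%:E).
  apply/funext => n; apply: (integral_law _ _ cF FM) => t.
  exact: measurable_levy_rescale.
by move=> /fine_cvg.
Qed.

(** The limit starts at 0 and is right-continuous, hence is small on a short
    initial interval with probability close to 1; the continuous functional
    [initial_oscillation] transfers this to [X n] for large [n]. *)
Lemma uniform_initial_window e : 0 < e -> exists2 h0, 0 < h0 <= 1 &
  \forall n \near \oo, exists A, [/\ measurable A, (P A <= 2^-1%:E)%E &
    forall w, ~ A w -> forall t, 0 <= t <= 1 -> t <= h0 -> `|X n w t| <= 2 * e].
Proof.
move=> e0.
pose F m := initial_oscillation m.+1%:R^-1 e : skorohod R -> R.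
have cF m : continuous (F m) by exact: initial_oscillation_continuous.
have FN m x : `|F m x| <= 1.
  by rewrite ger0_norm ?initial_oscillation_ge0// initial_oscillation_le1.
have : \int[P']_w F m (levy_restrict Y w) @[m --> \oo] --> \int[P']_w (0 : R).
  apply: (@expect_cvg _ _ _ _ _ _ 1) => //.
    by move=> m; exact: measurable_continuous_comp measurable_levy_restrict _ (cF m).
  move=> w; apply: cvg_near_cst.
  have Y0 : levy_restrict Y w 0 = 0 by rewrite levy_restrictE ?lexx ?ler01// levy0.
  apply: filterS (initially_small_cvg Y0 e0) => m /= small.
  exact: initial_oscillation_eq0.
rewrite expect_cst => /cvgr_lt/(_ 2^-1 ltac:(lra))[m _ /(_ m (leqnn m)) /= Fm].
exists m.+1%:R^-1.
  by rewrite invr_gt0 ltr0n invf_le1 ?ltr0n// ler1n.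
have := cvg_expect_rescale (cF m) (ex_intro _ 1 (FN m)).
move=> /cvgr_lt/(_ _ Fm); apply: filterS => n lt_half.
have mFX : measurable_fun setT (fun w => F m (X n w)).
  by apply: measurable_continuous_comp (cF m) => t; exact: measurable_levy_rescale.
pose A := [set w | 1 <= F m (X n w)].
have mA : measurable A.
  rewrite (_ : A = (fun w => F m (X n w)) @^-1` `[1, +oo[%classic).
    by rewrite -[X in measurable X]setTI; exact: mFX.
  by apply/seteqP; split => w /=; rewrite in_itv /= andbT.
exists A; split => //.
  rewrite -[P A]fineK ?fin_num_measure// lee_fin -expect_indic//.
  apply: le_trans (ltW lt_half); apply: le_expect.
  - exact: bounded_rv_indic.
  - by apply: bounded_rvP => // w; exact: FN.
  - move=> w; rewrite indicE; case: (boolP (w \in A)); first by rewrite inE.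
    by move=> _; exact: initial_oscillation_ge0.
move=> w; rewrite /A /= => /negP; rewrite -ltNge => lt1.
exact: initial_oscillation_lt1 lt1.
Qed.

(** The tail bounds depend on [n] only through the window [h0], which is common
    to all large [n].  For [h] beyond the window the bound is trivial. *)
Lemma uniform_initial_tail e : 0 < e -> exists2 C, 0 < C &
  \forall n \near \oo, forall h, 0 <= h <= 1 ->
  exists E, [/\ measurable E, (P E <= (C * h)%:E)%E &
    forall w, ~ E w -> forall t, 0 <= t <= 1 -> t <= h -> `|X n w t| <= e].
Proof.
move=> e0; have [h0 /andP[h0_gt0 h01] win] :=
  uniform_initial_window (ltac:(lra) : 0 < e / 8).
exists (4 / h0); first by rewrite divr_gt0.
apply: filterS win => n [A [mA PA AX]] h hI; have /andP[h_ge0 h1] := hI.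
have [hh0|h0h] := leP h h0; last first.
  exists setT; split => // [|w /(_ I)//].
  rewrite probability_setT lee_fin mulrAC ler_pdivlMr// mul1r; lra.
have [|E [mE PE EX]] := @prob_sup_exceeds_le R d T P V (s n) (a n) (b n) (e / 2) h
    (2 * h / h0) ltac:(lra) hI.
- move=> x /andP[x0 xh]; move: x0; rewrite le_eqVlt => /predU1P[x0|x0].
    rewrite (_ : [set _ | _] = set0) ?measure0 ?lee_fin ?divr_ge0 ?mulr_ge0 ?(ltW h0_gt0)//.
    apply/seteqP; split => // w; rewrite /mkset -x0 levy_rescaleE ?lexx ?ler01//.
    by rewrite mulr0 levy0 !mul0r subr0 normr0; lra.
  apply: (@le_trans _ _ (2 * x / h0)%:E).
    apply: (prob_exceeds_le (A := A)) => //; first exact: le_trans hh0.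
    move=> w nA t tI th; apply: le_trans (AX w nA t tI th) _; lra.
  by rewrite lee_fin ler_pM2r ?invr_gt0// ler_pM2l.
exists E; split => //.
  apply: le_trans PE _; rewrite lee_fin le_eqVlt; apply/orP; left; apply/eqP.
  by field; rewrite gt_eqF.
by move=> w nE t tI th; apply: le_trans (EX w nE t tI th) _; lra.
Qed.

End uniform_initial_tail.

(** * Second moments when dependence is confined to windows *)

Section cut_index.
Context {R : realType}.
Local Notation H := (@hsum R).

(** The two bounds pull in opposite directions: windows must weigh little
    compared with [H] for the second moment to be small, and indices below the
    window must be so far from [l] that the paths of index [l] spend a
    negligible fraction of their time there.  The square root serves both. *)
Lemma cut_index_ex : exists phi : nat -> nat, forall l,
  [/\ (phi l <= l)%N, H l.+1 - H (phi l) <= Num.sqrt (H l.+1) + 1 &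
      forall k, (k < phi l)%N -> Num.sqrt (H l.+1) <= H l.+1 - H k.+1].
Proof.
suff E l : exists p : nat,
    [/\ (p <= l)%N, H l.+1 - H p <= Num.sqrt (H l.+1) + 1 &
      forall k, (k < p)%N -> Num.sqrt (H l.+1) <= H l.+1 - H k.+1].
  by have [phi phiP] := choice E; exists phi.
have ex : exists k, H l.+1 - H k.+1 < Num.sqrt (H l.+1).
  by exists l; rewrite subrr sqrtr_gt0 hsum_gt0.
case: (ex_minnP ex) => p pP p_min; exists p; split.
- by apply: p_min; rewrite subrr sqrtr_gt0 hsum_gt0.
- by move: pP; rewrite (hsumS p); have := @weight_le1 R p; lra.
- move=> k kp; rewrite leNgt; apply/negP => /p_min; by rewrite leqNgt kp.
Qed.

(** As [weight l] is the increment of [H] at [l], the sum is dominated by the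
    telescoping sum of the decrements of [1 / H]. *)
Lemma sum_weight_div_sqr_le n : \sum_(l < n) weight l / H l.+1 ^+ 2 <= 2.
Proof.
case: n => [|n]; first by rewrite big_ord0.
suff : \sum_(l < n.+1) weight l / H l.+1 ^+ 2 <= 2 - (H n.+1)^-1.
  by move=> /le_trans; apply; rewrite gerBl invr_ge0 hsum_ge0.
elim: n => [|n IH].
  by rewrite big_ord_recr big_ord0 /= hsum1 expr1n /weight !invr1; lra.
rewrite big_ord_recr; apply: le_trans (lerD IH (_ : _ <= (H n.+1)^-1 - (H n.+2)^-1)) _.
  have h1 : 0 < H n.+1 by exact: hsum_gt0.
  have h2 : 0 < H n.+2 by exact: hsum_gt0.
  have h12 : H n.+1 <= H n.+2 by exact: hsum_le.
  have -> : (H n.+1)^-1 - (H n.+2)^-1 = weight n.+1 / (H n.+1 * H n.+2).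
    have -> : weight n.+1 = H n.+2 - H n.+1 :> R by rewrite (hsumS n.+1) addrC addKr.
    by field; rewrite !gt_eqF.
  apply: ler_wpM2l; first exact/ltW/weight_gt0.
  by rewrite lef_pV2 ?posrE ?exprn_gt0 ?mulr_gt0// expr2 ler_pM2r.
by rewrite addrA subrK.
Qed.

Context {d : measure_display} {T : measurableType d} (P : probability T R).

(** Only pairs of indices in the same window contribute to the second moment,
    and the window ending at [l] has total weight of order [sqrt (hsum l)]. *)
Lemma windowed_second_moment (u : nat -> T -> R) C (phi : nat -> nat) :
  (forall k, measurable_fun setT (u k)) -> (forall k w, `|u k w| <= C) ->
  (forall l, (phi l <= l)%N) ->
  (forall l, H l.+1 - H (phi l) <= Num.sqrt (H l.+1) + 1) ->
  (forall k l, (k < phi l)%N -> \int[P]_w (u k w * u l w) = 0) ->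
  forall n, \int[P]_w (\sum_(k < n) weight k * u k w) ^+ 2 <=
    3 * C ^+ 2 * (H n * (1 + Num.sqrt (H n))).
Proof.
move=> mu uC phi_le window uncorr N.
have C0 : 0 <= C by exact: le_trans (normr_ge0 _) (uC 0%N point).
have bu k : bounded_rv (u k) by apply: bounded_rvP (uC k).
pose S n w := \sum_(k < n) weight k * u k w.
have bS n : bounded_rv (S n).
  by apply: (bounded_rv_sum n (f := fun k w => weight k * u k w)) => k;
    exact: bounded_rvZ.
have b2 (f : T -> R) : bounded_rv f -> bounded_rv (fun w => f w ^+ 2).
  by move=> bf; under eq_fun do rewrite expr2; exact: bounded_rvM.
have cross n : \int[P]_w (S n w * u n w) <= C ^+ 2 * (Num.sqrt (H n.+1) + 1).
  rewrite /S; under eq_Rintegral do rewrite mulr_suml.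
  rewrite (expect_sum P n (f := fun k w => weight k * u k w * u n w)); last first.
    by move=> k; apply: bounded_rvM => //; exact: bounded_rvZ.
  apply: (@le_trans _ _ (\sum_(phi n <= k < n) C ^+ 2 * weight k)).
    rewrite -(big_mkord xpredT (fun k => \int[P]_w (weight k * u k w * u n w))).
    rewrite (big_cat_nat (n := phi n))//= big_nat big1 ?add0r; last first.
      move=> k /andP[_ kphi]; under eq_Rintegral do rewrite -mulrA.
      rewrite expectZ; last exact: bounded_rvM.
      by rewrite uncorr// mulr0.
    apply: ler_sum => k _; under eq_Rintegral do rewrite -mulrA.
    rewrite expectZ; last exact: bounded_rvM.
    rewrite mulrC; apply: ler_wpM2r; first exact/ltW/weight_gt0.
    apply: le_trans (ler_norm _) _; apply: expect_norm_le; first exact: bounded_rvM.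
    by move=> w; rewrite normrM expr2 ler_pM.
  rewrite -mulr_sumr; apply: ler_wpM2l; first exact: sqr_ge0.
  apply: le_trans (window n); rewrite hsumS.
  have -> : \sum_(phi n <= k < n) weight k = H n - H (phi n).
    rewrite /hsum -!(big_mkord xpredT (@weight R)).
    by rewrite (@big_cat_nat _ _ _ (phi n) 0 n)//= [RHS]addrC addKr.
  by have := @weight_gt0 R n; lra.
suff H_step : forall n, (n <= N)%N ->
    \int[P]_w (S n w) ^+ 2 <= C ^+ 2 * (2 * Num.sqrt (H N) + 3) * H n.
  apply: le_trans (H_step N (leqnn N)) _.
  have := sqr_ge0 C; have := sqrtr_ge0 (H N); have := @hsum_ge0 R N.
  move: (H N) (Num.sqrt (H N)) (C ^+ 2) => h r c h0 r0 c0.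
  rewrite (_ : 3 * c * _ = c * (2 * r + 3) * h + c * (r * h)); last by ring.
  by rewrite lerDl !mulr_ge0.
elim=> [|n IH] nN.
  rewrite hsum0 mulr0 /S; under eq_Rintegral do rewrite big_ord0 expr0n.
  by rewrite expect_cst.
have wn := @weight_gt0 R n.
have -> : \int[P]_w (S n.+1 w) ^+ 2 = \int[P]_w (S n w) ^+ 2 +
    (2 * weight n * \int[P]_w (S n w * u n w) + weight n ^+ 2 * \int[P]_w (u n w) ^+ 2).
  rewrite -!expectZ//; [|exact: b2|exact: bounded_rvM].
  rewrite -!expectD//.
  - apply: eq_Rintegral => w _; rewrite /S big_ord_recr /=; ring.
  - exact: b2.
  - by apply: bounded_rvD; apply: bounded_rvZ; [exact: bounded_rvM|exact: b2].
  - by apply: bounded_rvZ; exact: bounded_rvM.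
  - by apply: bounded_rvZ; exact: b2.
have sqrt_le : Num.sqrt (H n.+1) <= Num.sqrt (H N) by apply/ler_wsqrtr/hsum_le.
have diag : weight n ^+ 2 * \int[P]_w (u n w) ^+ 2 <= weight n * C ^+ 2.
  rewrite expr2 -mulrA; apply: ler_wpM2l; first exact: ltW.
  apply: (@le_trans _ _ (1 * C ^+ 2)); last by rewrite mul1r.
  apply: ler_pM; rewrite ?(ltW wn) ?weight_le1//.
    by apply: Rintegral_ge0 => w _; exact: sqr_ge0.
  apply: le_trans (ler_norm _) _; apply: expect_norm_le; first exact: b2.
  by move=> w; rewrite normrX ler_pXn2r ?nnegrE.
rewrite hsumS mulrDr; apply: lerD; first exact: IH (ltnW nN).
have -> : C ^+ 2 * (2 * Num.sqrt (H N) + 3) * weight n =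
    2 * weight n * (C ^+ 2 * (Num.sqrt (H N) + 1)) + weight n * C ^+ 2 by ring.
apply: lerD => //; apply: ler_wpM2l; first by rewrite mulr_ge0// ltW.
apply: le_trans (cross n) _; apply: ler_wpM2l; first exact: sqr_ge0.
by rewrite lerD2r.
Qed.

(** The square of the weighted sum of the indicators is at most [H n] times the
    sum, whose expectation is bounded; so the second moment is of order [H n]
    even if the events are dependent. *)
Lemma havg_indic_ae (E : nat -> set T) K : (forall l, measurable (E l)) ->
  (forall l, fine (P (E l)) <= K / H l.+1 ^+ 2) ->
  {ae P, forall w, havg (fun l => \1_(E l) w) n @[n --> \oo] --> (0 : R)}.
Proof.
move=> mE PE; have bE l := @bounded_rv_indic R _ _ _ (mE l).
have I01 l w : 0 <= (\1_(E l) w : R) <= 1.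
  by rewrite indicE; case: (_ \in _); rewrite ?lexx ?ler01.
have K0 : 0 <= K.
  have := PE 0%N; rewrite hsum1 expr1n divr1; apply: le_trans.
  by rewrite fine_ge0.
apply: (@havg_strong_law _ _ _ _ (fun l => \1_(E l)) 1 (2 * K)).
- by move=> l; exact: (bE l).1.
- by move=> l w; have /andP[? ?] := I01 l w; rewrite ger0_norm.
move=> n n0; pose U w := \sum_(k < n) weight k * \1_(E k) w : R.
have bU : bounded_rv U.
  by apply: (bounded_rv_sum n (f := fun k w => weight k * \1_(E k) w)) => k;
    exact: bounded_rvZ.
have U0 w : 0 <= U w.
  apply: sumr_ge0 => k _; apply: mulr_ge0; first exact/ltW/weight_gt0.
  by case/andP: (I01 k w).
have UH w : U w <= H n.
  apply: ler_sum => k _; have /andP[_ I1] := I01 k w.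
  by apply: ler_piMr => //; exact/ltW/weight_gt0.
apply: (@le_trans _ _ (H n * \int[P]_w U w)).
  rewrite -expectZ//; apply: le_expect.
  - by under eq_fun do rewrite expr2; exact: bounded_rvM.
  - exact: bounded_rvZ.
  - by move=> w; rewrite -/(U w) expr2; apply: ler_wpM2r; [exact: U0|exact: UH].
have EU : \int[P]_w U w <= 2 * K.
  rewrite (expect_sum P n (f := fun k w => weight k * \1_(E k) w)); last first.
    by move=> k; exact: bounded_rvZ.
  apply: (@le_trans _ _ (\sum_(k < n) K * (weight k / H k.+1 ^+ 2))).
    apply: ler_sum => k _; rewrite expectZ// expect_indic// mulrCA.
    apply: ler_wpM2l; first exact/ltW/weight_gt0.
    exact: PE.
  by rewrite -mulr_sumr mulrC ler_wpM2r// sum_weight_div_sqr_le.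
rewrite mulrCA; apply: ler_wpM2l; first exact: hsum_ge0.
apply: le_trans EU _; rewrite ler_peMr ?mulr_ge0// lerDl.
exact: sqrtr_ge0.
Qed.

End cut_index.

(** * The almost sure limit *)

Section almost_sure_limit.
Context {R : realType} {d : measure_display} {T : measurableType d}.
Context {d' : measure_display} {T' : measurableType d'}.
Variables (P : probability T R) (P' : probability T' R).
Variables (V : levy_process P) (Y : levy_process P').
Variables (a b : nat -> R) (s : nat -> {posnum R}) (beta : R).
Hypothesis beta0 : 0 < beta.
Hypothesis s_growth : forall m n : nat, (0 < m)%N -> (m <= n)%N ->
  (s m)%:num / m%:R `^ beta <= (s n)%:num / n%:R `^ beta.
Hypothesis X_cvg : cvg_in_distribution P P'
  (fun n => levy_rescale V (s n) (a n) (b n)) (levy_restrict Y).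

Local Notation H := (@hsum R).
(* indices are shifted by 1, like the weights *)
Let sigma k : R := (s k.+1)%:num.
Let X k := levy_rescale V (s k.+1) (a k.+1) (b k.+1).

Let sigma_gt0 k : 0 < sigma k. Proof. by rewrite /sigma. Qed.

(** The growth hypothesis read on the harmonic scale. *)
Let sigma_ratio k l : (k <= l)%N ->
  sigma k / sigma l <= expR (- beta * (H l.+1 - H k.+1)).
Proof.
move=> kl; have kl1 : 0 < (k.+1%:R / l.+1%:R : R) by rewrite divr_gt0.
have pk : 0 < (k.+1%:R `^ beta : R) by rewrite powR_gt0.
have pl : 0 < (l.+1%:R `^ beta : R) by rewrite powR_gt0.
apply: (@le_trans _ _ (k.+1%:R `^ beta / l.+1%:R `^ beta)).
  rewrite ler_pdivrMr ?sigma_gt0// mulrAC ler_pdivlMr//.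
  have := s_growth (ltn0Sn k) (kl : (k.+1 <= l.+1)%N).
  by rewrite ler_pdivrMr// mulrAC ler_pdivlMr// [k.+1%:R `^ _ * _]mulrC.
have lnk : ln (l.+1%:R / k.+1%:R) = ln l.+1%:R - ln k.+1%:R :> R.
  by rewrite lnM ?posrE ?invr_gt0// lnV ?posrE.
rewrite /powR !pnatr_eq0 /= -expRN -expRD ler_expR.
rewrite -mulrBr mulNr -mulrN ler_pM2l//.
have := @hsum_diff_le_ln R k l kl; rewrite lnk; lra.
Qed.

Let sigma_le k l : (k <= l)%N -> sigma k <= sigma l.
Proof.
move=> kl; rewrite -[leRHS]mul1r -ler_pdivrMr ?sigma_gt0//.
apply: le_trans (sigma_ratio kl) _; rewrite -expR0 ler_expR.
by rewrite mulNr oppr_le0 mulr_ge0 ?(ltW beta0)// subr_ge0 hsum_le.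
Qed.

Section window.
Variable phi : nat -> nat.
Hypothesis phiP : forall l,
  [/\ (phi l <= l)%N, H l.+1 - H (phi l) <= Num.sqrt (H l.+1) + 1 &
      forall k, (k < phi l)%N -> Num.sqrt (H l.+1) <= H l.+1 - H k.+1].

(* the last time at which [V] is read by the paths of index below [phi l] *)
Let cut l : R := if phi l is p.+1 then sigma p else 0.

Let cut_ge0 l : 0 <= cut l.
Proof. by rewrite /cut; case: (phi l) => // p; exact/ltW/sigma_gt0. Qed.

Let cut_le l : cut l <= sigma l.
Proof.
rewrite /cut; have [+ _ _] := phiP l; case: (phi l) => [_|p pl].
  exact/ltW/sigma_gt0.
exact/sigma_le/ltnW.
Qed.

Let le_cut k l : (k < phi l)%N -> sigma k <= cut l.
Proof. by rewrite /cut; case: phi => // p kp; exact: sigma_le. Qed.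

Let cut_frac l : 0 <= cut l / sigma l <= 1.
Proof.
have sl := sigma_gt0 l.
by rewrite divr_ge0 ?cut_ge0 ?(ltW sl)//= ler_pdivrMr// mul1r cut_le.
Qed.

(** A gap of [sqrt (H l.+1)] on the harmonic scale gives
    [exp (- beta * sqrt (H l.+1))], and [exp y >= y ^ 4 / 24]. *)
Let cut_small l : cut l / sigma l <= 24 / beta ^+ 4 / H l.+1 ^+ 2.
Proof.
have h0 : 0 < H l.+1 by exact: hsum_gt0.
have rhs0 : 0 <= 24 / beta ^+ 4 / H l.+1 ^+ 2.
  by rewrite !divr_ge0 ?exprn_ge0 ?(ltW beta0) ?(ltW h0).
rewrite /cut; have [pl _ gap] := phiP l.
case p_eq : (phi l) pl => [|p] pl; first by rewrite mul0r.
apply: le_trans (sigma_ratio (ltnW pl)) _.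
have gap_p := gap p ltac:(by rewrite p_eq).
pose y := beta * Num.sqrt (H l.+1).
have y0 : 0 < y by rewrite mulr_gt0// sqrtr_gt0.
apply: (@le_trans _ _ (expR (- y))).
  by rewrite ler_expR mulNr lerN2 ler_pM2l.
have y4 : y ^+ 4 / 24 <= expR y.
  have := @expR_ge1Dxn R y 3 (ltW y0); rewrite (_ : 4`!%:R = 24 :> R)//; lra.
rewrite expRN; have -> : 24 / beta ^+ 4 / H l.+1 ^+ 2 = (y ^+ 4 / 24)^-1.
  have -> : y ^+ 4 = beta ^+ 4 * H l.+1 ^+ 2.
    rewrite exprMn; congr (_ * _).
    by rewrite (_ : 4 = 2 * 2)%N// exprM sqr_sqrtr// ltW.
  by field; rewrite !gt_eqF.
by rewrite lef_pV2 ?posrE ?expR_gt0 ?divr_gt0 ?exprn_gt0.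
Qed.

Let X' l w := path_after (cut l / sigma l) (X l w).

Let measurable_X l t : 0 <= t <= 1 -> measurable_fun setT (fun w => X l w t).
Proof. exact: measurable_levy_rescale. Qed.

Let measurable_X' l t : 0 <= t <= 1 -> measurable_fun setT (fun w => X' l w t).
Proof.
move=> tI; apply: measurable_path_after => //; last exact: measurable_X.
by case/andP: (cut_frac l).
Qed.

(** Removing the beginning of the path matters only if the path is large there,
    and the beginning is short enough for the uniform tail bound to be
    summable.  The finitely many indices to which that bound does not apply are
    given the whole space, which is paid for by the constant [K]. *)
Let exceptional_events e : 0 < e -> exists E : nat -> set T, exists2 K,
  0 <= K & forall l, [/\ measurable (E l), fine (P (E l)) <= K / H l.+1 ^+ 2 &
    forall w, ~ E l w -> mdist (X l w) (X' l w) <= e].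
Proof.
move=> e0; have [C C0 [L _ tail]] := uniform_initial_tail X_cvg e0.
pose K := C * (24 / beta ^+ 4) + H L.+1 ^+ 2.
have K1 : 0 <= C * (24 / beta ^+ 4).
  by rewrite mulr_ge0 ?(ltW C0)// divr_ge0 ?exprn_ge0 ?(ltW beta0).
have K2 : 0 <= H L.+1 ^+ 2 by exact: sqr_ge0.
suff /choice[E EP] : forall l, exists El : set T,
    [/\ measurable El, fine (P El) <= K / H l.+1 ^+ 2 &
      forall w, ~ El w -> mdist (X l w) (X' l w) <= e].
  by exists E, K => //; exact: addr_ge0.
move=> l; have h0 : 0 < H l.+1 by exact: hsum_gt0.
have [lL|Ll] := ltnP l L.
  exists setT; split => // [|w /(_ I)//].
  rewrite probability_setT ler_pdivlMr ?exprn_gt0// mul1r.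
  apply: (@le_trans _ _ (H L.+1 ^+ 2)); last by rewrite lerDr.
  by rewrite ler_pXn2r ?nnegrE ?hsum_ge0// hsum_le// ltnS ltnW.
have [E [mE PE EX]] := tail l.+1 (leqW Ll) _ (cut_frac l).
exists E; split => //.
  rewrite -lee_fin fineK ?fin_num_measure//; apply: le_trans PE _.
  rewrite lee_fin; apply: (@le_trans _ _ (C * (24 / beta ^+ 4 / H l.+1 ^+ 2))).
    by rewrite ler_pM2l.
  rewrite mulrA; apply: ler_wpM2r; last by rewrite lerDl.
  by rewrite invr_ge0 sqr_ge0.
move=> w nE; apply: dist_path_after; first by case/andP: (cut_frac l).
exact: EX.
Qed.

(** For [k < phi l] the trimmed paths are independent, so that the centered
    variables are uncorrelated. *)
Lemma havg_centered_ae (F : skorohod R -> R) C : continuous F ->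
  (forall x, 0 <= F x <= C) ->
  {ae P, forall w, havg (fun l => F (X' l w) - \int[P]_w F (X' l w)) n
    @[n --> \oo] --> (0 : R)}.
Proof.
move=> cF FC.
have FN x : `|F x| <= C by have /andP[? ?] := FC x; rewrite ger0_norm.
have mF l : measurable_fun setT (fun w => F (X' l w)).
  by apply: measurable_continuous_comp => //; exact: measurable_X'.
have bF l : bounded_rv (fun w => F (X' l w)) by apply: bounded_rvP => // w; exact: FN.
pose m l := \int[P]_w F (X' l w).
have m0C l : 0 <= m l <= C.
  have := expect_norm_le P (bF l) (fun w => FN (X' l w)).
  have mge : 0 <= m l by apply: Rintegral_ge0 => w _; case/andP: (FC (X' l w)).
  by rewrite ger0_norm// mge => ->.
apply: (@havg_strong_law _ _ _ _ (fun l w => F (X' l w) - m l) C (3 * C ^+ 2)).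
- by move=> l; exact: measurable_funB.
- move=> l w; have /andP[? ?] := FC (X' l w); have /andP[? ?] := m0C l.
  by rewrite ler_norml; apply/andP; split; lra.
move=> n _; apply: (windowed_second_moment (u := fun l w => F (X' l w) - m l) (phi := phi)).
- by move=> l; exact: measurable_funB.
- move=> l w; have /andP[? ?] := FC (X' l w); have /andP[? ?] := m0C l.
  by rewrite ler_norml; apply/andP; split; lra.
- by move=> l; case: (phiP l).
- by move=> l; case: (phiP l).
move=> k l kl; have sc := le_cut kl.
have mul := expectM_path_after V (a k.+1) (b k.+1) (a l.+1) (b l.+1)
  (cut_ge0 k) (cut_le k) sc (cut_le l) cF cF FC FC.
have -> : \int[P]_w ((F (X' k w) - m k) * (F (X' l w) - m l)) =
  \int[P]_w (F (X' k w) * F (X' l w) + (- m l * F (X' k w) + (- m k * F (X' l w) + m k * m l))).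
  by apply: eq_Rintegral => w _; ring.
have bc := @bounded_rv_cst R _ T (m k * m l).
have bk := bounded_rvZ (- m l) (bF k); have bl := bounded_rvZ (- m k) (bF l).
rewrite expectD; [|exact: bounded_rvM|exact: bounded_rvD bk (bounded_rvD bl bc)].
rewrite expectD//; last exact: bounded_rvD bl bc.
rewrite expectD// expect_cst !expectZ// [X in X + _]mul -/(m k) -/(m l); ring.
Qed.

(** [F (X l)] differs from [F (X' l)] by little outside of events whose
    indicators average out, and likewise for the expectations, whose averages
    converge to the mean under the limit law. *)
Lemma havg_lipschitz_window_ae (F : skorohod R -> R) C K : continuous F ->
  (forall x, 0 <= F x <= C) -> 0 <= K ->
  (forall x y, `|F x - F y| <= K * mdist x y) ->
  {ae P, forall w, havg (fun l => F (X l w)) n @[n --> \oo] -->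
     \int[P']_w F (levy_restrict Y w)}.
Proof.
move=> cF FC K0 FK.
have FN x : `|F x| <= C by have /andP[? ?] := FC x; rewrite ger0_norm.
have C0 : 0 <= C by exact: le_trans (normr_ge0 _) (FN point).
have /choice[E EP] : forall j : nat, exists E : nat -> set T, exists2 K,
    0 <= K & forall l, [/\ measurable (E l), fine (P (E l)) <= K / H l.+1 ^+ 2 &
      forall w, ~ E l w -> mdist (X l w) (X' l w) <= j.+1%:R^-1].
  by move=> j; apply: exceptional_events; rewrite invr_gt0.
have aeE : {ae P, forall w, forall j,
    havg (fun l => \1_(E j l) w) n @[n --> \oo] --> (0 : R)}.
  apply/ae_foralln => j; have [Kj _ EjP] := EP j.
  by apply: (havg_indic_ae (K := Kj)) => l; have [] := EjP l.
have aeC := havg_centered_ae cF FC.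
apply: filterS2 aeE aeC => w indic_cvg centered_cvg.
have bX l : bounded_rv (fun w => F (X l w)).
  apply: (bounded_rvP (C := C)) => [|v]; last exact: FN.
  by apply: measurable_continuous_comp => //; exact: measurable_X.
have bX' l : bounded_rv (fun w => F (X' l w)).
  apply: (bounded_rvP (C := C)) => [|v]; last exact: FN.
  by apply: measurable_continuous_comp => //; exact: measurable_X'.
have mean_cvg : \int[P]_w F (X l w) @[l --> \oo] --> \int[P']_w F (levy_restrict Y w).
  have := cvg_expect_rescale X_cvg cF (ex_intro _ C FN).
  by rewrite -(cvg_shiftS (fun n => \int[P]_w F (levy_rescale V (s n) (a n) (b n) w))).
set m := \int[P']_w _ in mean_cvg *.
apply/cvgrPdist_le => e e0.
pose j := Num.truncn (K * (8 / e)).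
have Kj : K * j.+1%:R^-1 <= e / 8.
  rewrite ler_pdivrMr//; have : K * (8 / e) <= j.+1%:R by exact/ltW/truncnS_gt.
  by rewrite mulrA ler_pdivrMr// => ?; lra.
have [K' K'0 EjP] := EP j.
have mE l : measurable (E j l) by have [] := EjP l.
have near_F l v : `|F (X l v) - F (X' l v)| <= e / 8 + C * \1_(E j l) v.
  have [vE|vE] := pselect (E j l v).
    rewrite indicE mem_set//= mulr1; apply: (@le_trans _ _ C); last by lra.
    have /andP[? ?] := FC (X l v); have /andP[? ?] := FC (X' l v).
    by rewrite ler_norml; apply/andP; split; lra.
  rewrite indicE memNset//= mulr0 addr0; apply: le_trans (FK _ _) _.
  apply: le_trans Kj; apply: ler_wpM2l => //.
  by have [_ _] := EjP l; apply.
have near_mean l : `|\int[P]_w F (X l w) - \int[P]_w F (X' l w)| <=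
    e / 8 + C * fine (P (E j l)).
  rewrite -expectB//.
  have bd := bounded_rvB (bX l) (bX' l).
  apply: le_trans (le_normr_Rintegral _ (bounded_rv_integrable P bd)) _ => //.
  have bi := @bounded_rv_indic R _ _ _ (mE l).
  have bCi := bounded_rvZ C bi.
  rewrite -expect_indic// -expectZ// -(expect_cst P (e / 8)) -expectD//; last first.
    exact: bounded_rv_cst.
  apply: le_expect => //; first exact: bounded_rv_norm.
  by apply: bounded_rvD => //; exact: bounded_rv_cst.
have prob_cvg : fine (P (E j l)) @[l --> \oo] --> (0 : R).
  apply/cvgrPdist_le => e' e'0; move/cvgryPge: (@cvg_hsum R) => /(_ (1 + K' / e')).
  apply: filterS => l Hl; have [_ PEl _] := EjP l.
  rewrite sub0r normrN ger0_norm ?fine_ge0//; apply: le_trans PEl _.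
  have HlS : H l <= H l.+1 by exact: hsum_le.
  have K'e : 0 <= K' / e' by rewrite divr_ge0// ltW.
  have h1 : 1 <= H l.+1 by lra.
  have h0 : 0 < H l.+1 by lra.
  rewrite ler_pdivrMr ?exprn_gt0// mulrC -ler_pdivrMr//.
  apply: (@le_trans _ _ (H l.+1)); first by lra.
  by rewrite expr2 ler_peMr// ltW.
have prob_havg := havg_cvg prob_cvg.
have mean_havg := havg_cvg mean_cvg.
have C1 : 0 < 8 * (C + 1) by rewrite mulr_gt0// ltr_wpDl.
have e1 : 0 < e / (8 * (C + 1)) by rewrite divr_gt0.
have n1 : \forall n \near \oo, `|havg (fun l => \1_(E j l) w) n| <= e / (8 * (C + 1)).
  have /cvgrPdist_le/(_ _ e1) := indic_cvg j.
  by apply: filterS => n; rewrite sub0r normrN.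
have n2 : \forall n \near \oo, `|havg (fun l => fine (P (E j l))) n| <= e / (8 * (C + 1)).
  have /cvgrPdist_le/(_ _ e1) := prob_havg.
  by apply: filterS => n; rewrite sub0r normrN.
have n3 : \forall n \near \oo,
    `|havg (fun l => F (X' l w) - \int[P]_w F (X' l w)) n| <= e / 8.
  have /cvgrPdist_le/(_ (e / 8) ltac:(lra)) := centered_cvg.
  by apply: filterS => n; rewrite sub0r normrN.
have n4 : \forall n \near \oo, `|m - havg (fun l => \int[P]_w F (X l w)) n| <= e / 8.
  by have /cvgrPdist_le/(_ (e / 8) ltac:(lra)) := mean_havg.
near=> n.
have n0 : (0 < n)%N by near: n; exact: nbhs_infty_gt.
have Ce : C * (e / (8 * (C + 1))) <= e / 8.
  rewrite mulrA ler_pdivrMr// (_ : e / 8 * (8 * (C + 1)) = C * e + e); last by field.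
  by rewrite lerDl ltW.
have h1 : `|havg (fun l => \1_(E j l) w) n| <= e / (8 * (C + 1)) by near: n.
have h2 : `|havg (fun l => fine (P (E j l))) n| <= e / (8 * (C + 1)) by near: n.
have h3 : `|havg (fun l => F (X' l w) - \int[P]_w F (X' l w)) n| <= e / 8 by near: n.
have h4 : `|m - havg (fun l => \int[P]_w F (X l w)) n| <= e / 8 by near: n.
have g1 : `|havg (fun l => F (X l w) - F (X' l w)) n| <= e / 4.
  apply: le_trans (havg_norm _ _) _.
  apply: le_trans (havg_le _ (fun l => near_F l w)) _.
  rewrite havgD havg_cst// havgZ; have := ler_wpM2l C0 (le_trans (ler_norm _) h1).
  by lra.
have g2 : `|havg (fun l => \int[P]_w F (X l w) - \int[P]_w F (X' l w)) n| <= e / 4.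
  apply: le_trans (havg_norm _ _) _.
  apply: le_trans (havg_le _ near_mean) _.
  rewrite havgD havg_cst// havgZ; have := ler_wpM2l C0 (le_trans (ler_norm _) h2).
  by lra.
move: h3 h4 g1 g2; rewrite !havgB !ler_norml.
by move=> /andP[? ?] /andP[? ?] /andP[? ?] /andP[? ?]; apply/andP; split; lra.
Unshelve. all: by end_near. Qed.

End window.

Lemma havg_lipschitz_ae (F : skorohod R -> R) C K : continuous F ->
  (forall x, 0 <= F x <= C) -> 0 <= K ->
  (forall x y, `|F x - F y| <= K * mdist x y) ->
  {ae P, forall w, havg (fun l => F (X l w)) n @[n --> \oo] -->
     \int[P']_w F (levy_restrict Y w)}.
Proof.
have [phi phiP] := @cut_index_ex R.
move=> cF FC K0 FK; exact: (havg_lipschitz_window_ae phiP cF FC K0 FK).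
Qed.

Lemma weak_cvg_log_average_ae :
  {ae P, forall w, weak_cvg
    (log_average (fun k => levy_rescale V (s k) (a k) (b k) w))
    (pushforward P' (levy_restrict Y))}.
Proof.
pose Q n w := if @unpickle (seq bump_code) n is Some c then
  havg (fun l => bump_max c (X l w)) n @[n --> \oo] -->
    \int[P']_w bump_max c (levy_restrict Y w) else True.
have : {ae P, forall w n, Q n w}.
  apply/ae_foralln => n; rewrite /Q; case: unpickle => [c|]; last exact: aeW.
  have [K K0 cK] := @bump_max_lip R c; have [C cC] := @bump_max_bounded R c.
  apply: (havg_lipschitz_ae (C := C) (K := K)) => //.
    exact: bump_max_continuous.
  move=> x; rewrite bump_max_ge0 /=; exact: le_trans (ler_norm _) (cC x).
apply: filterS => w Qw.
apply: weak_cvg_log_average; first exact: measurable_levy_restrict.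
move=> c; have := Qw (pickle c); by rewrite /Q pickleK.
Qed.

End almost_sure_limit.

Theorem theorem5 (R : realType)
    (d : measure_display) (T : measurableType d) (P : probability T R)
    (V : levy_process P)
    (a b : nat -> R) (s : nat -> {posnum R})
    (ha : forall n : nat, (0 < n)%N -> a n != 0)
    (hs : (s n)%:num @[n --> \oo] --> +oo)
    (alpha : R) (halpha : 0 < alpha <= 2)
    (d' : measure_display) (T' : measurableType d') (P' : probability T' R)
    (Y : levy_process P') (hY : stable_levy_process alpha Y)
    (hbeta : exists2 beta : R, 0 < beta &
       forall m n : nat, (0 < m)%N -> (m <= n)%N ->
         (s m)%:num / m%:R `^ beta <= (s n)%:num / n%:R `^ beta)
    (hcvg : cvg_in_distribution P P'
       (fun n => levy_rescale V (s n) (a n) (b n)) (levy_restrict Y)) :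
  {ae P, forall w : T,
    weak_cvg (log_average (fun k => levy_rescale V (s k) (a k) (b k) w))
             (pushforward P' (levy_restrict Y))}.
Proof.
have [beta beta0 s_growth] := hbeta.
exact: weak_cvg_log_average_ae beta0 s_growth hcvg.
Qed.
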